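(* Let $(X,T)$ be an essentially free singly generated dynamical system, with $X$ a nonempty Hausdorff, second countable, locally compact space. Assume that for every nonempty open set $U\subset X$ and every $x\in X$, there exist $m,n\in\mathbf N$ such that $x\in\mathrm{dom}(T^n)$ and $T^nx\in T^m(U)$. Then the C$^*$-algebra $C^*(X,T)$ is simple.
   Context: A singly generated dynamical system (SGDS) is a pair $(X,T)$ where $X$ is a topological space and $T$ is a local homeomorphism from an open subset $\mathrm{dom}(T)$ of $X$ onto an open subset $\mathrm{ran}(T)$ of $X$. For $n\in\mathbf N=\{0,1,2,\dots\}$, $T^n$ is the $n$-fold composition with its natural (open) domain $\mathrm{dom}(T^n)$, and $T^0=\mathrm{id}_X$. For $U\subset X$, $T^m(U)$ means $T^m(U\cap\mathrm{dom}(T^m))$. $(X,T)$ is essentially free if for every pair of distinct $m,n\in\mathbf N$ there is no nonempty open set (contained in $\mathrm{dom}(T^m)\cap\mathrm{dom}(T^n)$) on which $T^m$ and $T^n$ agree. The semidirect product groupoid is $$G(X,T)=\{(x,m-n,y): m,n\in\mathbf N,\ x\in \mathrm{dom}(T^m),\ y\in\mathrm{dom}(T^n),\ T^mx=T^ny\},$$ with unit space $X$, range $(x,k,y)\mapsto x$, source $(x,k,y)\mapsto y$, product $(x,k,y)(y,l,z)=(x,k+l,z)$, inverse $(x,k,y)^{-1}=(y,-k,x)$, and the topology with basic open sets $\{(x,m-n,y):(x,y)\in U\times V,\ T^mx=T^ny\}$, where $U$ (resp. $V$) is an open subset of $\mathrm{dom}(T^m)$ (resp. $\mathrm{dom}(T^n)$)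 on which $T^m$ (resp. $T^n$) is injective. It is a Hausdorff locally compact étale groupoid, and $C^*(X,T)=C^*(G(X,T))$ is its groupoid C$^*$-algebra (full and reduced C$^*$-algebras coincide). *)

(* Defs.v *)
From HB Require Import structures.
From mathcomp Require Import all_boot all_order all_algebra.
From mathcomp Require Import complex.
From mathcomp Require Import all_classical all_reals all_analysis.
From mathcomp Require Import zify.

Set Implicit Arguments.
Unset Strict Implicit.
Unset Printing Implicit Defensive.

Import Order.TTheory GRing.Theory Num.Theory.
Import numFieldNormedType.Exports.

Local Open Scope classical_set_scope.
Local Open Scope ring_scope.

Definition homeomorphism_on (X Y : topologicalType) (U : set X) (V : set Y)
    (f : X -> Y) : Prop :=
  exists g : Y -> X,
    [/\ f @` U = V,
        forall x, U x -> g (f x) = x,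
        {within U, continuous f} &
        {within V, continuous g}].

(* [f] is a total function, but only its values on [D] are meaningful. *)
Definition local_homeomorphism (X : topologicalType) (D : set X)
    (f : X -> X) : Prop :=
  forall x, D x -> exists U : set X,
    [/\ open U, U x, U `<=` D, open (f @` U) &
        homeomorphism_on U (f @` U) f].

Record sgds (X : topologicalType) := Sgds {
  sgds_map :> X -> X;
  sgds_dom : set X;
  sgds_dom_open : open sgds_dom;
  sgds_ran_open : open (sgds_map @` sgds_dom);
  sgds_local_homeo : local_homeomorphism sgds_dom sgds_map
}.

Section Iterates.
Context {X : topologicalType} (T : sgds X).

Definition iter_dom (n : nat) : set X :=
  [set x | forall k, (k < n)%N -> sgds_dom T (iter k T x)].

Definition iter_image (m : nat) (U : set X) : set X :=
  iter m T @` (U `&` iter_dom m).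

Definition essentially_free : Prop :=
  forall m n : nat, m <> n -> forall U : set X,
    open U -> U `<=` iter_dom m `&` iter_dom n ->
    (forall x, U x -> iter m T x = iter n T x) -> U = set0.

Lemma iter_domD m n x :
  iter_dom (m + n) x <-> iter_dom m x /\ iter_dom n (iter m T x).
Proof.
split=> [h|[h1 h2] k kmn].
  split=> k kn; first by apply: h; lia.
  by rewrite -iterD; apply: h; lia.
have [km|mk] := ltnP k m; first exact: h1.
by rewrite -(subnK mk) iterD; apply: h2; lia.
Qed.

Definition injective_on (n : nat) (U : set X) : Prop :=
  [/\ open U, U `<=` iter_dom n &
      forall x y, U x -> U y -> iter n T x = iter n T y -> x = y].

Lemma injective_onI n U V :
  injective_on n U -> open V -> injective_on n (U `&` V).
Proof.
move=> [oU Un injU] oV; split; first exact: openI.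
  by move=> x [/Un].
by move=> x y [Ux _] [Uy _]; apply: injU.
Qed.

Lemma injective_on_exists n x :
  iter_dom n x -> exists U, injective_on n U /\ U x.
Proof.
elim: n x => [|n IHn] x xn.
  by exists setT; split=> //; split=> //; exact: openT.
have Dx : sgds_dom T x by exact: (xn 0%N).
have [|V [[oV Vn injV] Vx]] := IHn (T x).
  by have /(iter_domD 1 n) [] : iter_dom (1 + n) x by [].
have [U [oU Ux UD _ [g [_ gK + _]]]] := sgds_local_homeo Dx.
rewrite continuous_open_subspace// => cT.
have iS z : iter n.+1 T z = iter n T (T z) by rewrite iterSr.
exists (U `&` T @^-1` V); split=> //; split.
- rewrite openE => y [Uy Vy]; apply: filterI; first exact: open_nbhs_nbhs.
  by apply: (cT y (mem_set Uy)); exact: open_nbhs_nbhs.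
- move=> y [Uy Vy]; apply/(iter_domD 1 n); split; last exact: Vn.
  by move=> [|//] _; exact: UD.
- move=> y z [Uy Vy] [Uz Vz]; rewrite !iS => /injV - /(_ Vy Vz) e.
  by rewrite -(gK y Uy) e gK.
Qed.

End Iterates.

Section Groupoid.
Context {X : topologicalType} (T : sgds X).

Record arrow := Arrow {
  range_of : X;
  degree : int;
  source_of : X;
  arrowP : exists m n : nat,
    [/\ degree = m%:Z - n%:Z, iter_dom T m range_of, iter_dom T n source_of &
        iter m T range_of = iter n T source_of]
}.

Lemma arrow_mul_subproof (a b : arrow) : source_of a = range_of b ->
  exists m n : nat,
    [/\ degree a + degree b = m%:Z - n%:Z,
        iter_dom T m (range_of a), iter_dom T n (source_of b) &
        iter m T (range_of a) = iter n T (source_of b)].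
Proof.
case: a b => [x k y [m [n [ek xm yn emn]]]] [y' l z [p [q [el yp zq epq]]]] /=.
move=> eyy; move: y' eyy yp epq => _ <- yp epq.
have [np|/ltnW pn] := leqP n p.
- have ep : p = (n + (p - n))%N by lia.
  exists (m + (p - n))%N, q; split=> //; first by rewrite ek el; lia.
    by apply/iter_domD; split=> //; rewrite emn; move: yp; rewrite ep
      => /iter_domD []; rewrite addKn.
  by rewrite -epq addnC iterD emn -iterD subnK.
- have en : n = (p + (n - p))%N by lia.
  exists m, (q + (n - p))%N; split=> //; first by rewrite ek el; lia.
    by apply/iter_domD; split=> //; rewrite -epq; move: yn; rewrite en
      => /iter_domD []; rewrite addKn.
  by rewrite emn [in RHS]addnC iterD -epq -iterD subnK.
Qed.

Definition arrow_mul (a b : arrow) (ab : source_of a = range_of b) : arrow :=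
  Arrow (arrow_mul_subproof ab).

Lemma arrow_inv_subproof (a : arrow) : exists m n : nat,
  [/\ - degree a = m%:Z - n%:Z, iter_dom T m (source_of a),
      iter_dom T n (range_of a) &
      iter m T (source_of a) = iter n T (range_of a)].
Proof.
have [m [n [-> xm yn e]]] := arrowP a.
by exists n, m; split=> //; rewrite opprB.
Qed.

Definition arrow_inv (a : arrow) : arrow := Arrow (arrow_inv_subproof a).

Definition basic_index : Type := nat * nat * set X * set X.

Definition basic_indices : set basic_index :=
  [set i | let: (m, n, U, V) := i in injective_on T m U /\ injective_on T n V].

Definition basic_open (i : basic_index) : set arrow :=
  let: (m, n, U, V) := i in
  [set a | [/\ degree a = m%:Z - n%:Z, U (range_of a), V (source_of a) &
               iter m T (range_of a) = iter n T (source_of a)]].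

Lemma basic_open_cover :
  \bigcup_(i in basic_indices) basic_open i = setT.
Proof.
apply/seteqP; split=> // -[x k y [m [n [ek xm yn e]]]] _.
have [U [iU Ux]] := injective_on_exists xm.
have [V [iV Vy]] := injective_on_exists yn.
by exists (m, n, U, V).
Qed.

Lemma basic_open_join i j a :
  basic_indices i -> basic_indices j -> basic_open i a -> basic_open j a ->
  exists k, [/\ basic_indices k, basic_open k a &
                basic_open k `<=` basic_open i `&` basic_open j].
Proof.
wlog : i j / (i.1.1.1 <= j.1.1.1)%N => [wl|].
  have [ij|/ltnW ji] := leqP i.1.1.1 j.1.1.1; first exact: wl.
  move=> Di Dj ai aj; have [k [Dk ak kij]] := wl _ _ ji Dj Di aj ai.
  by exists k; split=> //; rewrite setIC.
case: i j => [[[m n] U] V] [[[p q] U'] V'] /= mp [iU iV] [[oU' _ _] [oV' _ _]].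
move=> [dmn Ua Va e] [dpq Ua' Va' _].
exists (m, n, U `&` U', V `&` V'); split=> //=.
  by split; apply: injective_onI.
move=> b [/= db [Ub Ub'] [Vb Vb'] eb]; split; split=> //.
  by rewrite db -dmn dpq.
have -> : p = ((p - m) + m)%N by lia.
have -> : q = ((p - m) + n)%N by lia.
by rewrite !iterD eb.
Qed.

End Groupoid.

HB.instance Definition _ (X : topologicalType) (T : sgds X) :=
  gen_eqMixin (arrow T).
HB.instance Definition _ (X : topologicalType) (T : sgds X) :=
  gen_choiceMixin (arrow T).
HB.instance Definition _ (X : topologicalType) (T : sgds X) :=
  @isBaseTopological.Build (arrow T) (nat * nat * set X * set X)%type
    (basic_indices T) (@basic_open X T)
    (basic_open_cover T) (@basic_open_join X T).

Section Convolution.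
Context (R : realType) {X : topologicalType} (T : sgds X).
Implicit Types f g : arrow T -> R[i]^o.

Definition Cc : set (arrow T -> R[i]^o) :=
  [set f | continuous f /\ compact (closure [set a | f a != 0])].

(* For [f] and [g] in [Cc] the sum has finitely many nonzero terms. *)
Definition convolution f g : arrow T -> R[i]^o := fun c =>
  \sum_(p \in [set p : arrow T * arrow T |
      exists ab : source_of p.1 = range_of p.2, arrow_mul ab = c])
    f p.1 * g p.2.

Definition involution f : arrow T -> R[i]^o := fun a => (f (arrow_inv a) : R[i])^*.

End Convolution.

Arguments Cc R {X} T.

(* [{dot _ for _}] is linear in its first argument and conjugate-linear in the
   second. *)
Record hilbertSpace (R : realType) := HilbertSpace {
  hilbert_space :> completeNormedModType R[i];
  inner : {dot hilbert_space for Num.conj};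
  inner_norm : forall v : hilbert_space, inner v v = `|v| ^+ 2
}.

Definition bounded_operator (R : realType) (H : hilbertSpace R)
    (A : H -> H) : Prop :=
  linear A /\ exists M : R[i], forall v, `|A v| <= M * `|v|.

(* Norms in an [R[i]]-module are elements of [R[i]]. *)
Definition operator_norm (R : realType) (H : hilbertSpace R)
    (A : H -> H) : \bar R :=
  ereal_sup [set (complex.Re `|A v|)%:E | v in [set v : H | `|v| <= 1]].

Record cstarAlgebra (R : realType) := CstarAlgebra {
  cstar_space :> completeNormedModType R[i];
  cmul : cstar_space -> cstar_space -> cstar_space;
  cstar : cstar_space -> cstar_space;
  cmulA : associative cmul;
  cmulDl : left_distributive cmul +%R;
  cmulDr : right_distributive cmul +%R;
  cmulZl : forall (k : R[i]) x y, cmul (k *: x) y = k *: cmul x y;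
  cmulZr : forall (k : R[i]) x y, cmul x (k *: y) = k *: cmul x y;
  cstarK : involutive cstar;
  cstarD : {morph cstar : x y / x + y};
  cstarZ : forall (k : R[i]) x, cstar (k *: x) = k^* *: cstar x;
  cstarM : forall x y, cstar (cmul x y) = cmul (cstar y) (cstar x);
  cmul_norm_le : forall x y, `|cmul x y| <= `|x| * `|y|;
  cstar_identity : forall x, `|cmul (cstar x) x| = `|x| ^+ 2
}.

Definition closed_ideal (R : realType) (A : cstarAlgebra R)
    (J : set A) : Prop :=
  [/\ J 0,
      forall x y, J x -> J y -> J (x + y),
      forall (k : R[i]) x, J x -> J (k *: x),
      forall a x, J x -> J (cmul a x) /\ J (cmul x a) &
      closed J].

Definition simple_cstar (R : realType) (A : cstarAlgebra R) : Prop :=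
  (exists x : A, x != 0) /\
  forall J : set A, closed_ideal J -> J = [set 0] \/ J = setT.

Section GroupoidCstar.
Context (R : realType) {X : topologicalType} (T : sgds X).

(* Representations and homomorphisms of the convolution algebra are total on
   functions, but only their values on [Cc] are constrained or used. *)
Record star_representation (H : hilbertSpace R)
    (pi : (arrow T -> R[i]^o) -> H -> H) : Prop := {
  rep_bounded : forall f, Cc R T f -> bounded_operator (pi f);
  repD : forall f g, Cc R T f -> Cc R T g ->
    forall v, pi (f \+ g) v = pi f v + pi g v;
  repZ : forall (k : R[i]) f, Cc R T f ->
    forall v, pi (fun a => k * f a) v = k *: pi f v;
  repM : forall f g, Cc R T f -> Cc R T g ->
    forall v, pi (convolution f g) v = pi f (pi g v);
  rep_star : forall f, Cc R T f ->
    forall v w, inner H (pi f v) w = inner H v (pi (involution f) w)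
}.

Definition full_norm (f : arrow T -> R[i]^o) : \bar R :=
  ereal_sup [set r | exists (H : hilbertSpace R)
      (pi : (arrow T -> R[i]^o) -> H -> H),
    star_representation pi /\ r = operator_norm (pi f)].

(* [A], with the canonical map [iota], is the completion of [Cc] for the full
   norm; this determines [A] up to a unique isomorphism. *)
Record is_groupoid_cstar (A : cstarAlgebra R)
    (iota : (arrow T -> R[i]^o) -> A) : Prop := {
  iotaD : forall f g, Cc R T f -> Cc R T g -> iota (f \+ g) = iota f + iota g;
  iotaZ : forall (k : R[i]) f, Cc R T f ->
    iota (fun a => k * f a) = k *: iota f;
  iotaM : forall f g, Cc R T f -> Cc R T g ->
    iota (convolution f g) = cmul (iota f) (iota g);
  iota_star : forall f, Cc R T f -> iota (involution f) = cstar (iota f);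
  iota_dense : closure (iota @` Cc R T) = setT;
  iota_norm : forall f, Cc R T f -> (complex.Re `|iota f|)%:E = full_norm f
}.

End GroupoidCstar.

(* Main.v *)
(* The conditional expectation onto functions on the unit space restricts a
   function to the units. It detects ideals because the groupoid is amenable:
   weights cut off along the orbits of T give functions h of positive type that
   tend to 1 uniformly on compact sets, with [h f = sum s_i E(s_i^* f s_j) s_j^*]
   for finitely many s_i, and multiplication by h is bounded by 8 in norm. Hence
   an ideal whose elements have zero expectation is zero. If b in an ideal J has
   a nonzero expectation, approximate b by f in Cc. By essential freeness there
   is an open set W such that the only arrows in the support of f with both ends
   in W are units; compressing b by functions supported in W produces an element
   of J within 1/2 of a function of the unit space equal to 1 on a smaller open
   set, so J contains all functions supported in that set. Minimality connects
   every point to this set by an arrow, and J is everything. *)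

From HB Require Import structures.
From mathcomp Require Import all_boot all_order all_algebra.
From mathcomp Require Import finmap complex.
From mathcomp Require Import all_classical all_reals all_analysis.
From mathcomp Require Import zify ring lra.
Require Import Defs.

Set Implicit Arguments.
Unset Strict Implicit.
Unset Printing Implicit Defensive.

Import Order.TTheory GRing.Theory Num.Theory.
Import numFieldNormedType.Exports.

Local Open Scope classical_set_scope.
Local Open Scope ring_scope.

Local Notation "x %:C" := (real_complex _ x) : ring_scope.
Local Notation Re := complex.Re.
Local Notation Im := complex.Im.

(** * Bump functions and partitions of unity *)

(** The norm of [A] is only given as a supremum over all representations, and elements of [A] are
    not functions. Three devices replace spectral theory and complete positivity. An inequality with
    an uncontrolled constant is applied to powers of order $2^n$, where the constant becomes
    harmless: this bounds functions on the unit space by their suprema, and multipliers of positive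
    type by their values on units. Positivity is exhibited as an explicit sum of terms $v^* v$,
    built from partitions of unity whose squares add up to 1. A map defined on functions only
    vanishes at an element of [A] when it is small on all functions near that element. The constant
    8 is $4 \cdot 2$: polarization costs 4 in passing from numerical values to norms, and a function
    splits into 2 self-adjoint parts. The 1/2 arises because [f] exceeds $e$ in modulus on the open
    set and lies within $e/2$ of [b], while dividing by [f] costs $1/e$. The multiplier [h] kills
    [a] in the ideal because every $s_i^* a s_j$ is again in the ideal and has expectation zero. *)

Definition csupp {Y : topologicalType} {V : zmodType} (f : Y -> V) : set Y :=
  closure [set y | f y != 0].

Lemma csupp_out {Y : topologicalType} {V : zmodType} (f : Y -> V) y :
  ~ csupp f y -> f y = 0.
Proof.
move=> nfy; apply: contrapT => /eqP fy; apply: nfy.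
exact: subset_closure.
Qed.

Lemma csupp_sub {Y : topologicalType} {V : zmodType} (f : Y -> V) (K : set Y) :
  closed K -> (forall y, ~ K y -> f y = 0) -> csupp f `<=` K.
Proof.
move=> /closure_id cK f0; rewrite [X in _ `<=` X]cK; apply: closureS.
by move=> y /= /eqP fy; apply: contrapT => /f0.
Qed.

Lemma csupp_imp {Y : topologicalType} {V W : zmodType} (f : Y -> V)
    (g : Y -> W) :
  (forall y, f y = 0 -> g y = 0) -> csupp g `<=` csupp f.
Proof.
by move=> fg; apply: closureS => y /=; apply: contra => /eqP /fg ->.
Qed.

Lemma csupp_compact {Y : topologicalType} {V : zmodType} (f : Y -> V)
    (K : set Y) :
  closed K -> compact K -> (forall y, ~ K y -> f y = 0) -> compact (csupp f).
Proof.
move=> cK kK f0; apply: subclosed_compact kK _; first exact: closed_closure.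
exact: csupp_sub.
Qed.

(** Off its closed support a function is zero near the point. This is how functions given by a
    formula that is continuous only on an open set are extended by zero. *)
Lemma continuous_csupp {Y : topologicalType} {V : topologicalZmodType}
    (f : Y -> V) :
  (forall y, csupp f y -> {for y, continuous f}) -> continuous f.
Proof.
move=> cf y; have [/cf//|nfy] := pselect (csupp f y).
have f0 : \forall z \near y, 0 = f z.
  have : open_nbhs y (~` csupp f).
    by split=> //; exact/closed_openC/closed_closure.
  move=> /open_nbhs_nbhs; apply: filterS => z nfz.
  by rewrite (csupp_out nfz).
rewrite /continuous_at -(nbhs_singleton f0).
exact: cvg_trans (near_eq_cvg f0) (cvg_cst _).
Qed.

Lemma compact_finite_nbhs {Y : topologicalType} (K : set Y) (f : Y -> set Y) :
  compact K -> (forall a, K a -> nbhs a (f a)) ->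
  exists s : seq Y, (forall a, a \in s -> K a) /\
    forall y, K y -> exists2 a, a \in s & f a y.
Proof.
move=> /compact_near_coveringP cK fK.
(* The filter of finite lists growing by inclusion: a property holds near it when it holds for all
   extensions of some list, so near-covering compactness yields one list that serves all of [K]. *)
pose F : set_system (seq Y) := fun A =>
  exists s0 : seq Y, forall s, {subset s0 <= s} -> A s.
have FF : Filter F.
  split; first by exists [::].
  - move=> A B [s As] [t Bt]; exists (s ++ t) => u stu; split.
      by apply: As => y sy; apply: stu; rewrite mem_cat sy.
    by apply: Bt => y sy; apply: stu; rewrite mem_cat sy orbT.
  - by move=> A B AB [s As]; exists s => u /As /AB.
have := cK _ F (fun s y => exists a, [/\ a \in s, K a & f a y]) FF.
case=> [x Kx|s0 /(_ _ (fun _ h => h)) Ks0].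
  exists (f x, [set s : seq Y | x \in s]) => [|[y s] /= [fxy xs]]; last by exists x.
  split; first exact: fK.
  by exists [:: x] => s; apply; rewrite inE.
exists [seq a <- s0 | a \in K]; split.
  by move=> a; rewrite mem_filter => /andP[/set_mem].
move=> y /Ks0 [a [sa Ka fay]]; exists a => //.
by rewrite mem_filter sa andbT; exact: mem_set.
Qed.

Section Bumps.
Context {R : realType} {Y : topologicalType}.
Hypothesis hY : hausdorff_space Y.
Hypothesis lY : locally_compact [set: Y].

(** Complete regularity gives a function that is 0 at [a] and 1 off the interior of a neighbourhood
    whose closure lies in [O] and in a compact set; the bump is its complement to 1. *)
Lemma bump_exists (a : Y) (O : set Y) : open O -> O a ->
  exists b : Y -> R, [/\ continuous b, forall y, 0 <= b y <= 1, 0 < b a,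
    compact (csupp b) & csupp b `<=` O].
Proof.
move=> oO Oa.
have [K + [cK clK]] := lY (I : [set: Y] a).
rewrite withinET => Ka.
have crs := locally_compact_completely_regular (R := R) lY hY.
have [W Wa cW] : filter_from (nbhs a) closure (O `&` K).
  apply: (@completely_regular_regular R Y crs a); apply: filterI => //.
    exact: open_nbhs_nbhs.
have nWa : ~ (~` W°) a by move=> /(_ Wa).
have : uniform_separator [set a] (~` W°).
  by apply: crs => //; exact/open_closedC/open_interior.
move=> /(@uniform_separatorP _ R) [f [cf f01 f0 f1]].
have f01' y : 0 <= f y <= 1.
  by have /= := f01 (f y) (ex_intro2 _ _ y I erefl); rewrite in_itv.
have bW : csupp (fun y => 1 - f y) `<=` closure W.
  apply: closureS => y /=; apply: contraPP => nWy; apply/negP; rewrite negbK.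
  rewrite (f1 (f y)) ?subrr//; exists y => // Wy; apply: nWy.
  exact: interior_subset Wy.
exists (fun y => 1 - f y); split.
- by move=> y; apply: cvgB; [exact: cvg_cst|exact: cf].
- by move=> y; have /andP[? ?] := f01' y; apply/andP; split; lra.
- by rewrite (f0 (f a)) ?subr0//; exists a.
- apply: subclosed_compact cK _; first exact: closed_closure.
  by move=> y /bW /cW [].
- by move=> y /bW /cW [].
Qed.

(** The squares are normalized, since the functions will be placed on both sides of a product. The
    predicate [P] records what the supporting open sets are for: bisections, or open sets on which a
    given function does not vanish. *)
Lemma partition_of_unity (K : set Y) (P : set Y -> Prop) : compact K ->
  (forall a, K a -> exists O, [/\ open O, O a & P O]) ->
  exists (s : seq Y) (chi : Y -> Y -> R),
    [/\ forall a, a \in s -> [/\ continuous (chi a),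
          forall y, 0 <= chi a y <= 1, compact (csupp (chi a)) &
          exists O, [/\ open O, P O & csupp (chi a) `<=` O]],
        forall y, K y -> \sum_(a <- s) chi a y ^+ 2 = 1 &
        forall y, \sum_(a <- s) chi a y ^+ 2 <= 1].
Proof.
move=> cK KP.
have /choice [b bP] : forall a, exists b : Y -> R,
    [/\ continuous b, forall y, 0 <= b y <= 1, K a -> 0 < b a &
     K a -> compact (csupp b) /\
       exists O, [/\ open O, P O & csupp b `<=` O]].
  move=> a; have [Ka|nKa] := pselect (K a); last first.
    exists (fun=> 0); split=> // y; first exact: cvg_cst.
    by rewrite lexx ler01.
  have [V [oO Oa PO]] := KP a Ka.
  have [b [? ? ? ? ?]] := bump_exists oO Oa.
  by exists b; split=> // _; split=> //; exists V.
have cb a : continuous (b a) by have [] := bP a.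
have b01 a y : 0 <= b a y <= 1 by have [_ /(_ y)] := bP a.
have b0 a y : 0 <= b a y by have /andP[] := b01 a y.
have [s [sK KD]] : exists s : seq Y, (forall a, a \in s -> K a) /\
    forall y, K y -> exists2 a, a \in s & [set y | 0 < b a y] y.
  apply: compact_finite_nbhs cK _ => a Ka.
  apply: open_nbhs_nbhs; split; last by have [_ _ /(_ Ka)] := bP a.
  rewrite -[X in open X]/(b a @^-1` [set r | 0 < r]).
  by apply: open_comp => [y _|]; [exact: cb|exact: open_gt].
pose S y := \sum_(a <- s) b a y.
have S0 y : 0 <= S y by apply: sumr_ge0 => a _; exact: b0.
have cS : continuous S.
  by apply: continuous_big => [|a _]; [exact: add_continuous|exact: cb].
have SK y : K y -> 0 < S y.
  move=> /KD [a Da /= ba]; apply: lt_le_trans ba _.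
  rewrite /S (big_rem a)//= lerDl; apply: sumr_ge0 => i _; exact: b0.
have [c c0 cSK] : exists2 c : R, 0 < c & forall y, K y -> c <= S y.
  have [K0|/set0P K0] := eqVneq K set0.
    by exists 1 => // y; rewrite K0.
  have [|y] := @compact_EVT_min Y R S K K0 cK.
    by apply: continuous_subspaceT.
  by rewrite inE => Ky yS; exists (S y) => [|z Kz]; [exact: SK|apply: yS; rewrite inE].
pose N y := Num.max (S y) c.
have N0 y : 0 < N y by rewrite /N lt_max c0 orbT.
have SN y : S y <= N y by rewrite /N le_max lexx.
have cN : continuous N.
  by move=> y; apply: continuous_max; [exact: cS|exact: cvg_cst].
pose chi a y := Num.sqrt (b a y / N y).
have chi2 a y : chi a y ^+ 2 = b a y / N y.
  by rewrite sqr_sqrtr// divr_ge0// ltW.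
have sum2 y : \sum_(a <- s) chi a y ^+ 2 = S y / N y.
  by rewrite /S mulr_suml; apply: eq_bigr => a _; exact: chi2.
have bN a y : a \in s -> b a y / N y <= 1.
  move=> sa; rewrite ler_pdivrMr// mul1r (le_trans _ (SN y))//.
  by rewrite /S (big_rem a)//= lerDl; apply: sumr_ge0 => i _; exact: b0.
exists s, chi; split.
- move=> a sa; have [_ _ _ /(_ (sK _ sa)) [kb [V [oO PO bO]]]] := bP a.
  have cb0 : csupp (chi a) `<=` csupp (b a).
    by apply: csupp_imp => y by0; rewrite /chi by0 mul0r sqrtr0.
  split.
  + move=> y; apply: continuous_comp; last exact: sqrt_continuous.
    apply: cvgM; first exact: cb.
    by apply: cvgV; [rewrite gt_eqF|exact: cN].
  + move=> y; rewrite sqrtr_ge0 /= -sqrtr1 ler_sqrt ?ler01//; exact: bN.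
  + by apply: subclosed_compact kb cb0; exact: closed_closure.
  + by exists V; split=> //; exact: subset_trans cb0 bO.
- move=> y Ky; rewrite sum2; have -> : N y = S y.
    by apply/max_idPl; exact: cSK.
  by rewrite divff// gt_eqF// SK.
- by move=> y; rewrite sum2 ler_pdivrMr// mul1r.
Qed.
End Bumps.

(** * The Hilbert space of square summable families *)

Section ComplexNorm.
Context {R : realType}.
Implicit Types z : R[i].

Lemma normc_ge_Im z : `|Im z|%:C <= `|z|.
Proof.
rewrite normc_def lecR -sqrtr_sqr ler_wsqrtr// lerDr; exact: sqr_ge0.
Qed.

Lemma normc_le_ReIm z : `|z| <= (`|Re z| + `|Im z|)%:C.
Proof.
rewrite {1}(complexE z) (le_trans (ler_normD _ _))//.
have -> : (`|Re z| + `|Im z|)%:C =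
    `|Re z|%:C + `|Im z|%:C by exact: rmorphD.
rewrite normrM; have -> : `|'i%C| = 1 :> R[i].
  by rewrite normc_def/= expr0n expr1n/= add0r sqrtr1.
by rewrite mul1r !normc_def/= expr0n/= !addr0 !sqrtr_sqr.
Qed.

Lemma complex_cauchy_cvg (F : set_system R[i]) : ProperFilter F ->
  (forall e : R, 0 < e -> exists z, F [set w | `|w - z| < e%:C]) ->
  exists l, forall e : R, 0 < e -> F [set w | `|w - l| < e%:C].
Proof.
move=> PF cF.
have cvgF (f : R[i] -> R) : (forall z w, `|f z - f w|%:C <= `|z - w|) ->
    cvg (f @ F).
  move=> fle; apply: (@R_complete R (f @ F)); apply: cauchy_exP => e e0.
  have [z Fz] := cF e e0; exists (f z).
  suff : F (f @^-1` ball (f z) e) by [].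
  apply: filterS Fz => w /= wz.
  rewrite /ball/= distrC; have := le_lt_trans (fle w z) wz.
  by rewrite ltcR.
have cRe : cvg (@Re R @ F).
  by apply: cvgF => z w; rewrite -raddfB; exact: normc_ge_Re.
have cIm : cvg (@Im R @ F).
  by apply: cvgF => z w; rewrite -raddfB; exact: normc_ge_Im.
set a := lim (@Re R @ F) in cRe; set b := lim (@Im R @ F) in cIm.
exists (Complex a b) => e e0; have e20 : 0 < e / 2 by rewrite divr_gt0.
have /cvgrPdist_lt/(_ _ e20) FR := cRe.
have /cvgrPdist_lt/(_ _ e20) FI := cIm.
apply: filterS (filterI FR FI) => w /= [wa wb].
apply: (le_lt_trans (normc_le_ReIm _)); rewrite ltcR !raddfB/= (splitr e).
by rewrite ltrD// distrC.
Qed.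

Lemma Re_normc (V : normedZmodType R[i]) (v : V) :
  (Re `|v|)%:C = `|v|.
Proof. by rewrite RRe_real// normr_real. Qed.

Implicit Types x y : R.

Lemma rcD x y : (x + y)%:C = x%:C + y%:C. Proof. exact: rmorphD. Qed.
Lemma rcB x y : (x - y)%:C = x%:C - y%:C. Proof. exact: rmorphB. Qed.
Lemma rcM x y : (x * y)%:C = x%:C * y%:C. Proof. exact: rmorphM. Qed.
Lemma rcX x n : (x ^+ n)%:C = x%:C ^+ n. Proof. exact: rmorphXn. Qed.
Lemma rc_sum (J : Type) (r : seq J) (F : J -> R) :
  (\sum_(j <- r) F j)%:C = \sum_(j <- r) (F j)%:C.
Proof. exact: rmorph_sum. Qed.
Lemma rc_conj x : x%:C^* = x%:C.
Proof. by rewrite conj_Creal// complex_real. Qed.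
Lemma rc_norm x : `|x%:C| = `|x|%:C.
Proof. by rewrite normc_def/= expr0n/= addr0 sqrtr_sqr. Qed.

Lemma Im_real z : z \is Num.real -> Im z = 0.
Proof. by case: z => a b; rewrite complex_real => /eqP. Qed.

End ComplexNorm.

(** * Unconditional sums and square summable families *)

Section HasSum.
Context {R : realType} {I : choiceType}.
Local Notation C := R[i].
Implicit Types (u v : I -> C) (F : {fset I}).

(** Convergence along finite subsets ordered by inclusion, since the index type, later the arrows,
    carries no order and may be uncountable. *)
Definition has_sum u (s : C) := forall e : C, 0 < e ->
  exists F0 : {fset I}, forall F, (F0 `<=` F)%fset ->
    `|\sum_(i <- F) u i - s| < e.

Lemma has_sum_uniq u s t : has_sum u s -> has_sum u t -> s = t.
Proof.
move=> us ut; apply/eqP; rewrite -subr_eq0 -normr_le0.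
apply/ler_addgt0Pl => e e0; rewrite addr0.
have e20 : 0 < e / 2 by rewrite divr_gt0.
have [F Fs] := us _ e20; have [G Gt] := ut _ e20.
have := Fs (F `|` G)%fset (fsubsetUl _ _).
have := Gt (F `|` G)%fset (fsubsetUr _ _).
set S := \sum_(i <- _) _ => St Ss.
have -> : s - t = (S - t) - (S - s) by ring.
rewrite (le_trans (ler_normB _ _))// (splitr e).
by rewrite lerD// ltW.
Qed.

Lemma has_sumD u v s t : has_sum u s -> has_sum v t ->
  has_sum (fun i => u i + v i) (s + t).
Proof.
move=> us vt e e0; have e20 : 0 < e / 2 by rewrite divr_gt0.
have [F Fs] := us _ e20; have [G Gt] := vt _ e20.
exists (F `|` G)%fset => H; rewrite fsubUset => /andP[/Fs ? /Gt ?].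
rewrite big_split/= opprD addrACA (le_lt_trans (ler_normD _ _))// (splitr e).
exact: ltrD.
Qed.

Lemma has_sumZ u s (c : C) : has_sum u s -> has_sum (fun i => c * u i) (c * s).
Proof.
have [->|c0] := eqVneq c 0.
  move=> _ e e0; exists fset0 => F _.
  by rewrite big1 ?mul0r ?subrr ?normr0// => i _; rewrite mul0r.
move=> us e e0; have [|F Fs] := us (e / `|c|).
  by rewrite divr_gt0// normr_gt0.
exists F => G /Fs; rewrite -mulr_sumr -mulrBr normrM.
by rewrite ltr_pdivlMr ?normr_gt0// mulrC.
Qed.

Lemma has_sum_conj u s : has_sum u s -> has_sum (fun i => (u i)^*) s^*.
Proof.
move=> us e e0; have [F Fs] := us e e0; exists F => G /Fs.
by rewrite -rmorph_sum -rmorphB norm_conjC.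
Qed.

Lemma fsum_mono F1 F2 u : (forall i, 0 <= u i) -> (F1 `<=` F2)%fset ->
  \sum_(i <- F1) u i <= \sum_(i <- F2) u i.
Proof.
move=> u0 F12; rewrite (big_fsetID _ (mem F1) F2)/=.
rewrite (_ : [fset x in F2 | x \in F1]%fset = F1); last first.
  apply/fsetP => x; rewrite !inE/=.
  by apply/andP/idP => [[]//|xF]; split=> //; exact: (fsubsetP F12).
by rewrite lerDl; apply: sumr_ge0.
Qed.

Lemma has_sum_le u s F : (forall i, 0 <= u i) -> has_sum u s ->
  \sum_(i <- F) u i <= s.
Proof.
move=> u0 us.
have mono F1 F2 := @fsum_mono F1 F2 u u0.
have SR G : \sum_(i <- G) u i \is Num.real by apply/ger0_real/sumr_ge0.
(* In the order of the complex numbers a comparison includes equality of imaginary parts, so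
   [Im s = 0] has to be proved along with the bound on real parts. *)
have close (e : R) : 0 < e -> `|Im s| < e /\ Re (\sum_(i <- F) u i) < Re s + e.
  move=> e0; have [|G Gs] := us e%:C; first by rewrite ltcR.
  have /Gs h := fsubsetUr F G; split.
    have := le_lt_trans (normc_ge_Im _) h; rewrite ltcR raddfB/=.
    by rewrite (Im_real (SR _)) sub0r normrN.
  have := le_lt_trans (normc_ge_Re _) h; rewrite ltcR raddfB/= ltr_norml.
  move=> /andP[_ +]; have := mono _ _ (fsubsetUl F G); rewrite lecE => /andP[_ h1] h2.
  by lra.
rewrite lecE (Im_real (SR _)); apply/andP; split.
  by rewrite -normr_le0; apply/ler_addgt0Pl => e /close[/ltW]; rewrite addr0.
by apply/ler_addgt0Pl => e /close[_ /ltW]; rewrite addrC.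
Qed.
End HasSum.

Section SquareSummable.
Context {R : realType} {I : choiceType}.
Local Notation C := R[i].
Implicit Types (u v f g : I -> C) (F : {fset I}).

Lemma has_sum_ge0_exists u (M : R) : (forall i, 0 <= u i) ->
  (forall F, \sum_(i <- F) u i <= M%:C) ->
  exists2 s : C, has_sum u s & s <= M%:C.
Proof.
move=> u0 uM; pose A := [set Re (\sum_(i <- F) u i) | F in [set: {fset I}]].
have ubA : ubound A M.
  by move=> _ [F _ <-]; have := uM F; rewrite lecE => /andP[].
have supA : has_sup A.
  by split; [exists (Re (\sum_(i <- fset0) u i)), fset0|exists M].
have SE F : \sum_(i <- F) u i = (Re (\sum_(i <- F) u i))%:C.
  by rewrite RRe_real//; apply/ger0_real/sumr_ge0.
exists (sup A)%:C; last by rewrite lecR; exact: ge_sup (proj1 supA) ubA.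
move=> e e0; have re : e = (Re e)%:C by rewrite RRe_real// gtr0_real.
have e0' : 0 < Re e by rewrite -ltcR -re.
have [_ [F0 _ <-] F0s] := sup_adherent e0' supA.
exists F0 => F F0F.
have F0F' : Re (\sum_(i <- F0) u i) <= Re (\sum_(i <- F) u i).
  have := fsum_mono u0 F0F; rewrite lecE => /andP[]//.
have Fs : Re (\sum_(i <- F) u i) <= sup A.
  by apply: sup_ubound => //; [exact: (proj2 supA)|exists F].
rewrite SE -raddfB/= normc_def/= expr0n/= addr0 sqrtr_sqr re ltcR ltr_norml.
move: F0s F0F' Fs; set a := Re _; set b := Re _; set c := sup _; set d := Re _.
by move=> ? ? ?; apply/andP; split; lra.
Qed.

Lemma sq_normD_le (x y : C) :
  `|x + y| ^+ 2 <= 2 * `|x| ^+ 2 + 2 * `|y| ^+ 2.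
Proof.
rewrite (@le_trans _ _ ((`|x| + `|y|) ^+ 2))//.
  by rewrite lerXn2r ?nnegrE ?addr_ge0//; exact: ler_normD.
rewrite -subr_ge0; rewrite (_ : _ - _ = (`|x| - `|y|) ^+ 2); last by ring.
by apply: real_exprn_even_ge0 => //; apply: rpredB; exact: normr_real.
Qed.

Definition sqsum f := exists M : R, forall F, \sum_(i <- F) `|f i| ^+ 2 <= M%:C.

Lemma sqsumD f g : sqsum f -> sqsum g -> sqsum (f + g).
Proof.
move=> [M fM] [N gN]; exists (2 * M + 2 * N) => F.
apply: le_trans (ler_sum _ (fun i _ => sq_normD_le (f i) (g i))) _.
rewrite big_split/= -!mulr_sumr rmorphD !rmorphM/= rmorph_nat.
by apply: lerD; rewrite ler_wpM2l.
Qed.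

Lemma sqsumZ (c : C) f : sqsum f -> sqsum (c *: f).
Proof.
move=> [M fM]; exists (Re `|c| ^+ 2 * M) => F.
have -> : (Re `|c| ^+ 2 * M)%:C = `|c| ^+ 2 * M%:C :> C.
  by rewrite rcM rcX Re_normc.
under eq_bigr do rewrite normrM exprMn.
by rewrite -mulr_sumr ler_wpM2l// exprn_ge0.
Qed.

(** Polarization writes the product as a combination of the four nonnegative families $|f + i^k
    g|^2$, which are summable because their partial sums are bounded. *)
Lemma has_sum_mul f g : sqsum f -> sqsum g ->
  exists s, has_sum (fun i => f i * (g i)^*) s.
Proof.
move=> ff gg.
have sq h : sqsum h -> exists s, has_sum (fun i => `|h i| ^+ 2) s.
  move=> [M hM]; have [|s hs _] := has_sum_ge0_exists _ hM; last by exists s.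
  by move=> i; rewrite exprn_ge0.
have [s1 h1] := sq _ (sqsumD ff gg).
have [s2 h2] := sq _ (sqsumD ff (sqsumZ (-1) gg)).
have [s3 h3] := sq _ (sqsumD ff (sqsumZ 'i gg)).
have [s4 h4] := sq _ (sqsumD ff (sqsumZ (- 'i) gg)).
have := has_sumZ (4^-1) (has_sumD (has_sumD h1 (has_sumZ (-1) h2))
  (has_sumD (has_sumZ 'i h3) (has_sumZ (- 'i) h4))).
set s := 4^-1 * _ => hs; exists s; congr has_sum: hs; apply/funext => i /=.
have fE (c : C) : (f + c *: g) i = f i + c * g i by [].
have fg : (f + g) i = f i + g i by [].
have E (x x' y y' I0 : C) : I0 ^+ 2 = -1 ->
    4^-1 * ((x + y) * (x' + y') + - 1 * ((x + - 1 * y) * (x' + - 1 * y')) +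
     (I0 * ((x + I0 * y) * (x' + - I0 * y')) +
      - I0 * ((x + - I0 * y) * (x' + I0 * y')))) = x * y'.
  move=> II; transitivity (4^-1 * (2 * (x * y' + y * x') +
     2 * I0 ^+ 2 * (y * x' - x * y'))); first by ring.
  by rewrite II; field.
rewrite !fE fg !normCK !(rmorphD, rmorphM, rmorphN)/= conjCi rmorph1 opprK.
by apply: E; rewrite sqrCi.
Qed.

End SquareSummable.

Section CauchySchwarz.
Context {C : numClosedFieldType} {U : lmodType C} (form : {dot U for Num.conj}).
Implicit Types u v : U.

Lemma dotC u v : form u v = (form v u)^*.
Proof. by rewrite (@hermitian_subproof _ _ _ _ form) expr0 mul1r. Qed.

Lemma dotDl u v w : form (u + v) w = form u w + form v w.
Proof. exact: linearDl. Qed.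

Lemma dotDr u v w : form u (v + w) = form u v + form u w.
Proof. exact: raddfD. Qed.

Lemma dotZl (c : C) u v : form (c *: u) v = c * form u v.
Proof. exact: linearZl_LR. Qed.

Lemma dotZr (c : C) u v : form u (c *: v) = c^* * form u v.
Proof. exact: linearZ_LR. Qed.

Lemma Cauchy_Schwarz u v : `|form u v| ^+ 2 <= form u u * form v v.
Proof.
have [->|v0] := eqVneq v 0.
  by rewrite (raddf0 (form u)) normr0 expr0n/= mulr_ge0// dnorm_ge0.
have vv : 0 < form v v by rewrite dnorm_gt0.
pose c := - (form u v / form v v).
have := dnorm_ge0 form (u + c *: v).
rewrite dotDl !dotDr !dotZl !dotZr (dotC v u).
have cE : c^* = - ((form u v)^* / form v v).
  rewrite /c rmorphN rmorphM/= fmorphV/=.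
  by rewrite (CrealP (gtr0_real vv)).
rewrite cE /c normCK; set a := form u u; set b := form v v; set d := form u v.
have b0 : b != 0 by rewrite gt_eqF.
have -> : a + - (d^* / b) * d + (- (d / b) * d^* + - (d / b) * (- (d^* / b) * b))
   = a - d * d^* / b by field.
by rewrite subr_ge0 ler_pdivrMr// mulrC.
Qed.

Lemma dot_triangle u v :
  sqrtC (form (u + v) (u + v)) <= sqrtC (form u u) + sqrtC (form v v).
Proof.
have u0 : 0 <= sqrtC (form u u) by rewrite sqrtC_ge0 dnorm_ge0.
have v0 : 0 <= sqrtC (form v v) by rewrite sqrtC_ge0 dnorm_ge0.
rewrite -(@ler_pXn2r _ 2)// ?nnegrE ?addr_ge0 ?sqrtC_ge0 ?dnorm_ge0//.
rewrite sqrtCK sqrrD !sqrtCK dotDl !dotDr (dotC v u).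
set d := form u v; set P := sqrtC _ * _.
have dP : `|d| <= P.
  rewrite -(@ler_pXn2r _ 2)// ?nnegrE ?mulr_ge0//.
  by rewrite exprMn !sqrtCK Cauchy_Schwarz.
have h : d + d^* <= P *+ 2.
  have -> : d + d^* = 'Re d *+ 2 by rewrite -mulr_natr ReE divfK// pnatr_eq0.
  rewrite ler_pMn2r// (le_trans _ dP)// (le_trans (real_ler_norm (Creal_Re _)))//.
  exact: leif_normC_Re_Creal.
rewrite -subr_ge0 (_ : _ - _ = P *+ 2 - (d + d^*)) ?subr_ge0//; ring.
Qed.

End CauchySchwarz.

Section L2Type.
Context (R : realType) (I : choiceType).
Local Notation C := R[i].

Definition l2_pred : {pred I -> C} := fun f => `[< sqsum f >].

Lemma l2_submod_closed : submod_closed l2_pred.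
Proof.
split=> [|c f g /asboolP ff /asboolP gg]; apply/asboolP.
  by exists 0 => F; rewrite big1// => i _; rewrite normr0 expr0n.
by apply: sqsumD => //; exact: sqsumZ.
Qed.

HB.instance Definition _ :=
  GRing.isSubmodClosed.Build C (I -> C) l2_pred l2_submod_closed.

Record l2 := L2 { l2_fun :> I -> C; l2_funP : l2_fun \in l2_pred }.

HB.instance Definition _ := [isSub for l2_fun].
HB.instance Definition _ := [Choice of l2 by <:].
HB.instance Definition _ := [SubChoice_isSubLmodule of l2 by <:].

End L2Type.

Section L2Inner.
Context (R : realType) (I : choiceType).
Local Notation C := R[i].
Implicit Types (f g h : l2 R I).

Lemma l2_sqsum f : sqsum f. Proof. exact/asboolP/l2_funP. Qed.

Lemma l2P f g : (forall i, f i = g i) -> f = g.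
Proof. by move=> fg; apply/val_inj/funext. Qed.

(** The default value 0 is never taken: [has_sum_mul] provides a sum for every pair. *)
Definition l2_inner f g : C := xget 0 (has_sum (fun i => f i * (g i)^*)).

Lemma l2_innerP f g : has_sum (fun i => f i * (g i)^*) (l2_inner f g).
Proof.
have [s hs] := has_sum_mul (l2_sqsum f) (l2_sqsum g).
exact: (@xgetI _ _ _ s).
Qed.

Lemma l2_innerE f g s : has_sum (fun i => f i * (g i)^*) s ->
  l2_inner f g = s.
Proof. exact/has_sum_uniq/l2_innerP. Qed.

Lemma l2_addE f g i : (f + g) i = f i + g i. Proof. by []. Qed.
Lemma l2_scaleE (c : C) f i : (c *: f) i = c * f i. Proof. by []. Qed.
Lemma l2_oppE f i : (- f) i = - f i. Proof. by []. Qed.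
Lemma l2_inner_linearl g : linear (l2_inner^~ g : l2 R I -> C^o).
Proof.
move=> c f f'; apply: l2_innerE.
have := has_sumD (has_sumZ c (l2_innerP f g)) (l2_innerP f' g).
congr has_sum; apply/funext => i.
by rewrite l2_addE l2_scaleE mulrDl mulrA.
Qed.

Lemma l2_innerC f g : l2_inner g f = (l2_inner f g)^*.
Proof.
apply: l2_innerE; have := has_sum_conj (l2_innerP f g).
by congr has_sum; apply/funext => i; rewrite rmorphM/= conjCK mulrC.
Qed.

Lemma l2_inner_le f (F : {fset I}) : \sum_(i <- F) `|f i| ^+ 2 <= l2_inner f f.
Proof.
under eq_bigr do rewrite normCK.
by apply: has_sum_le (l2_innerP f f) => i; exact: mul_conjC_ge0.
Qed.

Lemma l2_inner_ge f i : `|f i| ^+ 2 <= l2_inner f f.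
Proof. by have := l2_inner_le f [fset i]%fset; rewrite big_seq_fset1. Qed.

Lemma l2_inner_gt0 f : f != 0 -> 0 < l2_inner f f.
Proof.
move=> f0; rewrite lt_def (le_trans _ (l2_inner_le f fset0)) ?andbT; last first.
  by rewrite big_seq_fset0.
apply: contra f0 => /eqP f0; apply/eqP/l2P => i.
have := l2_inner_ge f i; rewrite f0 => fi.
have /eqP : `|f i| ^+ 2 == 0 by rewrite eq_le fi exprn_ge0.
by move=> /eqP; rewrite expf_eq0/= normr_eq0 => /eqP.
Qed.

End L2Inner.

Section L2Hilbert.
Context (R : realType) (I : choiceType).
Local Notation C := R[i].
Local Notation inner := (@l2_inner R I).

Lemma l2_bilinear : bilinear_for
  (GRing.Scale.Law.clone _ _ *%R _) (GRing.Scale.Law.clone _ _ (Num.conj \; *%R) _)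
  (inner : l2 R I -> l2 R I -> C).
Proof.
split=> [g c f f'|f c g g'] /=; first exact: l2_inner_linearl.
rewrite !(l2_innerC _ f) l2_inner_linearl.
by rewrite rmorphD rmorphM.
Qed.

HB.instance Definition _ := bilinear_isBilinear.Build C (l2 R I) (l2 R I) C
  _ _ inner l2_bilinear.

Lemma l2_hermitian (f g : l2 R I) :
  inner f g = (-1) ^+ false * (inner g f)^*.
Proof. by rewrite expr0 mul1r; exact: l2_innerC. Qed.

HB.instance Definition _ := @isHermitianSesquilinear.Build C (l2 R I) false
  Num.conj inner l2_hermitian.
HB.instance Definition _ := @isDotProduct.Build C (l2 R I) inner
  (@l2_inner_gt0 R I).

Definition l2_norm (f : l2 R I) : C := sqrtC (inner f f).

Lemma l2_normD f g : l2_norm (f + g) <= l2_norm f + l2_norm g.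
Proof. exact: (dot_triangle inner). Qed.

Lemma l2_normZ c f : l2_norm (c *: f) = `|c| * l2_norm f.
Proof.
rewrite /l2_norm (dotZl inner) (dotZr inner) mulrA -normCK.
by rewrite rootCMl ?exprn_ge0// sqrCK.
Qed.

Lemma l2_norm0_eq0 f : l2_norm f = 0 -> f = 0.
Proof.
move=> /eqP; rewrite sqrtC_eq0 => /eqP f0; apply: contrapT => /eqP.
by move=> /l2_inner_gt0; rewrite f0 ltxx.
Qed.

HB.instance Definition _ := @Lmodule_isNormed.Build C (l2 R I) l2_norm
  l2_normD l2_normZ l2_norm0_eq0.

Lemma l2_norm_inner (f : l2 R I) : inner f f = `|f| ^+ 2.
Proof. by rewrite sqrtCK. Qed.

Lemma l2_coord_le (f : l2 R I) i : `|f i| <= `|f|.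
Proof.
rewrite -(@ler_pXn2r _ 2)// ?nnegrE// -l2_norm_inner; exact: l2_inner_ge.
Qed.

Lemma l2_norm_leP (f : l2 R I) (M : C) : 0 <= M ->
  (forall F : {fset I}, \sum_(i <- F) `|f i| ^+ 2 <= M ^+ 2) -> `|f| <= M.
Proof.
move=> M0 fM; rewrite -(@ler_pXn2r _ 2)// ?nnegrE// -l2_norm_inner.
have := has_sum_ge0_exists (u := fun i => `|f i| ^+ 2) (M := Re (M ^+ 2)).
have -> : (Re (M ^+ 2))%:C = M ^+ 2 by rewrite RRe_real// ger0_real// exprn_ge0.
move=> [i||s fs sM]; [exact: exprn_ge0|exact: fM|].
rewrite (@l2_innerE _ _ _ _ s)//; congr has_sum: fs; apply/funext => i.
exact: normCK.
Qed.

Lemma l2_ballE (f g : l2 R I) (e : C) : ball f e g = (`|f - g| < e) :> Prop.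
Proof. by []. Qed.

(** The limit [l] is built coordinate by coordinate. The claim [key] compares [l] with [f] on a
    finite set through a member [g] of the filter that is close to [f] in norm and close to [l] at
    the points of that set. *)
Lemma l2_complete (F : set_system (l2 R I)) :
  ProperFilter F -> cauchy F -> cvg F.
Proof.
move=> PF /cauchyP cF.
have near_coord i : exists l : C, forall e : R, 0 < e ->
    F [set f | `|f i - l| < e%:C].
  have [|l hl] := @complex_cauchy_cvg R ((fun f : l2 R I => f i) @ F) _.
    move=> e e0; have [f Ff] := cF e%:C (etrans (ltcR 0 e) e0).
    exists (f i).
    suff : F [set g : l2 R I | `|g i - f i| < e%:C] by [].
    apply: filterS Ff => g; rewrite l2_ballE distrC /=.
    exact: le_lt_trans (l2_coord_le (g - f) i).
  by exists l.
have [l hl] := choice near_coord.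
have key (e : R) (f : l2 R I) : 0 < e -> F (ball f e%:C) ->
    forall S : {fset I}, \sum_(i <- S) `|l i - f i| ^+ 2 <= (2 * e)%:C ^+ 2.
  (* Small enough that [size S] squares of [d] add up to at most [e ^+ 2]. *)
  move=> e0 Ff S; pose d := e / (size S).+1%:R.
  have d0 : 0 < d by rewrite divr_gt0.
  have : F (\bigcap_(i in [set` S]) [set g : l2 R I | `|g i - l i| < d%:C]).
    by apply: filter_bigI => i _; exact: hl.
  move=> /(filterI Ff) /filter_ex [g [fg gl]].
  have e0' : 0 <= e%:C :> C by rewrite ler0c ltW.
  have d0' : 0 <= d%:C :> C by rewrite ler0c ltW.
  have dl i : i \in S -> `|l i - g i| ^+ 2 <= d%:C ^+ 2.
    move=> iS; rewrite lerXn2r ?nnegrE//.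
    by rewrite distrC; apply/ltW/gl.
  have sumd : \sum_(i <- S) `|l i - g i| ^+ 2 <= e%:C ^+ 2.
    rewrite big_seq; apply: le_trans (ler_sum _ dl) _.
    rewrite -big_seq big_const_seq count_predT iter_addr_0 -!rcX -rmorphMn/=.
    rewrite lecR /d expr_div_n -mulr_natl mulrA ler_pdivrMr ?exprn_gt0//.
    rewrite mulrC ler_wpM2l ?sqr_ge0// -natrX ler_nat.
    by rewrite (leq_trans (leqnSn _))// leq_pmulr.
  have sumg : \sum_(i <- S) `|g i - f i| ^+ 2 <= e%:C ^+ 2.
    apply: le_trans (l2_inner_le (g - f) S) _.
    rewrite l2_norm_inner lerXn2r ?nnegrE//.
    by move: fg; rewrite l2_ballE distrC => /ltW.
  have h i : `|l i - f i| ^+ 2 <= 2 * `|l i - g i| ^+ 2 + 2 * `|g i - f i| ^+ 2.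
    by have := sq_normD_le (l i - g i) (g i - f i); rewrite addrA subrK.
  apply: le_trans (ler_sum _ (fun i _ => h i)) _.
  rewrite big_split/= -!mulr_sumr rcM exprMn.
  have -> : 2%:C ^+ 2 * e%:C ^+ 2 = 2 * e%:C ^+ 2 + 2 * e%:C ^+ 2 :> C.
    by have -> : 2%:C = 2 :> C; [exact: rmorph_nat|ring].
  by apply: lerD; rewrite ler_wpM2l.
have l_sq : sqsum l.
  have [f Ff] := cF 1 ltr01.
  have lf : sqsum (l - f).
    by exists ((2 * 1) ^+ 2) => S; rewrite rcX; exact: (key 1).
  by have := sqsumD lf (l2_sqsum f); rewrite subrK.
pose L := L2 (introT (asboolP _) l_sq).
apply/cvg_ex; exists L; apply/cvgrPdist_lt => e e0.
have re : e = (Re e)%:C by rewrite RRe_real// gtr0_real.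
have e40 : 0 < Re e / 4 by rewrite divr_gt0// -ltcR -re.
have [f Ff] := cF (Re e / 4)%:C (etrans (ltcR 0 _) e40).
suff : F [set g : l2 R I | `|L - g| < e] by [].
apply: filterS (Ff) => g; rewrite l2_ballE /mkset => fg.
have Lf : `|L - f| <= (2 * (Re e / 4))%:C.
  apply: l2_norm_leP; first by rewrite lecR mulr_ge0// ltW.
  exact: key.
have -> : L - g = (L - f) + (f - g) by rewrite addrA subrK.
apply: (le_lt_trans (ler_normD _ _)).
rewrite [ltRHS]re; have := ler_ltD Lf fg; rewrite -rcD => /lt_trans; apply.
by rewrite ltcR; lra.
Qed.

HB.instance Definition _ := Uniform_isComplete.Build (l2 R I) l2_complete.

Definition l2_hilbert : hilbertSpace R :=
  @HilbertSpace R (l2 R I) inner l2_norm_inner.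

End L2Hilbert.

(** * The groupoid of a singly generated dynamical system *)

Local Notation bopen T := (@basic_open _ T).

Section Iterates.
Context {X : topologicalType} (T : sgds X).

(** Continuity and openness are stated at a point because [T] is a total function that is meaningful
    only on its domain; both come from the local inverse [g]. *)
Lemma sgds_nbhs x : sgds_dom T x ->
  {for x, continuous T} /\ forall A, nbhs x A -> nbhs (T x) (T @` A).
Proof.
move=> Dx; have [U [oU Ux UD oTU [g [_ gK cT cg]]]] := sgds_local_homeo Dx.
have UxU : nbhs x U by exact: open_nbhs_nbhs.
split.
  move: cT; rewrite continuous_open_subspace// => cT.
  by apply: cT; rewrite inE.
move=> A xA.
move: cg; rewrite continuous_open_subspace// => /(_ (T x)).
rewrite inE => /(_ (ex_intro2 _ _ x Ux erefl)) cg.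
have : nbhs (g (T x)) (A `&` U) by rewrite gK//; exact: filterI.
move=> /cg gAU; have {}gAU : nbhs (T x) (g @^-1` (A `&` U)) by [].
have TxU : nbhs (T x) (T @` U).
  by apply: open_nbhs_nbhs; split=> //; exists x.
apply: filterS (filterI gAU TxU) => y [/= [Ay _] [z Uz ezy]].
by exists (g y) => //; rewrite -ezy gK.
Qed.

Lemma iter_nbhs n x : iter_dom T n x ->
  {for x, continuous (iter n T)} /\
  forall A, nbhs x A -> nbhs (iter n T x) (iter n T @` A).
Proof.
elim: n => [_|n IHn xn].
  by split=> [|A xA]; [exact: cvg_id|rewrite image_id].
have /(iter_domD T n 1) [xn' Tx] : iter_dom T (n + 1) x by rewrite addn1.
have [cn on] := IHn xn'; have [cT oT] := sgds_nbhs (Tx 0%N erefl).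
split; first by apply: continuous_comp.
move=> A xA; have := oT _ (on _ xA); rewrite iterS.
by apply: filterS => _ [_ [y Ay <-] <-]; exists y.
Qed.

Lemma iter_open n (U : set X) : open U -> U `<=` iter_dom T n ->
  open (iter n T @` U).
Proof.
move=> oU Un; rewrite openE => _ [x Ux <-].
have [_] := iter_nbhs (Un _ Ux); apply; exact: open_nbhs_nbhs.
Qed.

Lemma iter_dom_leq m n : (m <= n)%N -> iter_dom T n `<=` iter_dom T m.
Proof. by move=> mn x xn k km; apply: xn; exact: leq_trans mn. Qed.

(** One degree can be witnessed by many pairs of exponents. Larger exponents follow by applying [T]
    further; smaller ones by cancelling $T^{P-m}$, which is injective near $T^m x$. This reconciles
    the level at which arrows are composed with the level of a given basic neighbourhood. *)
Lemma level_change (I : Type) (F : set_system I) (r s : I -> X) (x y : X)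
    (P Q m n : nat) : Filter F -> r @ F --> x -> s @ F --> y ->
  (P%:Z - Q%:Z = m%:Z - n%:Z) ->
  iter_dom T P x -> iter_dom T m x -> iter_dom T n y ->
  iter m T x = iter n T y ->
  (\forall i \near F, iter P T (r i) = iter Q T (s i) ->
     iter m T (r i) = iter n T (s i)).
Proof.
move=> FF rx sy PQ xP xm yn e.
have [Pm|/ltnW mP] := leqP P m.
  near=> i => ei.
  have -> : m = ((m - P) + P)%N by lia.
  have -> : n = ((m - P) + Q)%N by lia.
  by rewrite !iterD ei.
have eP : P = (m + (P - m))%N by lia.
have eQ : Q = (n + (P - m))%N by lia.
have [W [[oW _ injW] Wz]] : exists W, injective_on T (P - m) W /\ W (iter m T x).
  by apply: injective_on_exists; move: xP; rewrite {1}eP => /iter_domD[].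
have [cm _] := iter_nbhs xm; have [cn _] := iter_nbhs yn.
have rW : \forall i \near F, W (iter m T (r i)).
  by apply: (cvg_comp _ _ rx cm); apply: open_nbhs_nbhs.
have sW : \forall i \near F, W (iter n T (s i)).
  by apply: (cvg_comp _ _ sy cn); rewrite -e; apply: open_nbhs_nbhs.
near=> i; rewrite {1}eP {1}eQ ![(_ + (P - m))%N]addnC !iterD.
by apply: injW; [near: i|near: i].
Unshelve. all: by end_near. Qed.

End Iterates.

(** * The étale topology on the arrows *)

Section ArrowTopology.
Context {X : topologicalType} (T : sgds X).
Local Notation G := (arrow T).
Implicit Types (a b c : G).

Lemma arrow_ext a b : range_of a = range_of b -> degree a = degree b ->
  source_of a = source_of b -> a = b.
Proof.
case: a b => [x k y p] [x' k' y' p'] /= ex ek ey.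
rewrite {}ex {}ek {}ey in p *; congr Arrow; exact: Prop_irrelevance.
Qed.

Lemma basic_open_open i : basic_indices T i -> open (bopen T i).
Proof. by move=> Di; exists [set i]; [move=> _ ->|rewrite bigcup_set1]. Qed.

Lemma arrow_nbhsP a (A : set G) : nbhs a A <->
  exists m n U V, [/\ injective_on T m U, injective_on T n V,
    bopen T (m, n, U, V) a & bopen T (m, n, U, V) `<=` A].
Proof.
split; last first.
  move=> [m [n [U [V [mU nV aB BA]]]]]; apply: filterS BA _.
  by apply: open_nbhs_nbhs; split=> //; exact: basic_open_open.
rewrite nbhsE => -[_ [[D' D'D <-] [i D'i ai]] BA].
case: i D'i ai => [[[m n] U] V] D'i ai.
have [? ?] := D'D _ D'i; exists m, n, U, V; split=> //.
by move=> b bi; apply: BA; exists (m, n, U, V).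
Qed.

Lemma arrow_levels a : exists m n,
  [/\ degree a = m%:Z - n%:Z, iter_dom T m (range_of a),
      iter_dom T n (source_of a) &
      iter m T (range_of a) = iter n T (source_of a)].
Proof. exact: arrowP. Qed.

Lemma arrow_nbhs_level a m n (W W' : set X) : degree a = m%:Z - n%:Z ->
  iter_dom T m (range_of a) -> iter_dom T n (source_of a) ->
  iter m T (range_of a) = iter n T (source_of a) ->
  nbhs (range_of a) W -> nbhs (source_of a) W' ->
  exists U V, [/\ injective_on T m U, injective_on T n V,
    U `<=` W, V `<=` W' & bopen T (m, n, U, V) a].
Proof.
move=> da ra sa e aW aW'.
have [U [iU Ua]] := injective_on_exists ra.
have [V [iV Va]] := injective_on_exists sa.
exists (U `&` W°), (V `&` W'°); split.
- by apply: injective_onI => //; exact: open_interior.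
- by apply: injective_onI => //; exact: open_interior.
- by move=> x [_ /interior_subset].
- by move=> x [_ /interior_subset].
- by split=> //; split.
Qed.

Lemma range_continuous : continuous (@range_of X T).
Proof.
move=> a W aW; have [m [n [da ra sa e]]] := arrow_levels a.
have [U [V [iU iV UW _ aB]]] := arrow_nbhs_level da ra sa e aW filterT.
by apply/arrow_nbhsP; exists m, n, U, V; split=> // b [_ /UW].
Qed.

Lemma source_continuous : continuous (@source_of X T).
Proof.
move=> a W aW; have [m [n [da ra sa e]]] := arrow_levels a.
have [U [V [iU iV _ VW aB]]] := arrow_nbhs_level da ra sa e filterT aW.
by apply/arrow_nbhsP; exists m, n, U, V; split=> // b [_ _ /VW].
Qed.

Lemma near_level a m n : degree a = m%:Z - n%:Z ->
  iter_dom T m (range_of a) -> iter_dom T n (source_of a) ->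
  iter m T (range_of a) = iter n T (source_of a) ->
  \forall b \near a, [/\ degree b = m%:Z - n%:Z,
    iter_dom T m (range_of b), iter_dom T n (source_of b) &
    iter m T (range_of b) = iter n T (source_of b)].
Proof.
move=> da ra sa e.
have [U [V [iU iV _ _ aB]]] := arrow_nbhs_level da ra sa e filterT filterT.
apply/arrow_nbhsP; exists m, n, U, V; split=> // b [db Ub Vb eb]; split=> //.
  by have [_ + _] := iU; apply.
by have [_ + _] := iV; apply.
Qed.

Lemma near_degree a : \forall b \near a, degree b = degree a.
Proof.
have [m [n [da ra sa e]]] := arrow_levels a.
by apply: filterS (near_level da ra sa e) => b []; rewrite da.
Qed.

(** For [x] near the range, $T^m x$ stays in the open set $T^n(V)$, and a preimage in [V] is the
    source of an arrow over [x]. *)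
Lemma range_nbhs a (A : set G) : nbhs a A ->
  nbhs (range_of a) (@range_of X T @` A).
Proof.
move=> /arrow_nbhsP[m [n [U [V [iU iV [da Ua Va ea] BA]]]]].
have [oU Um _] := iU; have [oV Vn _] := iV.
have oTV : open (iter n T @` V) by exact: iter_open.
have [cm _] := iter_nbhs (Um _ Ua).
have : nbhs (iter m T (range_of a)) (iter n T @` V).
  by apply: open_nbhs_nbhs; split=> //; rewrite ea; exists (source_of a).
move=> /cm h; have h' : nbhs (range_of a) U by exact: open_nbhs_nbhs.
apply: filterS (filterI h' h) => x [Ux [y Vy e]].
have p : exists m n : nat, [/\ degree a = m%:Z - n%:Z, iter_dom T m x,
    iter_dom T n y & iter m T x = iter n T y].
  by exists m, n; split=> //; [exact: Um|exact: Vn].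
by exists (Arrow p) => //; apply: BA; split.
Qed.

Lemma arrow_inv_continuous : continuous (@arrow_inv X T).
Proof.
move=> a A /arrow_nbhsP[m [n [U [V [iU iV [/= da Ua Va ea] BA]]]]].
apply/arrow_nbhsP; exists n, m, V, U; split=> //.
  by split=> //; lia.
by move=> b [db Vb Ub eb]; apply: BA; split=> //=; lia.
Qed.

Lemma arrow_invK : involutive (@arrow_inv X T).
Proof. by move=> a; apply: arrow_ext => //=; rewrite opprK. Qed.

(** An arrow is determined by its range, degree and source; the degree is locally constant and the
    two ends vary continuously in a Hausdorff space. *)
Lemma arrow_hausdorff : hausdorff_space X -> hausdorff_space G.
Proof.
move=> hX a b ab; apply: arrow_ext.
- apply: hX => A B /range_continuous Aa /range_continuous Bb.
  by have [c [Ac Bc]] := ab _ _ Aa Bb; exists (range_of c).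
- by have [c [<- <-]] := ab _ _ (near_degree a) (near_degree b).
- apply: hX => A B /source_continuous Aa /source_continuous Bb.
  by have [c [Ac Bc]] := ab _ _ Aa Bb; exists (source_of c).
Qed.

(** Openness of the range map, read backwards along the section. *)
Lemma section_continuous (B : set G) (sigma : X -> G) : open B ->
  (forall b, B b -> sigma (range_of b) = b) ->
  forall b, B b -> {for range_of b, continuous sigma}.
Proof.
move=> oB sB b Bb A; rewrite sB// => bA.
have /range_nbhs : nbhs b (A `&` B).
  by apply: filterI => //; exact: open_nbhs_nbhs.
by apply: filterS => _ [c [Ac Bc] <-]; rewrite /= sB.
Qed.

Definition bisection (B : set G) : Prop :=
  [/\ open B, forall a b, B a -> B b -> range_of a = range_of b -> a = b &
      forall a b, B a -> B b -> source_of a = source_of b -> a = b].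

Lemma basic_open_bisection i : basic_indices T i -> bisection (bopen T i).
Proof.
case: i => [[[m n] U] V] Di; split; first exact: basic_open_open.
  move=> a b [da Ua Va ea] [db Ub Vb eb] rab.
  have [_ [_ _ injV]] := Di.
  apply: arrow_ext => //; first by rewrite da.
  by apply: injV => //; rewrite -ea -eb rab.
move=> a b [da Ua Va ea] [db Ub Vb eb] sab.
have [[_ _ injU] _] := Di.
apply: arrow_ext => //; last by rewrite da.
by apply: injU => //; rewrite ea eb sab.
Qed.

Lemma bisection_section (B : set G) : bisection B ->
  exists sigma : X -> G, forall b, B b -> sigma (range_of b) = b.
Proof.
move=> [_ injr _]; have [[b0 Bb0]|B0] := pselect (exists b, B b); last first.
  have [[x]|nX] := pselect (exists x : X, True); last first.
    by exists (fun x => False_rect _ (nX (ex_intro _ x I))) => b.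
  move=> _; have p : exists m n : nat, [/\ 0 = m%:Z - n%:Z, iter_dom T m x,
      iter_dom T n x & iter m T x = iter n T x] by exists 0%N, 0%N; split.
  by exists (fun=> Arrow p) => b Bb; case: B0; exists b.
exists (fun x => xget b0 [set b | B b /\ range_of b = x]) => b Bb.
case: xgetP => [c _ [Bc rc]|/(_ b)]; last by case.
exact: injr.
Qed.

(** The compact support of a bump function around the range is carried into the groupoid by the
    continuous section of a bisection; [R] is the field of values of that bump function. *)
Lemma arrow_locally_compact (R : realType) : hausdorff_space X ->
  locally_compact [set: X] -> locally_compact [set: G].
Proof.
move=> hX lX a _; rewrite withinET.
have [m [n [da ra sa e]]] := arrow_levels a.
have [U [V [iU iV _ _ aB]]] := arrow_nbhs_level da ra sa e filterT filterT.
have bB : bisection (bopen T (m, n, U, V)) by exact: basic_open_bisection.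
set B := bopen T _ in aB bB.
have [oB injr _] := bB; have [sigma sB] := bisection_section bB.
have : open_nbhs (range_of a) (@range_of X T @` B)°.
  split; first exact: open_interior.
  by apply: range_nbhs; exact: open_nbhs_nbhs.
move=> [oO Oa]; have [b [cb b01 ba kb bO]] := @bump_exists R X hX lX _ _ oO Oa.
have bB' : csupp b `<=` @range_of X T @` B.
  by move=> x /bO /interior_subset.
exists (sigma @` csupp b).
  have : nbhs (range_of a) (csupp b).
    have : nbhs (range_of a) (b @^-1` [set r | 0 < r]).
      by apply: cb; apply: open_nbhs_nbhs; split=> //; exact: open_gt.
    by apply: filterS => x /= bx; apply: subset_closure; rewrite /= gt_eqF.
  move=> /range_continuous h.
  have {}h : nbhs a (@range_of X T @^-1` csupp b) by [].
  have aB' : nbhs a B by exact: open_nbhs_nbhs.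
  apply: filterS (filterI h aB') => c [/= cb' Bc].
  by exists (range_of c) => //; exact: sB.
have ks : compact (sigma @` csupp b).
  apply: continuous_compact => //; apply: continuous_in_subspaceT => x.
  rewrite inE => /bB' [c Bc <-]; exact: section_continuous oB sB _ Bc.
by split=> //; apply: compact_closed => //; exact: arrow_hausdorff.
Qed.

End ArrowTopology.

(** * Composition of arrows and its continuity *)

Section ArrowAlgebra.
Context {X : topologicalType} (T : sgds X).
Local Notation G := (arrow T).
Implicit Types (a b c : G) (x : X).

(* Outside of composable pairs, [amul a b] is the junk value [a]. *)
Definition amul a b : G :=
  if pselect (source_of a = range_of b) is left ab then arrow_mul ab else a.

Lemma amul_mul a b (ab : source_of a = range_of b) : amul a b = arrow_mul ab.
Proof. by rewrite /amul; case: pselect => // ab'; exact: arrow_ext. Qed.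

Lemma amul_range a b : source_of a = range_of b ->
  range_of (amul a b) = range_of a.
Proof. by move=> ab; rewrite amul_mul. Qed.

Lemma amul_source a b : source_of a = range_of b ->
  source_of (amul a b) = source_of b.
Proof. by move=> ab; rewrite amul_mul. Qed.

Lemma amul_degree a b : source_of a = range_of b ->
  degree (amul a b) = degree a + degree b.
Proof. by move=> ab; rewrite amul_mul. Qed.

Let amulE := (amul_range, amul_source, amul_degree).

Lemma amulA a b c : source_of a = range_of b -> source_of b = range_of c ->
  amul a (amul b c) = amul (amul a b) c.
Proof.
move=> ab bc.
have h1 : source_of a = range_of (amul b c) by rewrite amulE.
have h2 : source_of (amul a b) = range_of c by rewrite amulE.
by apply: arrow_ext; rewrite !amulE// addrA.
Qed.

Lemma amulVKl a b : range_of a = range_of b ->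
  amul a (amul (arrow_inv a) b) = b.
Proof.
move=> ab; have h1 : source_of (arrow_inv a) = range_of b by [].
have h2 : source_of a = range_of (amul (arrow_inv a) b) by rewrite amulE.
by apply: arrow_ext; rewrite !amulE//= addNKr.
Qed.

Lemma amulKl a b : source_of a = range_of b ->
  amul (arrow_inv a) (amul a b) = b.
Proof.
move=> ab.
have h1 : source_of (arrow_inv a) = range_of (amul a b) by rewrite amulE.
by apply: arrow_ext; rewrite !amulE//= addKr.
Qed.

Lemma amulKr a b : source_of a = range_of b ->
  amul (amul a b) (arrow_inv b) = a.
Proof.
move=> ab.
have h1 : source_of (amul a b) = range_of (arrow_inv b) by rewrite amulE.
by apply: arrow_ext; rewrite !amulE//= addrK.
Qed.

Lemma amulVKr a b : source_of a = source_of b ->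
  amul (amul a (arrow_inv b)) b = a.
Proof.
move=> ab; have h1 : source_of a = range_of (arrow_inv b) by [].
have h2 : source_of (amul a (arrow_inv b)) = range_of b by rewrite amulE.
by apply: arrow_ext; rewrite !amulE//= subrK.
Qed.

Lemma amul_inv a b : source_of a = range_of b ->
  arrow_inv (amul a b) = amul (arrow_inv b) (arrow_inv a).
Proof.
move=> ab; have h : source_of (arrow_inv b) = range_of (arrow_inv a) by [].
by apply: arrow_ext => /=; rewrite ?amulE//= opprD addrC.
Qed.

Lemma unit_subproof x : exists m n : nat, [/\ 0 = m%:Z - n%:Z, iter_dom T m x,
  iter_dom T n x & iter m T x = iter n T x].
Proof. by exists 0%N, 0%N; split. Qed.

Definition aunit x : G := Arrow (unit_subproof x).

Lemma amul1l a : amul (aunit (range_of a)) a = a.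
Proof. by apply: arrow_ext; rewrite !amulE//= add0r. Qed.

Lemma amul1r a : amul a (aunit (source_of a)) = a.
Proof. by apply: arrow_ext; rewrite !amulE//= addr0. Qed.

Lemma amulVr a : amul a (arrow_inv a) = aunit (range_of a).
Proof. by apply: arrow_ext; rewrite !amulE//= subrr. Qed.

Lemma arrow_inv1 x : arrow_inv (aunit x) = aunit x.
Proof. exact: arrow_ext. Qed.

(** Stated along a filter, so that the factors need to be composable only near the limit and the
    lemma applies to subspaces and to sections alike. *)
Lemma cvg_amul (I : Type) (F : set_system I) (u v : I -> G) a b : Filter F ->
  u @ F --> a -> v @ F --> b -> source_of a = range_of b ->
  (\forall i \near F, source_of (u i) = range_of (v i)) ->
  (fun i => amul (u i) (v i)) @ F --> amul a b.
Proof.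
move=> FF ua vb ab uv N /arrow_nbhsP[m [n [U [V [iU iV [dab Uab Vab eab] BN]]]]].
rewrite amul_degree// in dab; rewrite !amulE// in Uab Vab eab.
have [oU Um _] := iU; have [oV Vn _] := iV.
have ru : range_of (u i) @[i --> F] --> range_of a.
  by apply: (cvg_comp _ _ ua); exact: range_continuous.
have sv : source_of (v i) @[i --> F] --> source_of b.
  by apply: (cvg_comp _ _ vb); exact: source_continuous.
have [p [q [da ra sa ea]]] := arrow_levels a.
have [p' [q' [db rb sb eb]]] := arrow_levels b.
have lu := ua _ (near_level da ra sa ea).
have lv := vb _ (near_level db rb sb eb).
(* A level common to all nearby products: the inner exponents [q] and [p'] are raised to the larger
   of the two. [level_change] then moves it to the level [(m, n)] of the target neighbourhood. *)
have [P [Q [PQ aP near_PQ]]] : exists P Q, [/\ P%:Z - Q%:Z = m%:Z - n%:Z,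
    iter_dom T P (range_of a) &
    \forall i \near F, iter P T (range_of (u i)) = iter Q T (source_of (v i))].
  have [qp|/ltnW pq] := leqP q p'.
  - exists (p + (p' - q))%N, q'; split; first by rewrite -dab da db; lia.
      apply/iter_domD; split=> //; rewrite ea; move: rb.
      by rewrite -ab -{1}(subnKC qp) => /iter_domD[].
    near=> i.
    have [_ _ _ e1] : [/\ degree (u i) = p%:Z - q%:Z,
      iter_dom T p (range_of (u i)), iter_dom T q (source_of (u i)) &
      iter p T (range_of (u i)) = iter q T (source_of (u i))] by near: i.
    have [_ _ _ e2] : [/\ degree (v i) = p'%:Z - q'%:Z,
      iter_dom T p' (range_of (v i)), iter_dom T q' (source_of (v i)) &
      iter p' T (range_of (v i)) = iter q' T (source_of (v i))] by near: i.
    rewrite addnC iterD e1 -iterD subnK// -e2; congr (iter _ _ _).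
    by near: i.
  - exists p, (q' + (q - p'))%N; split=> //; first by rewrite -dab da db; lia.
    near=> i.
    have [_ _ _ e1] : [/\ degree (u i) = p%:Z - q%:Z,
      iter_dom T p (range_of (u i)), iter_dom T q (source_of (u i)) &
      iter p T (range_of (u i)) = iter q T (source_of (u i))] by near: i.
    have [_ _ _ e2] : [/\ degree (v i) = p'%:Z - q'%:Z,
      iter_dom T p' (range_of (v i)), iter_dom T q' (source_of (v i)) &
      iter p' T (range_of (v i)) = iter q' T (source_of (v i))] by near: i.
    rewrite e1 addnC iterD -e2 -iterD subnK//; congr (iter _ _ _).
    by near: i.
have lev := level_change FF ru sv PQ aP (Um _ Uab) (Vn _ Vab) eab.
have nU : \forall i \near F, U (range_of (u i)).
  by apply: ru; exact: open_nbhs_nbhs.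
have nV : \forall i \near F, V (source_of (v i)).
  by apply: sv; exact: open_nbhs_nbhs.
have du : \forall i \near F, degree (u i) = degree a.
  exact: ua _ (near_degree a).
have dv : \forall i \near F, degree (v i) = degree b.
  exact: vb _ (near_degree b).
apply: filterS (filterI (filterI (filterI nU nV) (filterI near_PQ lev))
  (filterI uv (filterI du dv))).
move=> i [[[Ui Vi] [PQi levi]] [uvi [/= dui dvi]]]; apply: BN => /=.
rewrite !amulE//; split=> //; last exact: levi.
by rewrite dui dvi.
Unshelve. all: by end_near. Qed.

Definition composable : set (G * G) :=
  [set p | source_of p.1 = range_of p.2].

Lemma composable_closed : hausdorff_space X -> closed composable.
Proof.
move=> hX [a b] ab; apply: hX => A B aA bB.
have [] := ab ((@source_of X T @^-1` A) `*` (@range_of X T @^-1` B)).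
  exists (@source_of X T @^-1` A, @range_of X T @^-1` B) => //; split=> /=.
    exact: source_continuous.
  exact: range_continuous.
by move=> [c d] [/= cd [/= Ac Bd]]; exists (source_of c); split=> //; rewrite cd.
Qed.

Lemma compact_amul (K L : set G) : hausdorff_space X -> compact K ->
  compact L ->
  compact ((fun p : G * G => amul p.1 p.2) @` (K `*` L `&` composable)).
Proof.
move=> hX kK kL; apply: continuous_compact; last first.
  apply: compact_closedI; first exact: compact_setX.
  exact: composable_closed.
apply/subspace_continuousP => -[a b] [_ /= ab].
apply: cvg_amul => //.
- move=> A aA; have : nbhs (a, b) (fst @^-1` A) by exact: cvg_fst.
  by apply: filterS => p Ap _.
- move=> A bA; have : nbhs (a, b) (snd @^-1` A) by exact: cvg_snd.
  by apply: filterS => p Ap _.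
- have : nbhs (a, b) setT by exact: filterT.
  by apply: filterS => p _ [].
Qed.

End ArrowAlgebra.

(** * The convolution algebra *)

Section Convolution.
Context {R : realType} {X : topologicalType} (T : sgds X).
Local Notation G := (arrow T).
Local Notation C := R[i].
Local Notation Cf := (G -> R[i]^o).
Implicit Types (a b c : G) (f g h : Cf).

(** A bijective reindexing, so the formula also holds when infinitely many terms are nonzero and
    both sums take their default value 0. *)
Lemma convE f g c : convolution f g c =
  \sum_(a \in [set a : G | range_of a = range_of c])
    f a * g (amul (arrow_inv a) c).
Proof.
rewrite /convolution.
rewrite (@reindex_fsbig _ _ _ _ _ (fun a => (a, amul (arrow_inv a) c))
  [set a : G | range_of a = range_of c])//; split.
- move=> a /= ac; have e : source_of a = range_of (amul (arrow_inv a) c).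
    by rewrite amul_range.
  by exists e; rewrite -amul_mul amulVKl.
- by move=> a b _ _ [].
- move=> [a b] /= [ab <-]; exists a => //=.
  by rewrite -amul_mul amulKl.
Qed.

Lemma convEr f g c : convolution f g c =
  \sum_(b \in [set b : G | source_of b = source_of c])
    f (amul c (arrow_inv b)) * g b.
Proof.
rewrite /convolution.
rewrite (@reindex_fsbig _ _ _ _ _ (fun b => (amul c (arrow_inv b), b))
  [set b : G | source_of b = source_of c])//; split.
- move=> b /= bc; have e : source_of (amul c (arrow_inv b)) = range_of b.
    by rewrite amul_source.
  by exists e; rewrite -amul_mul amulVKr.
- by move=> a b _ _ [].
- move=> [a b] /= [ab <-]; exists b => //=.
  by rewrite -amul_mul amulKr.
Qed.

(** A sum over a set with infinitely many nonzero terms is 0 by convention and hence not additive;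
    this condition restores additivity of the convolution. *)
Definition row_finite f :=
  forall x, finite_set [set a : G | range_of a = x /\ f a <> 0].

Definition range_inj f := forall a b, f a <> 0 -> f b <> 0 ->
  range_of a = range_of b -> a = b.

Definition source_inj f := forall a b, f a <> 0 -> f b <> 0 ->
  source_of a = source_of b -> a = b.

Lemma range_inj_row_finite f : range_inj f -> row_finite f.
Proof.
move=> fi x; have [[a [ax fa]]|nx] :=
    pselect (exists a, range_of a = x /\ f a <> 0); last first.
  by rewrite (_ : mkset _ = set0)// -subset0 => a ha; apply: nx; exists a.
apply: (@sub_finite_set _ _ [set a]); last exact: finite_set1.
by move=> b [bx fb] /=; apply: fi => //; rewrite bx.
Qed.

Lemma conv_finite f g c (W : set G) : finite_set W ->
  (forall a, range_of a = range_of c -> f a <> 0 -> W a) ->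
  (forall a, W a -> range_of a = range_of c) ->
  convolution f g c = \sum_(a \in W) f a * g (amul (arrow_inv a) c).
Proof.
move=> fW fWc Wc; rewrite convE; apply/esym/fsbig_widen => //.
move=> a [/= ac nWa]; have [->|/eqP fa] := eqVneq (f a) 0; first by rewrite mul0r.
by have := nWa (fWc _ ac fa).
Qed.

Lemma conv_range_inj f g a c : range_inj f -> f a <> 0 ->
  range_of a = range_of c ->
  convolution f g c = f a * g (amul (arrow_inv a) c).
Proof.
move=> fi fa ac; rewrite (@conv_finite _ _ _ [set a]) ?fsbig_set1//.
  by move=> b bc fb /=; apply: fi => //; rewrite ac.
by move=> b ->.
Qed.

(** In contrast with [conv_range_inj], the value [f a] may be 0, so the one-term formula is valid on
    a whole open set of [c], as a continuity argument requires. *)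
Lemma conv_bisection f g a c (B : set G) :
  (forall a b, B a -> B b -> range_of a = range_of b -> a = b) ->
  (forall a, f a <> 0 -> B a) -> B a -> range_of a = range_of c ->
  convolution f g c = f a * g (amul (arrow_inv a) c).
Proof.
move=> rB fB Ba ac; rewrite (@conv_finite _ _ _ [set a]) ?fsbig_set1//.
  by move=> b bc /fB Bb; apply: rB => //; rewrite ac.
by move=> b ->.
Qed.

Lemma conv_support f g c : convolution f g c <> 0 ->
  exists a, [/\ range_of a = range_of c, f a <> 0 &
    g (amul (arrow_inv a) c) <> 0].
Proof.
move=> fg; apply: contrapT => nc; apply: fg; rewrite convE.
apply: fsbig1 => a /= ac; have [->|/eqP fa] := eqVneq (f a) 0.
  by rewrite mul0r.
have [->|/eqP ga] := eqVneq (g (amul (arrow_inv a) c)) 0.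
  by rewrite mulr0.
by case: nc; exists a.
Qed.

Lemma conv_range0 f g c :
  (forall a, range_of a = range_of c -> f a = 0) -> convolution f g c = 0.
Proof.
by move=> f0; rewrite convE; apply: fsbig1 => a /= /f0 ->; rewrite mul0r.
Qed.

Lemma conv_source_inj f g b c : source_inj g -> g b <> 0 ->
  source_of b = source_of c ->
  convolution f g c = f (amul c (arrow_inv b)) * g b.
Proof.
move=> gi gb bc; rewrite convEr.
rewrite -(@fsbig_widen _ _ _ _ [set b]) ?fsbig_set1//; first by move=> _ ->.
move=> d [/= dc nd]; have [->|/eqP gd] := eqVneq (g d) 0; first by rewrite mulr0.
by case: nd; apply: gi => //; rewrite bc.
Qed.

Lemma conv_source0 f g c :
  (forall b, source_of b = source_of c -> g b = 0) -> convolution f g c = 0.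
Proof.
by move=> g0; rewrite convEr; apply: fsbig1 => b /= /g0 ->; rewrite mulr0.
Qed.

Lemma row_finiteD f g : row_finite f -> row_finite g -> row_finite (f \+ g).
Proof.
move=> ff gf x; apply: sub_finite_set (_ : finite_set
  ([set a | range_of a = x /\ f a <> 0] `|` [set a | range_of a = x /\ g a <> 0])).
  move=> a [ax fga]; have [fa|/eqP fa] := eqVneq (f a) 0; last by left.
  by right; split=> // ga; apply: fga => /=; rewrite fa ga addr0.
by rewrite finite_setU; split; [exact: ff|exact: gf].
Qed.

Lemma row_finite_sum (J : Type) (s : seq J) (F : J -> Cf) :
  (forall j, row_finite (F j)) -> row_finite (fun a => \sum_(j <- s) F j a).
Proof.
move=> FF; elim: s => [|j s IH] x.
  rewrite (_ : mkset _ = set0)// -subset0 => a [_]; by rewrite big_nil.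
apply: sub_finite_set (row_finiteD (FF j) IH x) => a [ax].
by rewrite big_cons.
Qed.

Lemma conv_addl f f' g : row_finite f -> row_finite f' ->
  convolution (f \+ f') g = convolution f g \+ convolution f' g.
Proof.
move=> ff ff'; apply/funext => c /=.
pose W := [set a | range_of a = range_of c /\ f a <> 0] `|`
  [set a | range_of a = range_of c /\ f' a <> 0].
have fW : finite_set W by rewrite finite_setU; split; [exact: ff|exact: ff'].
have Wc a : W a -> range_of a = range_of c by case=> -[].
rewrite !(@conv_finite _ _ _ W)//.
- by rewrite -fsbig_split//; apply: eq_fsbigr => a _; rewrite mulrDl.
- by move=> a ac fa; right.
- by move=> a ac fa; left.
- move=> a ac /= fa; have [e|/eqP fa0] := eqVneq (f a) 0; last by left.
  by right; split=> // e'; apply: fa; rewrite e e' addr0.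
Qed.

Lemma conv_suml (J : Type) (s : seq J) (F : J -> Cf) g :
  (forall j, row_finite (F j)) ->
  convolution (fun a => \sum_(j <- s) F j a) g =
  fun c => \sum_(j <- s) convolution (F j) g c.
Proof.
move=> FF; elim: s => [|j s IH]; apply/funext => c.
  by rewrite big_nil; apply: conv_range0 => a _; rewrite big_nil.
have -> : (fun a => \sum_(i <- j :: s) F i a) =
    F j \+ (fun a => \sum_(i <- s) F i a).
  by apply/funext => a; rewrite big_cons.
rewrite conv_addl//; last exact: row_finite_sum.
by rewrite big_cons IH.
Qed.

Lemma conv_scalel (k : C) f g :
  convolution (fun a => k * f a) g = fun c => k * convolution f g c.
Proof.
apply/funext => c; rewrite !convE mulr_fsumr.
by apply: eq_fsbigr => a _; rewrite mulrA.
Qed.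

Lemma conv_scaler (k : C) f g :
  convolution f (fun a => k * g a) = fun c => k * convolution f g c.
Proof.
apply/funext => c; rewrite !convE mulr_fsumr.
by apply: eq_fsbigr => a _; rewrite mulrCA.
Qed.

Lemma conv_addr f g g' : row_finite f ->
  convolution f (g \+ g') = convolution f g \+ convolution f g'.
Proof.
move=> ff; apply/funext => c /=.
pose W := [set a | range_of a = range_of c /\ f a <> 0].
have fW : finite_set W by exact: ff.
have Wc a : W a -> range_of a = range_of c by case.
rewrite !(@conv_finite _ _ _ W)//.
by rewrite -fsbig_split//; apply: eq_fsbigr => a _; rewrite mulrDr.
Qed.

Lemma conv_range_inj_inj f g : range_inj f -> range_inj g ->
  range_inj (convolution f g).
Proof.
move=> fi gi c d /conv_support[a [ac fa ga]] /conv_support[b [bd fb gb]] cd.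
have ab : a = b by apply: fi => //; rewrite ac bd.
subst b; rewrite -(amulVKl ac) -(amulVKl bd); congr amul.
by apply: gi => //; rewrite !amul_range.
Qed.

(** Each convolution by [f] or [g] has at most one nonzero term, and associativity becomes that of
    the arrows. No condition is put on [h], which will be a square summable vector. *)
Lemma convA_inj f g h : range_inj f -> range_inj g ->
  convolution (convolution f g) h = convolution f (convolution g h).
Proof.
move=> fi gi; apply/funext => c.
have [[a [ac fa]]|nc] :=
    pselect (exists a, range_of a = range_of c /\ f a <> 0); last first.
  have f0 a : range_of a = range_of c -> f a = 0.
    by move=> ac; apply: contrapT => fa; apply: nc; exists a.
  rewrite !conv_range0// => a ac; apply: conv_range0 => b ba; apply: f0.
  by rewrite ba.
rewrite (conv_range_inj (convolution g h) fi fa ac).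
have [[b [ba gb]]|nb] :=
    pselect (exists b, range_of b = source_of a /\ g b <> 0); last first.
  have g0 b : range_of b = source_of a -> g b = 0.
    by move=> ba; apply: contrapT => gb; apply: nb; exists b.
  rewrite (conv_range0 (f := g)) ?mulr0; last first.
    by move=> b; rewrite amul_range//; exact: g0.
  apply: conv_range0 => d dc; rewrite (conv_range_inj _ fi fa).
    by rewrite g0 ?mulr0// amul_range//= ac.
  by rewrite ac.
have ab : source_of a = range_of b by [].
have fgab : convolution f g (amul a b) = f a * g b.
  by rewrite (conv_range_inj _ fi fa) ?amul_range// amulKl.
have fgn0 : convolution f g (amul a b) <> 0.
  by rewrite fgab; apply/eqP; rewrite mulf_neq0//; exact/eqP.
rewrite (conv_range_inj _ (conv_range_inj_inj fi gi) fgn0); last first.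
  by rewrite amul_range.
rewrite fgab (conv_range_inj _ gi gb); last by rewrite amul_range.
rewrite mulrA; congr (_ * h _).
by rewrite amul_inv// amulA//= ?amul_range.
Qed.

Lemma involution_range_inj f : source_inj f -> range_inj (involution f).
Proof.
move=> fi a b fa fb ab.
have nz d : involution f d <> 0 -> f (arrow_inv d) <> 0.
  by move=> fd e; apply: fd; rewrite /involution e conjC0.
by rewrite -(arrow_invK a) (fi _ _ (nz _ fa) (nz _ fb) ab) arrow_invK.
Qed.

Lemma involutionK f : involution (involution f) = f.
Proof. by apply/funext => a; rewrite /involution conjCK arrow_invK. Qed.

End Convolution.

Section ComplexContinuity.
Context {R : realType}.
Local Notation C := R[i].

Lemma rc_continuous : continuous (fun x : R => x%:C : C^o).
Proof.
move=> x; apply/cvgrPdist_lt => e e0.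
have re : e = (Re e)%:C by rewrite RRe_real// gtr0_real.
have e0' : 0 < Re e by rewrite -ltcR -re.
have : \forall y \near x, `|x - y| < Re e.
  by have /cvgrPdist_lt := @cvg_id _ (nbhs x); apply.
by apply: filterS => y xy; rewrite -rcB rc_norm re ltcR.
Qed.

Lemma lipschitz_continuous (f : C^o -> R) :
  (forall z w, `|f z - f w|%:C <= `|z - w|) -> continuous f.
Proof.
move=> fle z; apply/(@cvgrPdist_lt R R^o _ (nbhs z) (@nbhs_filter _ z)) => e e0.
have e0' : 0 < e%:C :> C by rewrite ltcR.
have : \forall w \near z, `|z - w| < e%:C.
  by have /cvgrPdist_lt := @cvg_id _ (nbhs z); apply.
by apply: filterS => w zw; rewrite -ltcR (le_lt_trans (fle z w)).
Qed.

Lemma continuous_ReC {Y : topologicalType} (f : Y -> C^o) :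
  continuous f -> continuous (fun y => Re (f y)).
Proof.
move=> cf y; apply: (@continuous_comp _ _ _ f (fun z : C^o => Re z)).
  exact: cf.
by apply: lipschitz_continuous => z w; rewrite -raddfB; exact: normc_ge_Re.
Qed.

Lemma continuous_real {Y : topologicalType} (k : Y -> R) :
  continuous (fun y => (k y)%:C : C^o) -> continuous k.
Proof. exact: continuous_ReC. Qed.

Lemma Re_norm_continuous : continuous (fun z : C^o => Re `|z|).
Proof.
apply: lipschitz_continuous => z w.
by rewrite -rc_norm rcB !Re_normc; exact: ler_dist_dist.
Qed.

Lemma continuous_normC {Y : topologicalType} (f : Y -> C^o) :
  continuous f -> continuous (fun y => Re `|f y|).
Proof.
move=> cf y; apply: (@continuous_comp _ _ _ f (fun z : C^o => Re `|z|)).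
  exact: cf.
exact: Re_norm_continuous.
Qed.

Lemma conj_continuous : continuous (fun z : C^o => (z : C)^* : C^o).
Proof.
move=> z; apply/(@cvgrPdist_lt C C^o _ (nbhs z) (@nbhs_filter _ z)) => e e0.
have : \forall w \near z, `|z - w| < e.
  by have /cvgrPdist_lt := @cvg_id _ (nbhs z); apply.
by apply: filterS => w zw; rewrite -rmorphB norm_conjC.
Qed.

Lemma continuous_mulC {Y : topologicalType} (f g : Y -> C^o) (y : Y) :
  {for y, continuous f} -> {for y, continuous g} ->
  {for y, continuous (fun z => f z * g z : C^o)}.
Proof. by move=> cf cg; exact: (@continuousM C Y f g y cf cg). Qed.

Lemma continuous_addC {Y : topologicalType} (f g : Y -> C^o) (y : Y) :
  {for y, continuous f} -> {for y, continuous g} ->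
  {for y, continuous (fun z => f z + g z : C^o)}.
Proof. by move=> cf cg; exact: (@continuousD C C^o Y f g y cf cg). Qed.

Lemma continuous_conjC {Y : topologicalType} (f : Y -> C^o) (y : Y) :
  {for y, continuous f} -> {for y, continuous (fun z => (f z : C)^* : C^o)}.
Proof.
by move=> cf; apply: (continuous_comp cf); exact: conj_continuous.
Qed.

Lemma continuous_rcC {Y : topologicalType} (p : Y -> R) (y : Y) :
  {for y, continuous p} -> {for y, continuous (fun z => (p z)%:C : C^o)}.
Proof. by move=> cp; apply: (continuous_comp cp); exact: rc_continuous. Qed.

Lemma continuous_cstC {Y : topologicalType} (k : C^o) (y : Y) :
  {for y, continuous (fun _ : Y => k)}.
Proof. exact: (@cst_continuous Y C^o k y). Qed.

End ComplexContinuity.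

Lemma compact_range {X : topologicalType} (T : sgds X) (K : set (arrow T)) :
  compact K -> compact (@range_of X T @` K).
Proof.
apply: continuous_compact; apply: continuous_subspaceT.
exact: range_continuous.
Qed.

Lemma compact_source {X : topologicalType} (T : sgds X) (K : set (arrow T)) :
  compact K -> compact (@source_of X T @` K).
Proof.
apply: continuous_compact; apply: continuous_subspaceT.
exact: source_continuous.
Qed.

(** * Compactly supported functions and bisections *)

Section CompactSupport.
Context {R : realType} {X : topologicalType} (T : sgds X).
Hypothesis hX : hausdorff_space X.
Hypothesis lX : locally_compact [set: X].
Local Notation G := (arrow T).
Local Notation C := R[i].
Local Notation Cf := (G -> R[i]^o).
Implicit Types (a b c : G) (f g h u : Cf).

Let hG : hausdorff_space G := @arrow_hausdorff X T hX.
Let lG : locally_compact [set: G] := @arrow_locally_compact X T R hX lX.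

Lemma Cc_sub f g : Cc R T f -> csupp g `<=` csupp f ->
  (forall a, csupp f a -> {for a, continuous g}) -> Cc R T g.
Proof.
move=> [cf kf] gf cg; split.
  by apply: continuous_csupp => a /gf /cg.
by apply: subclosed_compact kf gf; exact: closed_closure.
Qed.

Lemma CcM f (u : Cf) : Cc R T f ->
  (forall a, csupp f a -> {for a, continuous u}) ->
  Cc R T (fun a => f a * u a).
Proof.
move=> ff cu; apply: Cc_sub (ff) _ _ => [|a /cu cua].
  by apply: csupp_imp => a ->; rewrite mul0r.
have cfa : {for a, continuous f} := proj1 ff a.
exact: (continuous_mulC cfa cua).
Qed.

Lemma Cc0 : Cc R T (fun=> 0).
Proof.
split; first by move=> a; exact: continuous_cstC.
rewrite (_ : mkset _ = set0); first by rewrite closure0; exact: compact0.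
by rewrite -subset0 => a /=; rewrite eqxx.
Qed.

Lemma CcZ (k : C) f : Cc R T f -> Cc R T (fun a => k * f a).
Proof.
move=> ff; apply: Cc_sub (ff) _ _ => [|a _].
  by apply: csupp_imp => a ->; rewrite mulr0.
have cfa : {for a, continuous f} := proj1 ff a.
exact: (continuous_mulC (@continuous_cstC R _ k a) cfa).
Qed.

Lemma CcD f g : Cc R T f -> Cc R T g -> Cc R T (f \+ g).
Proof.
move=> [cf kf] [cg kg]; split.
  by move=> a; exact: (continuous_addC (cf a) (cg a)).
apply: (@csupp_compact _ _ _ (csupp f `|` csupp g)).
- by apply: closedU; exact: closed_closure.
- exact: compactU.
- by move=> a /not_orP[/csupp_out fa /csupp_out ga] /=; rewrite fa ga addr0.
Qed.

Lemma Cc_sum (J : Type) (s : seq J) (F : J -> Cf) :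
  (forall j, Cc R T (F j)) -> Cc R T (fun a => \sum_(j <- s) F j a).
Proof.
move=> FF; elim: s => [|j s IH].
  have -> : (fun a => \sum_(j <- [::]) F j a) = (fun=> 0) :> Cf.
    by apply/funext => a; rewrite big_nil.
  exact: Cc0.
have -> : (fun a => \sum_(i <- j :: s) F i a) =
    F j \+ (fun a => \sum_(i <- s) F i a) :> Cf.
  by apply/funext => a; rewrite big_cons.
exact: CcD.
Qed.

Lemma Cc_involution f : Cc R T f -> Cc R T (involution f).
Proof.
move=> [cf kf]; split.
  move=> a; apply: (@continuous_comp _ _ _ (f \o @arrow_inv X T)); last first.
    exact: conj_continuous.
  by apply: continuous_comp; [exact: arrow_inv_continuous|exact: cf].
have kif : compact (@arrow_inv X T @` csupp f).
  apply: continuous_compact => //; apply: continuous_subspaceT.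
  exact: arrow_inv_continuous.
apply: csupp_compact (kif) _; first exact: compact_closed.
move=> a nfa; rewrite /involution (@csupp_out _ _ f) ?conjC0// => fa; apply: nfa.
by exists (arrow_inv a) => //; rewrite arrow_invK.
Qed.

Lemma Cc_bounded f : Cc R T f -> exists2 M : R, 0 <= M &
  forall a, `|f a| <= M%:C.
Proof.
move=> [cf kf]; have [s0|/set0P s0] := eqVneq (csupp f) set0.
  exists 0 => // a; have -> : f a = 0 by apply: csupp_out; rewrite s0.
  by rewrite normr0.
have [|c cK cmax] := @compact_EVT_max G R (fun a => Re `|f a|) _ s0 kf.
  by apply: continuous_subspaceT; exact: continuous_normC.
exists (Re `|f c|) => [|a]; first by rewrite -ler0c Re_normc.
rewrite Re_normc; have [fa|nfa] := pselect (csupp f a); last first.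
  by rewrite (csupp_out nfa) normr0 -Re_normc ler0c -ler0c Re_normc.
rewrite -(Re_normc (f a)) -(Re_normc (f c)) lecR; apply: cmax.
exact: mem_set.
Qed.

Lemma bisection_nbhd a : exists O : set G, [/\ open O, O a & bisection O].
Proof.
have [m [n [da ra sa e]]] := arrow_levels a.
have [U [V [iU iV _ _ aB]]] := arrow_nbhs_level da ra sa e filterT filterT.
exists (bopen T (m, n, U, V)).
by split=> //; [exact: basic_open_open|exact: basic_open_bisection].
Qed.

(** The closed support is required to lie in the bisection, not just the nonvanishing set, so that
    extension by zero raises no question at the boundary. *)
Definition bis_supp f := exists2 B : set G, bisection B & csupp f `<=` B.

Lemma bis_supp_range_inj f : bis_supp f -> range_inj f.
Proof.
move=> [B [_ rB _] fB] a b fa fb; apply: rB; apply: fB; apply: subset_closure.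
  exact/eqP.
exact/eqP.
Qed.

Lemma bis_supp_source_inj f : bis_supp f -> source_inj f.
Proof.
move=> [B [_ _ sB] fB] a b fa fb; apply: sB; apply: fB; apply: subset_closure.
  exact/eqP.
exact/eqP.
Qed.

Lemma bis_supp_sub f g : bis_supp f -> (forall a, f a = 0 -> g a = 0) ->
  bis_supp g.
Proof.
move=> [B bB fB] fg; exists B => //; apply: subset_trans fB.
exact: csupp_imp.
Qed.

Lemma bis_partition (K : set G) : compact K ->
  exists (s : seq G) (chi : G -> G -> R),
    [/\ forall a, Cc R T (fun c => (chi a c)%:C),
        forall a, bis_supp (fun c => (chi a c)%:C : R[i]^o),
        forall a c, 0 <= chi a c <= 1 &
        forall c, K c -> \sum_(a <- s) chi a c ^+ 2 = 1].
Proof.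
move=> kK; have [|s [chi [chiP sum1 _]]] :=
    partition_of_unity (R := R) hG lG kK (P := @bisection X T).
  by move=> a _; exact: bisection_nbhd.
(* Indices outside the list get the zero function, so that the support properties hold for every
   index. *)
exists s, (fun a c => if a \in s then chi a c else 0); split=> [a|a|a c|c Kc].
- case: (boolP (a \in s)) => sa; last exact: Cc0.
  have [ca _ ka _] := chiP a sa; split.
    by move=> b; exact: (continuous_rcC (ca b)).
  apply: subclosed_compact ka _; first exact: closed_closure.
  by apply: closureS => b /=; apply: contra => /eqP ->.
- case: (boolP (a \in s)) => sa; last first.
    have [V [oV _ bV]] := bisection_nbhd a; exists V => // b.
    by rewrite /csupp (_ : mkset _ = set0) ?closure0// -subset0 => d /=; rewrite eqxx.
  have [_ _ _ [V [oV bV cV]]] := chiP a sa; exists V => //.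
  by apply: subset_trans cV; apply: closureS => b /=; apply: contra => /eqP ->.
- case: (boolP (a \in s)) => sa; last by rewrite lexx ler01.
  by have [_ /(_ c)] := chiP a sa.
- by rewrite -(sum1 c Kc) big_seq [RHS]big_seq; apply: eq_bigr => a ->.
Qed.

Lemma Cc_bis_partition f : Cc R T f ->
  exists (s : seq G) (th : G -> Cf), [/\ forall a, Cc R T (th a),
    forall a, bis_supp (th a), forall a c, `|th a c| <= 1 &
    forall c, csupp f c -> \sum_(a <- s) th a c = 1].
Proof.
move=> [_ kf]; have [s [chi [Cchi bchi chi01 sum1]]] := bis_partition kf.
exists s, (fun a c => (chi a c)%:C * (chi a c)%:C); split=> [a|a|a c|c fc].
- by apply: CcM => // b _; exact: (proj1 (Cchi a) b).
- by apply: bis_supp_sub (bchi a) _ => c ->; rewrite mulr0.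
- have /andP[c0 c1] := chi01 a c.
  by rewrite -rcM -expr2 rc_norm (ger0_norm (sqr_ge0 _)) lecR expr_le1.
- transitivity ((\sum_(a <- s) chi a c ^+ 2)%:C); last by rewrite sum1.
  by rewrite rc_sum; apply: eq_bigr => a _; rewrite expr2 rcM.
Qed.

(** Reduces bilinear statements about convolution to functions supported in bisections, for which
    convolution sums have one term. *)
Lemma Cc_decomposition f : Cc R T f ->
  exists (s : seq G) (F : G -> Cf), [/\ forall a, Cc R T (F a),
    forall a, bis_supp (F a) &
    f = (fun c => \sum_(a <- s) F a c)].
Proof.
move=> ff; have [s [th [Cth bth _ sum1]]] := Cc_bis_partition ff.
exists s, (fun a c => th a c * f c); split=> [a|a|].
- by apply: CcM => // c _; exact: (proj1 ff).
- by apply: bis_supp_sub (bth a) _ => c ->; rewrite mul0r.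
- apply/funext => c; rewrite -mulr_suml.
  have [fc|nfc] := pselect (csupp f c); last by rewrite csupp_out// mulr0.
  by rewrite sum1// mul1r.
Qed.

Lemma Cc_row_finite f : Cc R T f -> row_finite f.
Proof.
move=> ff; have [s [F [_ bF ->]]] := Cc_decomposition ff.
by apply: row_finite_sum => a; exact/range_inj_row_finite/bis_supp_range_inj.
Qed.

(** With [sigma] the section of the bisection, the convolution near a point over it is
    $f(\sigma(r(d)))\, g(\sigma(r(d))^{-1} d)$, a composite of continuous maps. Elsewhere it
    vanishes locally, because the ranges of the support of [f] form a closed set. *)
Lemma conv_continuous_bis f g : Cc R T f -> bis_supp f -> Cc R T g ->
  continuous (convolution f g).
Proof.
move=> ff bf gg c; have fi := bis_supp_range_inj bf.
have [B bB fB] := bf; have [oB rB _] := bB.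
have [sigma sB] := bisection_section bB.
have fB' a : f a <> 0 -> B a.
  by move=> fa; apply/fB/subset_closure/eqP.
have [[b [Bb bc]]|nb] := pselect (exists b, B b /\ range_of b = range_of c).
  have rc : \forall d \near c, (@range_of X T @` B) (range_of d).
    apply: (@range_continuous X T c); rewrite -bc; apply: range_nbhs.
    exact: open_nbhs_nbhs.
  have E : \forall d \near c,
      f (sigma (range_of d)) * g (amul (arrow_inv (sigma (range_of d))) d) =
      convolution f g d.
    apply: filterS rc => d [a Ba ad]; rewrite -ad sB//.
    by rewrite (conv_bisection g rB fB' Ba ad).
  have cs : {for c, continuous (sigma \o @range_of X T)}.
    apply: continuous_comp; first exact: range_continuous.
    by rewrite -bc; exact: (section_continuous oB sB).
  have sc : sigma (range_of c) = b by rewrite -bc sB.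
  have cam : {for c, continuous (fun d => amul (arrow_inv (sigma (range_of d))) d)}.
    apply: (@cvg_amul X T G (nbhs c)
      (fun d => arrow_inv (sigma (range_of d))) id) => //.
    - apply: (@continuous_comp _ _ _ (sigma \o @range_of X T)) => //.
      exact: arrow_inv_continuous.
    - by rewrite sc.
    - by apply: filterS rc => d [a Ba ad] /=; rewrite -ad sB.
  have cfs : {for c, continuous (f \o (sigma \o @range_of X T))}.
    exact: (@continuous_comp _ _ _ _ f c cs (proj1 ff _)).
  have cgs : {for c, continuous (g \o
      (fun d => amul (arrow_inv (sigma (range_of d))) d))}.
    exact: (@continuous_comp _ _ _ _ g c cam (proj1 gg _)).
  rewrite /continuous_at -(nbhs_singleton E).
  exact: (cvg_trans (near_eq_cvg E) (continuous_mulC cfs cgs)).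
have kr := compact_range (proj2 ff).
have E : \forall d \near c, 0 = convolution f g d.
  have : open_nbhs (range_of c) (~` (@range_of X T @` csupp f)).
    split; first by apply: closed_openC; exact: compact_closed.
    by move=> [a /fB Ba ac]; apply: nb; exists a.
  move=> /open_nbhs_nbhs /(@range_continuous X T c) h.
  have {}h : nbhs c (@range_of X T @^-1` (~` (@range_of X T @` csupp f))) by [].
  apply: filterS h => d /= nd.
  rewrite conv_range0// => a ad; apply: csupp_out => fa; apply: nd.
  by exists a.
rewrite /continuous_at -(nbhs_singleton E).
exact: (cvg_trans (near_eq_cvg E) (@continuous_cstC R _ 0 c)).
Qed.

Lemma Cc_conv f g : Cc R T f -> Cc R T g -> Cc R T (convolution f g).
Proof.
move=> ff gg; split.
  have [s [F [CF bF fE]]] := Cc_decomposition ff.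
  have -> : convolution f g = (fun c => \sum_(a <- s) convolution (F a) g c).
    rewrite fE conv_suml// => a.
    exact/range_inj_row_finite/bis_supp_range_inj.
  elim: s {fE} => [|a s IH].
    rewrite (_ : (fun c => _) = fun=> 0); last first.
      by apply/funext => c; rewrite big_nil.
    by move=> c; exact: continuous_cstC.
  rewrite (_ : (fun c => _) = fun c =>
    convolution (F a) g c + \sum_(a <- s) convolution (F a) g c); last first.
    by apply/funext => c; rewrite big_cons.
  move=> c; have c1 := @conv_continuous_bis (F a) g (CF a) (bF a) gg c.
  exact: (continuous_addC c1 (IH c)).
have kM := compact_amul hX (proj2 ff) (proj2 gg).
apply: csupp_compact (kM) _; first exact: compact_closed.
move=> c nM; apply: contrapT => /conv_support[a [ac fa ga]]; apply: nM.
exists (a, amul (arrow_inv a) c) => /=; last exact: amulVKl.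
split; first by split; apply/subset_closure/eqP.
by rewrite /composable/= amul_range.
Qed.

End CompactSupport.

(** * The unit space and the conditional expectation *)

Section Units.
Context {R : realType} {X : topologicalType} (T : sgds X).
Hypothesis hX : hausdorff_space X.
Local Notation G := (arrow T).
Local Notation C := R[i].
Local Notation Cf := (G -> R[i]^o).
Implicit Types (a b c : G) (f g h : Cf) (x : X) (phi psi : X -> R[i]^o).

Let hG : hausdorff_space G := @arrow_hausdorff X T hX.

Definition units : set G := [set c | c = aunit T (range_of c)].

Lemma unitsP c : units c <-> exists x, c = aunit T x.
Proof. by split=> [->|[x ->]]; [exists (range_of c)|]. Qed.

Lemma units_basic : units = bopen T (0%N, 0%N, setT, setT).
Proof.
apply/seteqP; split=> [_ /unitsP[x ->]|c [dc _ _ rs]]; first by split.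
by apply: arrow_ext.
Qed.

Lemma units_bisection : bisection units.
Proof.
rewrite units_basic; apply: basic_open_bisection.
have iT : injective_on T 0 [set: X] by split=> //; exact: openT.
by split.
Qed.

Lemma aunit_continuous : continuous (aunit T).
Proof.
have [oU _ _] := units_bisection.
move=> x; have := @section_continuous X T units (aunit T) oU _ (aunit T x).
by apply=> // b ->.
Qed.

Lemma units_closed : closed units.
Proof.
move=> c cU; apply: hG => A B cA cB.
have cr : {for c, continuous (aunit T \o @range_of X T)}.
  by apply: continuous_comp; [exact: range_continuous|exact: aunit_continuous].
have {cr} cB' : nbhs c ((aunit T \o @range_of X T) @^-1` B) by exact: cr.
have [d [Ud [Ad Bd]]] := cU _ (filterI cA cB').
by exists d; split=> //; rewrite {1}Ud.
Qed.

Definition lift phi : Cf := fun c =>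
  if `[< units c >] then phi (range_of c) else 0.

Lemma lift1 phi x : lift phi (aunit T x) = phi x.
Proof. by rewrite /lift asboolT. Qed.

Lemma lift0 phi c : ~ units c -> lift phi c = 0.
Proof. by move=> nU; rewrite /lift asboolF. Qed.

Lemma lift_units phi c : lift phi c <> 0 -> units c.
Proof. by move=> h; apply: contrapT => /(lift0 phi). Qed.

Definition CcX : set (X -> R[i]^o) :=
  [set phi | continuous phi /\ compact (csupp phi)].

(** The units are open and closed, so extension by zero is continuous on both parts. *)
Lemma Cc_lift phi : CcX phi -> Cc R T (lift phi).
Proof.
move=> [cphi kphi]; split.
  move=> c; have [Uc|nUc] := pselect (units c).
    have E : \forall d \near c, (phi \o @range_of X T) d = lift phi d.
      have [oU _ _] := units_bisection.
      apply: filterS (open_nbhs_nbhs (conj oU Uc)) => d Ud.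
      by rewrite /lift asboolT.
    rewrite /continuous_at -(nbhs_singleton E).
    apply: (cvg_trans (near_eq_cvg E)).
    exact: (@continuous_comp _ _ _ _ phi c (@range_continuous X T c) (cphi _)).
  have E : \forall d \near c, 0 = lift phi d.
    apply: filterS (open_nbhs_nbhs (conj (closed_openC units_closed) nUc)).
    by move=> d /(lift0 phi) ->.
  rewrite /continuous_at -(nbhs_singleton E).
  exact: (cvg_trans (near_eq_cvg E) (@continuous_cstC R _ 0 c)).
have k1 : compact (aunit T @` csupp phi).
  apply: continuous_compact => //; apply: continuous_subspaceT.
  exact: aunit_continuous.
apply: csupp_compact (k1) _; first exact: compact_closed.
move=> c nc; have [Uc|/(lift0 phi)//] := pselect (units c).
rewrite Uc lift1; apply: csupp_out => h; apply: nc.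
by exists (range_of c).
Qed.

Lemma CcX_restrict f : Cc R T f -> CcX (fun x => f (aunit T x)).
Proof.
move=> [cf kf]; split.
  rewrite -[X in continuous X]/(f \o aunit T) => x.
  by apply: continuous_comp; [exact: aunit_continuous|exact: cf].
have kr : compact (@range_of X T @` csupp f).
  apply: continuous_compact => //; apply: continuous_subspaceT.
  exact: range_continuous.
apply: csupp_compact (kr) _; first exact: compact_closed.
move=> x nx; apply: csupp_out => h; apply: nx.
by exists (aunit T x).
Qed.

(* [condE] is the conditional expectation of the convolution algebra onto the
   functions supported on the unit space. *)
Definition condE f : Cf := lift (fun x => f (aunit T x)).

Lemma Cc_condE f : Cc R T f -> Cc R T (condE f).
Proof. by move=> /CcX_restrict /Cc_lift. Qed.

Lemma conv_liftl phi f :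
  convolution (lift phi) f = fun c => phi (range_of c) * f c.
Proof.
have [_ rU _] := units_bisection; apply/funext => c.
have U : units (aunit T (range_of c)) by [].
rewrite (@conv_bisection R X T (lift phi) f (aunit T (range_of c)) c units)//.
  by rewrite lift1 arrow_inv1 amul1l.
exact: lift_units.
Qed.

Lemma conv_liftr f phi :
  convolution f (lift phi) = fun c => f c * phi (source_of c).
Proof.
have [_ _ sU] := units_bisection; apply/funext => c.
have [p0|/eqP p0] := eqVneq (phi (source_of c)) 0.
  rewrite p0 mulr0; apply: conv_source0 => b bc.
  have [Ub|/(lift0 phi)//] := pselect (units b).
  rewrite Ub lift1 -p0 -bc; congr phi.
  by rewrite [in RHS]Ub.
rewrite (@conv_source_inj R X T f (lift phi) (aunit T (source_of c)))//.
- by rewrite lift1 arrow_inv1 amul1r.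
- by move=> a b /lift_units Ua /lift_units Ub; exact: sU.
- by rewrite lift1.
Qed.

Lemma conv_lift phi psi :
  convolution (lift phi) (lift psi) = lift (fun x => phi x * psi x).
Proof.
rewrite conv_liftl; apply/funext => c; rewrite /lift.
by case: asboolP => // _; rewrite mulr0.
Qed.

Lemma involution_lift phi :
  involution (lift phi) = lift (fun x => (phi x : C)^*).
Proof.
apply/funext => c; rewrite /involution /lift.
have [Uc|nUc] := pselect (units c).
  have -> : arrow_inv c = c by rewrite Uc arrow_inv1.
  by rewrite asboolT.
rewrite [in RHS]asboolF// asboolF ?conjC0// => /unitsP[x e]; apply: nUc.
by rewrite -(arrow_invK c) e arrow_inv1.
Qed.

End Units.

(** * The regular representation *)

Section HasSumReindex.
Context {R : realType} {I : choiceType}.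
Local Notation C := R[i].

(** Translation by a bisection is a partial bijection of the arrows: defined and injective on [D],
    reaching every index where [v] is nonzero. *)
Lemma has_sum_partial_bij (u v : I -> C) (D : set I) (tau : I -> I) (s : C) :
  (forall c c', D c -> D c' -> tau c = tau c' -> c = c') ->
  (forall c, D c -> u c = v (tau c)) -> (forall c, ~ D c -> u c = 0) ->
  (forall d, v d <> 0 -> exists2 c, D c & tau c = d) ->
  has_sum v s -> has_sum u s.
Proof.
move=> tinj uv u0 v0 vs e e0; have [F0 F0s] := vs e e0.
have /choice[rho rhoP] : forall d, exists c, v d <> 0 -> D c /\ tau c = d.
  move=> d; have [/v0[c Dc cd]|nv] := pselect (v d <> 0); first by exists c.
  by exists d.
exists [fset rho d | d in F0]%fset => F FF0.
pose F1 : {fset I} := [fset c in F | `[< D c >]]%fset.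
pose H1 : {fset I} := [fset tau c | c in F1]%fset.
have F1D c : c \in F1 -> D c by rewrite !inE => /andP[_ /asboolP].
have uF : \sum_(c <- F) u c = \sum_(d <- H1) v d.
  rewrite big_imfset/=; last by move=> c c' /F1D Dc /F1D Dc'; exact: tinj.
  rewrite -(@big_fset_incl _ _ _ _ F1); last 2 first.
  - by apply/fsubsetP => c; rewrite !inE => /andP[].
  - move=> c cF; rewrite !inE/= cF/= => /asboolP; exact: u0.
  by apply: eq_big_seq => c /F1D; exact: uv.
have vH : \sum_(d <- (H1 `|` F0)%fset) v d = \sum_(d <- H1) v d.
  rewrite -(@big_fset_incl _ _ _ _ H1) ?fsubsetUl// => d dH dnH.
  apply: contrapT => /rhoP[Dr rd].
  move/negP: (dnH); apply; rewrite -rd; apply: in_imfset.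
  rewrite /= !inE/=; apply/andP; split; last exact/asboolP.
  apply: (fsubsetP FF0); apply: in_imfset.
  by move: dH; rewrite inE (negbTE dnH).
by rewrite uF -vH; apply: F0s; exact: fsubsetUr.
Qed.

End HasSumReindex.

Section RegularRepresentation.
Context {R : realType} {X : topologicalType} (T : sgds X).
Hypothesis hX : hausdorff_space X.
Hypothesis lX : locally_compact [set: X].
Local Notation G := (arrow T).
Local Notation C := R[i].
Local Notation Cf := (G -> R[i]^o).
Local Notation L := (l2 R G).
Implicit Types (a b c d : G) (f g h : Cf) (x y : L).

(** The default 0 makes this total; for convolution by a function in [Cc] it is excluded by
    [conv_bounded_Cc]. *)
Definition l2_of (u : G -> C) : L :=
  if pselect (sqsum u) is left h then L2 (introT (asboolP _) h) else 0.

Lemma l2_ofE (u : G -> C) c : sqsum u -> l2_of u c = u c.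
Proof. by rewrite /l2_of; case: pselect. Qed.

Definition regrep f x : L := l2_of (convolution f (x : Cf)).

Definition conv_bounded f := exists M : C, forall x, exists2 y : L,
  (forall c, y c = convolution f (x : Cf) c) & `|y| <= M * `|x|.

(** The convolution has at most one term, $f(a)\, x(a^{-1} c)$, and $c \mapsto a^{-1} c$ is
    injective where it is nonzero because sources are injective on the support. Hence the supremum
    of [f] bounds the operator. *)
Lemma conv_bounded_bis f : Cc R T f -> bis_supp f -> conv_bounded f.
Proof.
move=> ff bf; have fi := bis_supp_range_inj bf.
have fs := bis_supp_source_inj bf.
have [M M0 fM] := Cc_bounded ff.
have M0' : 0 <= M%:C :> C by rewrite ler0c.
exists M%:C => x.
have /choice[al alP] : forall c, exists a, convolution f (x : Cf) c <> 0 ->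
    [/\ range_of a = range_of c, f a <> 0 &
     convolution f (x : Cf) c = f a * x (amul (arrow_inv a) c)].
  move=> c; have [/conv_support[a [ac fa _]]|n0] :=
    pselect (convolution f (x : Cf) c <> 0); last by exists c.
  by exists a => _; split=> //; exact: conv_range_inj.
pose tau c := amul (arrow_inv (al c)) c.
pose D := [set c | convolution f (x : Cf) c <> 0].
have tinj c c' : D c -> D c' -> tau c = tau c' -> c = c'.
  move=> /alP[ac fa _] /alP[ac' fa' _]; rewrite /tau => e.
  have aa : al c = al c'.
    apply: fs => //; have := congr1 (@range_of X T) e.
    by rewrite !amul_range.
  by rewrite -(amulVKl ac) -(amulVKl ac') e aa.
have bound (F : {fset G}) :
    \sum_(c <- F) `|convolution f (x : Cf) c| ^+ 2 <= (M%:C * `|x|) ^+ 2.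
  pose F1 : {fset G} := [fset c in F | `[< D c >]]%fset.
  have F1D c : c \in F1 -> D c by rewrite !inE => /andP[_ /asboolP].
  rewrite -(@big_fset_incl _ _ _ _ F1); last 2 first.
  - by apply/fsubsetP => c; rewrite !inE => /andP[].
  - move=> c cF; rewrite !inE/= cF/= => /asboolP/contrapT ->.
    by rewrite normr0 expr0n.
  apply: (@le_trans _ _ (\sum_(c <- F1) M%:C ^+ 2 * `|x (tau c)| ^+ 2)).
    rewrite big_seq [leRHS]big_seq; apply: ler_sum => c /F1D /alP[_ _ ->].
    rewrite normrM exprMn ler_wpM2r ?exprn_ge0// lerXn2r ?nnegrE//.
  rewrite -mulr_sumr exprMn ler_wpM2l ?exprn_ge0// -l2_norm_inner.
  have := l2_inner_le x [fset tau c | c in F1]%fset.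
  rewrite big_imfset//=.
  by move=> c c' /F1D Dc /F1D Dc'; exact: tinj.
have sq : sqsum (convolution f (x : Cf)).
  exists (Re ((M%:C * `|x|) ^+ 2)) => F; rewrite RRe_real//.
  by apply: ger0_real; rewrite exprn_ge0// mulr_ge0.
exists (l2_of (convolution f (x : Cf))); first by move=> c; exact: l2_ofE.
apply: l2_norm_leP; first by rewrite mulr_ge0.
by move=> F; under eq_bigr do rewrite l2_ofE//.
Qed.

Lemma conv_bounded_Cc f : Cc R T f -> conv_bounded f.
Proof.
move=> ff; have [s [F [CF bF ->]]] := Cc_decomposition hX lX ff.
elim: s => [|a s [M IH]].
  exists 0 => x; exists 0; last by rewrite normr0 mul0r.
  move=> c; rewrite conv_range0// => a _; by rewrite big_nil.
have [Ma Ha] := conv_bounded_bis (CF a) (bF a).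
exists (Ma + M) => x; have [y yE yM] := IH x; have [z zE zM] := Ha x.
exists (z + y) => [c|]; last first.
  by rewrite mulrDl (le_trans (ler_normD _ _))// lerD.
rewrite l2_addE yE zE !conv_suml ?big_cons// => b;
  exact/range_inj_row_finite/bis_supp_range_inj.
Qed.

Lemma regrepE f x c : Cc R T f -> regrep f x c = convolution f (x : Cf) c.
Proof.
move=> /conv_bounded_Cc[M /(_ x)[y yE _]]; apply: l2_ofE.
by have := l2_sqsum y; rewrite (_ : (y : G -> C) = convolution f (x : Cf))//;
  exact/funext.
Qed.

Lemma regrep_bounded f : Cc R T f ->
  exists M : C, forall x, `|regrep f x| <= M * `|x|.
Proof.
move=> ff; have [M H] := conv_bounded_Cc ff; exists M => x.
have [y yE yM] := H x; rewrite (_ : regrep f x = y)//.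
by apply: l2P => c; rewrite regrepE.
Qed.

Lemma conv_sumr (J : Type) (s : seq J) (F : J -> Cf) f : row_finite f ->
  convolution f (fun a => \sum_(j <- s) F j a) =
  fun c => \sum_(j <- s) convolution f (F j) c.
Proof.
move=> ff; elim: s => [|j s IH]; apply/funext => c.
  by rewrite big_nil; apply: conv_source0 => a _; rewrite big_nil.
have -> : (fun a => \sum_(i <- j :: s) F i a) =
    F j \+ (fun a => \sum_(i <- s) F i a).
  by apply/funext => a; rewrite big_cons.
by rewrite conv_addr// big_cons IH.
Qed.

(** By bilinearity from [convA_inj]; [h] stays arbitrary so that the identity can be used on
    vectors. *)
Lemma convA f g h : Cc R T f -> Cc R T g ->
  convolution (convolution f g) h = convolution f (convolution g h).
Proof.
move=> ff gg; have [s [F [CF bF ->]]] := Cc_decomposition hX lX ff.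
have [t [K [CK bK ->]]] := Cc_decomposition hX lX gg.
have Fi a : range_inj (F a) by exact: bis_supp_range_inj.
have Ki a : range_inj (K a) by exact: bis_supp_range_inj.
have Ff a : row_finite (F a) by exact: range_inj_row_finite.
have Kf a : row_finite (K a) by exact: range_inj_row_finite.
rewrite !conv_suml//; last first.
  move=> a; rewrite conv_sumr//; apply: row_finite_sum => b.
  exact/range_inj_row_finite/conv_range_inj_inj.
apply/funext => c; apply: eq_bigr => a _.
rewrite !conv_sumr// conv_suml; last first.
  by move=> b; exact/range_inj_row_finite/conv_range_inj_inj.
by apply: eq_bigr => b _; rewrite convA_inj.
Qed.

(** The translation $c \mapsto a^{-1} c$ matches the nonzero terms of the two inner products. *)
Lemma regrep_star_bis f x y x' y' : bis_supp f ->
  (forall c, x' c = convolution f (x : Cf) c) ->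
  (forall c, y' c = convolution (involution f) (y : Cf) c) ->
  l2_inner x' y = l2_inner x y'.
Proof.
move=> bf x'E y'E; have fi := bis_supp_range_inj bf.
have fs := bis_supp_source_inj bf.
have ifi := involution_range_inj fs.
have /choice[al alP] : forall c, exists a,
    (exists b, range_of b = range_of c /\ f b <> 0) ->
    range_of a = range_of c /\ f a <> 0.
  move=> c; have [[b hb]|nb] :=
    pselect (exists b, range_of b = range_of c /\ f b <> 0).
    by exists b.
  by exists c.
pose D := [set c : G | exists b : G, range_of b = range_of c /\ f b <> 0].
pose tau c := amul (arrow_inv (al c)) c.
apply: l2_innerE.
apply: (has_sum_partial_bij (D := D) (tau := tau) _ _ _ _ (l2_innerP x y')).
- move=> c c' /alP[ac fa] /alP[ac' fa']; rewrite /tau => e.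
  have aa : al c = al c'.
    apply: fs => //; have := congr1 (@range_of X T) e.
    by rewrite !amul_range.
  by rewrite -(amulVKl ac) -(amulVKl ac') e aa.
- move=> c /alP[ac fa]; rewrite x'E (conv_range_inj _ fi fa ac) y'E.
  have ifa : involution f (arrow_inv (al c)) <> 0.
    by rewrite /involution arrow_invK; apply/eqP; rewrite conjC_eq0; exact/eqP.
  rewrite (conv_range_inj _ ifi ifa); last by rewrite amul_range.
  rewrite /tau arrow_invK amulVKl// rmorphM/= /involution arrow_invK conjCK.
  by rewrite mulrA [x _ * _]mulrC.
- move=> c nD; rewrite x'E conv_range0 ?mul0r// => a ac.
  by apply: contrapT => fa; apply: nD; exists a.
- move=> d h; have : convolution (involution f) (y : Cf) d <> 0.
    by rewrite -y'E => e; apply: h; rewrite e conjC0 mulr0.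
  move=> /conv_support[b [bd ifb _]].
  have fb : f (arrow_inv b) <> 0.
    by move=> e; apply: ifb; rewrite /involution e conjC0.
  have hs : source_of (arrow_inv b) = range_of d by [].
  have Dc : D (amul (arrow_inv b) d).
    by exists (arrow_inv b); split=> //; rewrite amul_range.
  exists (amul (arrow_inv b) d) => //.
  have [ac fa] := alP _ Dc.
  have -> : tau (amul (arrow_inv b) d) = amul b (amul (arrow_inv b) d).
    rewrite /tau; have -> : al (amul (arrow_inv b) d) = arrow_inv b.
      by apply: fi => //; rewrite ac amul_range.
    by rewrite arrow_invK.
  exact: amulVKl.
Qed.

Lemma regrep_star f x y : Cc R T f ->
  l2_inner (regrep f x) y = l2_inner x (regrep (involution f) y).
Proof.
move=> ff.
have iff' : Cc R T (involution f) by exact: Cc_involution.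
(* The claim is generalized to all vectors with the prescribed coordinates, so that the induction
   over the decomposition can subtract one term at a time. *)
have : forall x' y', (forall c, x' c = convolution f (x : Cf) c) ->
  (forall c, y' c = convolution (involution f) (y : Cf) c) ->
  l2_inner x' y = l2_inner x y'; last first.
  by apply => c; exact: regrepE.
have [s [F [CF bF fE]]] := Cc_decomposition hX lX ff.
have Ff a : row_finite (F a).
  exact/range_inj_row_finite/bis_supp_range_inj.
have IFf a : row_finite (involution (F a)).
  exact/range_inj_row_finite/involution_range_inj/bis_supp_source_inj.
rewrite {}fE {iff' ff}; have -> : involution (fun c => \sum_(a <- s) F a c) =
    (fun c => \sum_(a <- s) involution (F a) c).
  by apply/funext => c; rewrite /involution rmorph_sum.
rewrite !conv_suml//.
elim: s => [|a s IH] x' y' x'E y'E.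
  have -> : x' = 0 by apply: l2P => c; rewrite x'E big_nil.
  have -> : y' = 0 by apply: l2P => c; rewrite y'E big_nil.
  have := linear0r (@l2_inner R G) x; rewrite /= => ->.
  by have := linear0l (@l2_inner R G) y; rewrite /= => ->.
have [Ma /(_ x)[xa xaE _]] := conv_bounded_bis (CF a) (bF a).
have [Mb /(_ y)[ya yaE _]] :=
  conv_bounded_Cc (Cc_involution hX (CF a)).
have xx : x' = xa + (x' - xa) by rewrite addrC subrK.
have yy : y' = ya + (y' - ya) by rewrite addrC subrK.
rewrite xx yy (dotDl (@l2_inner R G)) (dotDr (@l2_inner R G)); congr (_ + _).
  exact: regrep_star_bis (bF a) xaE yaE.
apply: IH => c.
  by rewrite l2_addE l2_oppE x'E xaE big_cons addrC addKr.
by rewrite l2_addE l2_oppE y'E yaE big_cons addrC addKr.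
Qed.

(** All arrows are used at once: this is the direct sum over the units [x] of the regular
    representations on the arrows with source [x]. It supplies lower bounds for the full norm. *)
Lemma regrep_star_representation :
  star_representation (H := l2_hilbert R G) regrep.
Proof.
split.
- move=> f ff; split; last exact: regrep_bounded.
  move=> k x y; apply: l2P => c.
  rewrite l2_addE l2_scaleE !regrepE//.
  have -> : (k *: x + y : L) = (fun a => k * x a) \+ y :> Cf by [].
  rewrite conv_addr; last exact: Cc_row_finite.
  by rewrite conv_scaler.
- move=> f g ff gg v; apply: l2P => c; rewrite l2_addE !regrepE//; last first.
    exact: CcD.
  by rewrite conv_addl//; exact: Cc_row_finite.
- move=> k f ff v; apply: l2P => c; rewrite l2_scaleE !regrepE//; last first.
    exact: CcZ.
  by rewrite conv_scalel.
- move=> f g ff gg v; apply: l2P => c; rewrite !regrepE//; last exact: Cc_conv.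
  rewrite convA//; congr (convolution f _ c); apply/funext => d.
  by rewrite regrepE.
- by move=> f ff v w; exact: regrep_star.
Qed.

Definition l2_delta d : L := l2_of (fun c => (c == d)%:R).

Lemma delta_sum d (F : {fset G}) :
  \sum_(c <- F) `|(c == d)%:R| ^+ 2 <= 1 :> C.
Proof.
have [dF|dF] := boolP (d \in F).
  rewrite (big_fsetD1 d)//= eqxx normr1 expr1n big_seq big1 ?addr0//.
  by move=> c; rewrite !inE => /andP[/negPf -> _]; rewrite normr0 expr0n.
rewrite big_seq big1 ?ler01// => c cF; case: eqVneq => [e|_].
  by rewrite -e cF in dF.
by rewrite normr0 expr0n.
Qed.

Lemma l2_deltaE d c : l2_delta d c = (c == d)%:R.
Proof. by apply: l2_ofE; exists 1 => F; exact: delta_sum. Qed.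

Lemma l2_delta_norm d : `|l2_delta d| <= 1.
Proof.
apply: l2_norm_leP => // F; rewrite expr1n.
by under eq_bigr do rewrite l2_deltaE; exact: delta_sum.
Qed.

Lemma regrep_delta f c : Cc R T f ->
  regrep f (l2_delta (aunit T (source_of c))) c = f c.
Proof.
move=> ff; rewrite regrepE//.
set d := aunit T _.
have di : source_inj (l2_delta d : Cf).
  move=> a b; rewrite !l2_deltaE.
  by case: eqVneq => // -> _; case: eqVneq => // ->.
rewrite (@conv_source_inj R X T f (l2_delta d) d c di)//.
  by rewrite l2_deltaE eqxx mulr1 arrow_inv1 amul1r.
by rewrite l2_deltaE eqxx; apply/eqP; exact: oner_neq0.
Qed.

End RegularRepresentation.

(** * Norm estimates in the groupoid C*-algebra *)

Section PowerTrick.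
Context {R : realType}.

Lemma bernoulli_ineq (a : R) n : 0 <= a -> 1 + n%:R * a <= (1 + a) ^+ n.
Proof.
move=> a0; elim: n => [|n IH]; first by rewrite mul0r addr0 expr0.
rewrite exprS; apply: (@le_trans _ _ ((1 + a) * (1 + n%:R * a))); last first.
  by rewrite ler_wpM2l// addr_ge0.
rewrite -natr1; have : 0 <= n%:R * a * a by rewrite !mulr_ge0.
by nra.
Qed.

(** If [x] exceeded a positive [M], the powers of [x / M] would be unbounded by Bernoulli, whereas
    they stay below [K]. *)
Lemma power_trick (x M K : R) : 0 <= M ->
  (forall n, x ^+ (2 ^ n) <= M ^+ (2 ^ n) * K) -> x <= M.
Proof.
move=> M0 H; rewrite leNgt; apply/negP => Mx.
have x0 : 0 < x by exact: le_lt_trans Mx.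
have [M00|M1] := eqVneq M 0.
  have := H 0%N; rewrite M00 expn0 !expr1 mul0r; lra.
have {}M0 : 0 < M by rewrite lt_def M1.
pose a := x / M - 1.
have a0 : 0 < a by rewrite subr_gt0 ltr_pdivlMr// mul1r.
have HK n : n%:R * a <= K.
  have := H n; rewrite mulrC -ler_pdivrMr ?exprn_gt0// -expr_div_n => HK.
  apply: le_trans HK; have -> : x / M = 1 + a by rewrite /a addrC subrK.
  apply: le_trans (bernoulli_ineq (2 ^ n) (ltW a0)).
  rewrite ler_wpDl// ler_wpM2r ?(ltW a0)// ler_nat.
  by apply: ltnW; exact: ltn_expl.
have K0 : 0 <= K / a.
  by rewrite divr_ge0 ?(ltW a0)//; have := HK 0%N; rewrite mul0r.
have := archi_boundP K0; rewrite ltr_pdivrMr// => /lt_le_trans/(_ (HK _)).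
by rewrite ltxx.
Qed.

Lemma power_trickC (x M K : R[i]) : 0 <= x -> 0 <= M -> 0 <= K ->
  (forall n, x ^+ (2 ^ n) <= M ^+ (2 ^ n) * K) -> x <= M.
Proof.
move=> x0 M0 K0 H.
have rx := RRe_real (ger0_real x0).
have rM := RRe_real (ger0_real M0).
have rK := RRe_real (ger0_real K0).
rewrite -rx -rM lecR; apply: (@power_trick _ _ (Re K)).
  by rewrite -ler0c rM.
by move=> n; have := H n; rewrite -{1}rx -{1}rM -{1}rK -!rcX -rcM lecR.
Qed.

Lemma quadratic_discriminant (a b c : R) : 0 <= a -> 0 <= c ->
  (forall t, 0 <= a + 2 * t * b + t ^+ 2 * c) -> b ^+ 2 <= a * c.
Proof.
move=> a0 c0 H; have [c00|cn0] := eqVneq c 0.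
  rewrite c00 mulr0; have [->|b0] := eqVneq b 0; first by rewrite expr0n.
  (* With [c = 0] and [b] nonzero, this [t] makes the expression equal to -1. *)
  have := H (- (a + 1) / (2 * b)); rewrite c00.
  have -> : 2 * (- (a + 1) / (2 * b)) * b = - (a + 1) by field.
  by lra.
have := H (- b / c).
have -> : a + 2 * (- b / c) * b + (- b / c) ^+ 2 * c = (a * c - b ^+ 2) / c.
  by field.
by rewrite pmulr_lge0 ?subr_ge0// invr_gt0 lt_def cn0.
Qed.

End PowerTrick.

Section CstarBasics.
Context {R : realType} {A : cstarAlgebra R}.
Implicit Types x y : A.

Lemma cmul0l x : cmul 0 x = 0.
Proof. by have := cmulZl 0 0 x; rewrite !scale0r. Qed.

Lemma cmul0r x : cmul x 0 = 0.
Proof. by have := cmulZr 0 x 0; rewrite !scale0r. Qed.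

Lemma cmulNl x y : cmul (- x) y = - cmul x y.
Proof. by rewrite -scaleN1r cmulZl scaleN1r. Qed.

Lemma cmulNr x y : cmul x (- y) = - cmul x y.
Proof. by rewrite -[in LHS]scaleN1r cmulZr scaleN1r. Qed.

Lemma cmulBl x y z : cmul (x - y) z = cmul x z - cmul y z.
Proof. by rewrite cmulDl cmulNl. Qed.

Lemma cmulBr x y z : cmul x (y - z) = cmul x y - cmul x z.
Proof. by rewrite cmulDr cmulNr. Qed.

Lemma cstar_norm x : `|cstar x| = `|x|.
Proof.
have h y : `|y| <= `|cstar y|.
  have [->|y0] := eqVneq y 0; first by rewrite normr0.
  rewrite -(@ler_pM2r _ `|y|) ?normr_gt0// -expr2 -cstar_identity.
  exact: cmul_norm_le.
by apply/eqP; rewrite eq_le h andbT -{2}(cstarK x) h.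
Qed.

Lemma cmul_sumr (J : Type) (s : seq J) (F : J -> A) x :
  cmul x (\sum_(j <- s) F j) = \sum_(j <- s) cmul x (F j).
Proof.
by elim: s => [|j s IH]; rewrite ?big_nil ?cmul0r// !big_cons cmulDr IH.
Qed.

Lemma cmul_suml (J : Type) (s : seq J) (F : J -> A) x :
  cmul (\sum_(j <- s) F j) x = \sum_(j <- s) cmul (F j) x.
Proof.
by elim: s => [|j s IH]; rewrite ?big_nil ?cmul0l// !big_cons cmulDl IH.
Qed.

Lemma cstar0 : cstar (0 : A) = 0.
Proof. by have := cstarZ 0 (0 : A); rewrite !scale0r conjC0 scale0r. Qed.

Lemma cstar_sum (J : Type) (s : seq J) (F : J -> A) :
  cstar (\sum_(j <- s) F j) = \sum_(j <- s) cstar (F j).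
Proof.
by elim: s => [|j s IH]; rewrite ?big_nil ?cstar0// !big_cons cstarD IH.
Qed.

End CstarBasics.

Section GroupoidNorm.
Context {R : realType} {X : topologicalType} (T : sgds X).
Hypothesis hX : hausdorff_space X.
Hypothesis lX : locally_compact [set: X].
Local Notation G := (arrow T).
Local Notation C := R[i].
Local Notation Cf := (G -> R[i]^o).
Context {A : cstarAlgebra R} {iota : Cf -> A}.
Hypothesis iotaP : is_groupoid_cstar iota.
Implicit Types (f g h : Cf) (phi psi : X -> R[i]^o) (M : R).
Local Notation Cc := (Cc R T).
Local Notation liftT phi := (@lift R X T phi).

Lemma rep_linear (H : hilbertSpace R) (pi : Cf -> H -> H) f :
  star_representation pi -> Cc f -> linear (pi f).
Proof. by move=> piP ff; have [] := rep_bounded piP ff. Qed.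

Lemma rep_norm_le (H : hilbertSpace R) (pi : Cf -> H -> H) f v :
  star_representation pi -> Cc f -> `|pi f v| <= `|iota f| * `|v|.
Proof.
move=> piP ff; have lin := rep_linear piP ff.
have piZ := scalable_linear lin.
have pi0 : pi f 0 = 0 by have := piZ 0 0; rewrite /= !scale0r.
have [->|v0] := eqVneq v 0; first by rewrite pi0 !normr0 mulr0.
have nv : 0 < `|v| by rewrite normr_gt0.
pose w := `|v|^-1 *: v.
have w1 : `|w| <= 1 by rewrite normfZV.
have : ((Re `|pi f w|)%:E <= (Re `|iota f|)%:E)%E.
  rewrite (iota_norm iotaP ff).
  apply: (@le_trans _ _ (operator_norm (pi f))).
    by apply: ereal_sup_ubound; exists w.
  by apply: ereal_sup_ubound; exists H, pi.
rewrite lee_fin -lecR !Re_normc /w piZ normrZ normfV normr_id.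
by rewrite mulrC ler_pdivrMr.
Qed.

Lemma iota_norm_le f (M : C) : Cc f -> 0 <= M ->
  (forall (H : hilbertSpace R) (pi : Cf -> H -> H),
    star_representation pi -> forall v, `|pi f v| <= M * `|v|) ->
  `|iota f| <= M.
Proof.
move=> ff M0 HM; rewrite -(RRe_real (ger0_real M0)) -Re_normc lecR -lee_fin.
rewrite (iota_norm iotaP ff); apply: ge_ereal_sup => _ [H [pi [piP ->]]].
apply: ge_ereal_sup => _ [v /= v1 <-]; rewrite lee_fin -lecR Re_normc.
rewrite (RRe_real (ger0_real M0)) (le_trans (HM _ _ piP v))//.
by rewrite -[leRHS]mulr1 ler_wpM2l.
Qed.

(** [f c] is a matrix coefficient of the regular representation between two point masses. *)
Lemma coef_le_norm f c : Cc f -> `|f c| <= `|iota f|.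
Proof.
move=> ff; rewrite -(regrep_delta hX lX c ff).
apply: le_trans (l2_coord_le _ _) _.
set d := l2_delta _.
have h : `|regrep f d| <= `|iota f| * `|d|.
  have h := rep_norm_le (d : l2_hilbert R G) (regrep_star_representation T hX lX) ff.
  exact h.
by rewrite (le_trans h)// -[leRHS]mulr1 ler_wpM2l//; exact: l2_delta_norm.
Qed.

Let sub_funE f g : (fun a => f a - g a) = f \+ (fun a => -1 * g a).
Proof. by apply/funext => a /=; rewrite mulN1r. Qed.

Lemma CcB f g : Cc f -> Cc g -> Cc (fun a => f a - g a).
Proof. by move=> ff gg; rewrite sub_funE; apply: CcD => //; exact: CcZ. Qed.

Lemma iotaB f g : Cc f -> Cc g ->
  iota (fun a => f a - g a) = iota f - iota g.
Proof.
move=> ff gg; rewrite sub_funE (iotaD iotaP)//; last exact: CcZ.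
by rewrite (iotaZ iotaP)// scaleN1r.
Qed.

(** Allows identities between convolutions to be verified in [A], where associativity and the rules
    of the involution are axioms. *)
Lemma iota_inj f g : Cc f -> Cc g -> iota f = iota g -> f = g.
Proof.
move=> ff gg fg; apply/funext => c; apply/eqP; rewrite -subr_eq0 -normr_le0.
have := coef_le_norm c (CcB ff gg).
by rewrite iotaB// fg subrr normr0.
Qed.

Lemma iota_sum (J : Type) (s : seq J) (F : J -> Cf) :
  (forall j, Cc (F j)) ->
  iota (fun c => \sum_(j <- s) F j c) = \sum_(j <- s) iota (F j).
Proof.
move=> FF; elim: s => [|j s IH].
  rewrite big_nil; have := iotaZ iotaP 0 (Cc0 T (R := R)).
  rewrite scale0r => <-; congr iota; apply/funext => c.
  by rewrite big_nil mul0r.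
rewrite big_cons -IH -(iotaD iotaP)//; last exact: Cc_sum.
by congr iota; apply/funext => c; rewrite big_cons.
Qed.

Lemma iota_conv_star f : Cc f ->
  iota (convolution (involution f) f) = cmul (cstar (iota f)) (iota f).
Proof.
move=> ff; rewrite (iotaM iotaP)//; last exact: Cc_involution.
by rewrite (iota_star iotaP).
Qed.

Lemma rep_norm_sq (H : hilbertSpace R) (pi : Cf -> H -> H) f v :
  star_representation pi -> Cc f ->
  `|pi f v| ^+ 2 = inner H (pi (convolution (involution f) f) v) v.
Proof.
move=> piP ff; have iff := Cc_involution hX ff.
rewrite -inner_norm (repM piP)//.
by rewrite (rep_star piP iff) involutionK.
Qed.

Lemma CcX_sub phi psi : CcX phi -> csupp psi `<=` csupp phi ->
  (forall x, csupp phi x -> {for x, continuous psi}) -> CcX psi.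
Proof.
move=> [cf kf] gf cg; split.
  by apply: continuous_csupp => a /gf /cg.
by apply: subclosed_compact kf gf; exact: closed_closure.
Qed.

(** The sum of squares of a partition of unity with all supports in [U]. *)
Lemma CcX_urysohn (K U : set X) : compact K -> open U -> K `<=` U ->
  exists k : X -> R, [/\ CcX (fun x => (k x)%:C),
    forall x, 0 <= k x <= 1, forall x, K x -> k x = 1 & csupp k `<=` U].
Proof.
move=> kK oU KU.
have [|s [chi [chiP sum1 sum_le]]] := @partition_of_unity R X hX lX K
    (fun V => V = U) kK.
  by move=> a /KU Ua; exists U.
pose chi' a x := if a \in s then chi a x else 0.
have chi'E x : \sum_(a <- s) chi a x ^+ 2 = \sum_(a <- s) chi' a x ^+ 2.
  by rewrite big_seq [RHS]big_seq; apply: eq_bigr => a sa; rewrite /chi' sa.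
have chi'P a : [/\ continuous (chi' a), compact (csupp (chi' a)) &
    csupp (chi' a) `<=` U].
  rewrite /chi'; case: (boolP (a \in s)) => sa.
    by have [? _ ? [_ [_ -> ?]]] := chiP a sa.
  have -> : csupp (fun _ : X => 0 : R) = set0.
    rewrite /csupp (_ : mkset _ = set0) ?closure0// -subset0 => x /=.
    by rewrite eqxx.
  by split=> //; [move=> x; exact: cvg_cst|exact: compact0].
pose k x := \sum_(a <- s) chi' a x ^+ 2.
pose S := \big[setU/set0]_(a <- s) csupp (chi' a).
have kS : compact S.
  by apply: bigsetU_compact => a _; have [] := chi'P a.
have cS : closed S by exact: compact_closed.
have SU : S `<=` U.
  rewrite /S; elim: (s) => [|a t IH]; first by rewrite big_nil.
  by rewrite big_cons subUset; split=> //; have [] := chi'P a.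
have k0 x : ~ S x -> k x = 0.
  move=> nS; rewrite /k big_seq big1// => a sa.
  suff -> : chi' a x = 0 by rewrite expr0n.
  apply: csupp_out => ax; apply: nS; rewrite /S.
  by rewrite (big_rem a)//=; left.
have ck : continuous k.
  apply: continuous_big => [|a _]; first exact: add_continuous.
  have [ca _ _] := chi'P a.
  by move=> x; apply: cvgM; exact: ca.
exists k; split.
- split.
    by move=> x; exact: (continuous_rcC (ck x)).
  by apply: csupp_compact kS _ => // x /k0 ->.
- move=> x; rewrite /k -chi'E sum_le andbT.
  by apply: sumr_ge0 => a _; exact: sqr_ge0.
- by move=> x Kx; rewrite /k -chi'E sum1.
- by apply: subset_trans SU; exact: csupp_sub.
Qed.

(** With $h = \sqrt{q^2 - p^2}$, the difference of the squared norms is the squared norm of the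
    image of [v] under [h], so it is nonnegative. *)
Lemma CcX_real_sq_le (H : hilbertSpace R) (pi : Cf -> H -> H)
    (p q : X -> R) v : star_representation pi ->
  CcX (fun x => (q x)%:C : R[i]^o) -> continuous p ->
  (forall x, `|p x| <= q x) ->
  `|pi (liftT (fun x => (p x)%:C)) v| <= `|pi (liftT (fun x => (q x)%:C)) v|.
Proof.
move=> piP kq cp pleq.
have cq : continuous q := continuous_real (proj1 kq).
have q0 x : 0 <= q x by exact: le_trans (pleq x).
have p0 x : (q x)%:C = 0 :> C -> p x = 0.
  move=> /(congr1 (@Re R)) /= qx0.
  by apply/eqP; rewrite -normr_le0 -qx0.
pose h x := Num.sqrt (q x ^+ 2 - p x ^+ 2).
have h2 x : h x ^+ 2 = q x ^+ 2 - p x ^+ 2.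
  by rewrite sqr_sqrtr// subr_ge0 -real_normK ?num_real// lerXn2r ?nnegrE.
have ch : continuous h.
  move=> x; apply: continuous_comp; last exact: sqrt_continuous.
  by apply: cvgB; apply: cvgM; first [exact: cq | exact: cp].
have kp : CcX (fun x => (p x)%:C : R[i]^o).
  apply: CcX_sub kq _ _ => [|x _].
    by apply: csupp_imp => x /p0 ->.
  exact: (continuous_rcC (cp x)).
have kh : CcX (fun x => (h x)%:C : R[i]^o).
  apply: CcX_sub (kq) _ _ => [|x _].
    apply: csupp_imp => x /[dup] /p0 px0 /(congr1 (@Re R)) /= qx0.
    by rewrite /h qx0 px0 expr0n subrr sqrtr0.
  exact: (continuous_rcC (ch x)).
have sq (u : X -> R) : CcX (fun x => (u x)%:C : R[i]^o) ->
    `|pi (liftT (fun x => (u x)%:C)) v| ^+ 2 =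
    inner H (pi (liftT (fun x => (u x ^+ 2)%:C)) v) v.
  move=> ku; rewrite rep_norm_sq//; last exact: (Cc_lift T hX).
  rewrite involution_lift// conv_lift//; congr (inner H (pi (liftT _) v) v).
  by apply/funext => x; rewrite rc_conj rcX expr2.
have k2 (u : X -> R) : CcX (fun x => (u x)%:C : R[i]^o) ->
    Cc (liftT (fun x => (u x ^+ 2)%:C : R[i]^o)).
  move=> ku; apply: (Cc_lift T hX); apply: CcX_sub (ku) _ _ => [|x _].
    by apply: csupp_imp => x /(congr1 (@Re R)) /= ->; rewrite expr0n.
  have c1 : {for x, continuous (fun x => (u x)%:C : R[i]^o)} := proj1 ku x.
  have E : (fun y => (u y ^+ 2)%:C : R[i]^o) = (fun y => (u y)%:C * (u y)%:C).
    by apply/funext => y; rewrite expr2; exact: rcM.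
  by rewrite E; exact: (continuous_mulC c1 c1).
rewrite -(@ler_pXn2r _ 2)// ?nnegrE// !sq//.
have -> : liftT (fun x => (q x ^+ 2)%:C : R[i]^o) =
    liftT (fun x => (p x ^+ 2)%:C : R[i]^o) \+ liftT (fun x => (h x ^+ 2)%:C : R[i]^o).
  apply/funext => c; rewrite /lift /=; case: asboolP => _; last by rewrite addr0.
  by rewrite h2 -rcD addrC subrK.
rewrite (repD piP)//; try exact: k2.
by rewrite (dotDl (inner H)) lerDl -sq// exprn_ge0.
Qed.

(** Comparing [phi] with [M] times a function [k] equal to 1 on its support brings in the unknown
    norm of [k]. Iterating $\phi \mapsto \bar\phi \phi$ raises the norm and the bound to the power
    $2^n$ but leaves that of [k] unchanged, and [power_trickC] removes it. *)
Lemma iota_lift_le phi M : CcX phi -> (forall x, `|phi x| <= M%:C) ->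
  0 <= M -> `|iota (liftT phi)| <= M%:C.
Proof.
move=> kphi phiM M0; have M0' : 0 <= M%:C :> C by rewrite ler0c.
have [k [kk k01 k1 _]] := CcX_urysohn (proj2 kphi) openT (@subsetT _ _).
pose psi n : X -> R[i]^o := iter n (fun u x => (u x : C)^* * u x) phi.
have kpsi n : CcX (psi n) /\ csupp (psi n) `<=` csupp phi.
  elim: n => [|n [kn sn]]; first by split.
  have sub : csupp (psi n.+1) `<=` csupp (psi n).
    by apply: csupp_imp => x /= ->; rewrite mulr0.
  split; last exact: subset_trans sn.
  apply: CcX_sub (kn) sub _ => x _.
  have c1 : {for x, continuous (psi n)} := proj1 kn x.
  have c2 : {for x, continuous (fun y => (psi n y : C)^* : C^o)}.
    exact: (continuous_conjC c1).
  exact: (continuous_mulC c2 c1).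
have psiM n x : `|psi n x| <= M%:C ^+ (2 ^ n).
  elim: n => [|n IH]; first by rewrite expn0 expr1.
  rewrite /psi iterS -/(psi n) normrM norm_conjC expnS mulnC exprM expr2.
  by apply: ler_pM.
have norm_psi n : `|iota (liftT (psi n))| = `|iota (liftT phi)| ^+ (2 ^ n).
  elim: n => [|n IH]; first by rewrite expn0 expr1.
  have -> : liftT (psi n.+1) =
      convolution (involution (liftT (psi n))) (liftT (psi n)).
    by rewrite involution_lift// conv_lift.
  rewrite iota_conv_star ?cstar_identity ?IH -?exprM ?expnS ?[(2 * _)%N]mulnC//.
  by apply: (Cc_lift T hX); exact: (proj1 (kpsi n)).
(* One squaring in advance leads to [psi n.+1], which is real valued, as [CcX_real_sq_le]
   demands. *)
rewrite -(@ler_pXn2r _ 2)// ?nnegrE//.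
apply: (@power_trickC _ _ _ `|iota (liftT (fun x => (k x)%:C))|); rewrite ?exprn_ge0// => n.
rewrite -!exprM -!expnS -norm_psi.
pose p x := Re (psi n.+1 x).
have pE : psi n.+1 = (fun x => (p x)%:C).
  apply/funext => x; rewrite /p RRe_real// /psi iterS -/(psi n) mulrC.
  exact/ger0_real/mul_conjC_ge0.
pose q x := M ^+ (2 ^ n.+1) * k x.
have kq : CcX (fun x => (q x)%:C : R[i]^o).
  apply: CcX_sub (kk) _ _ => [|x _].
    by apply: csupp_imp => x; rewrite /q rcM => ->; rewrite mulr0.
  have E : (fun y => (q y)%:C : R[i]^o) =
      (fun y => (M ^+ (2 ^ n.+1))%:C * (k y)%:C).
    by apply/funext => y; exact: rcM.
  rewrite E.
  exact: (continuous_mulC (@continuous_cstC R X ((M ^+ (2 ^ n.+1))%:C) x)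
    (proj1 kk x)).
have cp : continuous p := continuous_ReC (proj1 (proj1 (kpsi n.+1))).
have pq x : `|p x| <= q x.
  rewrite /q; have [px|npx] := pselect (csupp phi x).
    rewrite k1// mulr1 -lecR -rc_norm rcX.
    by have := psiM n.+1 x; rewrite pE.
  have -> : p x = 0.
    by rewrite /p (@csupp_out _ _ (psi n.+1) x)// => /(proj2 (kpsi n.+1)).
  by rewrite normr0 mulr_ge0 ?exprn_ge0//; have /andP[] := k01 x.
apply: iota_norm_le.
- by apply: (Cc_lift T hX); exact: (proj1 (kpsi n.+1)).
- by rewrite mulr_ge0 ?exprn_ge0.
- move=> H pi piP v; rewrite pE (le_trans (CcX_real_sq_le v piP kq cp pq))//.
  have -> : liftT (fun x => (q x)%:C) =
      (fun c => M%:C ^+ (2 ^ n.+1) * liftT (fun x => (k x)%:C) c).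
    apply/funext => c; rewrite /lift; case: asboolP => _; last by rewrite mulr0.
    by rewrite /q rcM rcX.
  have kk' : Cc (liftT (fun x => (k x)%:C)) by exact: (Cc_lift T hX).
  rewrite (repZ piP)// normrZ (ger0_norm (exprn_ge0 _ M0')) -mulrA.
  by rewrite ler_wpM2l ?exprn_ge0// rep_norm_le.
Qed.

(** For a support in a bisection $f^* f$ lives on the units, and the C*-identity reduces the claim
    to [iota_lift_le]. *)
Lemma iota_bis_le f M : Cc f -> bis_supp f -> (forall c, `|f c| <= M%:C) ->
  0 <= M -> `|iota f| <= M%:C.
Proof.
move=> ff bf fM M0; have M0' : 0 <= M%:C :> C by rewrite ler0c.
have fi := bis_supp_range_inj bf; have fs := bis_supp_source_inj bf.
have iff := Cc_involution hX ff.
have kff : Cc (convolution (involution f) f) by exact: Cc_conv.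
rewrite -(@ler_pXn2r _ 2)// ?nnegrE// -cstar_identity -iota_conv_star//.
have ffE : convolution (involution f) f =
    liftT (fun x => convolution (involution f) f (aunit T x)).
  apply/funext => c; have [Uc|nUc] := pselect (units c).
    by rewrite {2}Uc lift1 -Uc.
  rewrite lift0//; apply: contrapT => /conv_support[a [ac ifa fb]].
  have fa : f (arrow_inv a) <> 0.
    by move=> e; apply: ifa; rewrite /involution e conjC0.
  have := fi _ _ fa fb; rewrite amul_range// => /(_ erefl) e.
  apply: nUc; rewrite -(amulVKl ac) -e amulVr ac.
  by rewrite /units/=.
rewrite ffE -rcX; apply: iota_lift_le; last exact: exprn_ge0.
  exact: CcX_restrict.
move=> x; have [[a [ax ifa]]|na] :=
    pselect (exists a, range_of a = x /\ involution f a <> 0); last first.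
  rewrite conv_range0 ?normr0 ?rcX ?exprn_ge0// => a ax.
  by apply: contrapT => ifa; apply: na; exists a.
rewrite (conv_range_inj _ (involution_range_inj fs) ifa)// normrM rcX expr2.
by apply: ler_pM => //; rewrite /involution norm_conjC.
Qed.

(** Norm control by suprema on a fixed compact support: [K] is the number of bisections covering the
    support times the supremum of [f], and does not depend on [g]. *)
Lemma iota_dominated f : Cc f -> exists2 K : R, 0 <= K &
  forall g M, 0 <= M -> Cc g -> (forall c, `|g c| <= M%:C * `|f c|) ->
    `|iota g| <= (K * M)%:C.
Proof.
move=> ff; have [s [th [Cth bth th1 sum1]]] := Cc_bis_partition hX lX ff.
have [B B0 fB] := Cc_bounded ff.
exists ((size s)%:R * B); first by rewrite mulr_ge0.
move=> g M M0 gg gM.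
have -> : g = (fun c => \sum_(a <- s) th a c * g c).
  apply/funext => c; rewrite -mulr_suml.
  have [fc|nfc] := pselect (csupp f c); first by rewrite sum1// mul1r.
  suff -> : g c = 0 by rewrite mulr0.
  apply/eqP; rewrite -normr_le0; have := gM c.
  by rewrite (csupp_out nfc) normr0 mulr0.
have CTh a : Cc (fun c => th a c * g c).
  by apply: CcM => // c _; exact: (proj1 gg).
rewrite iota_sum//; apply: le_trans (ler_norm_sum _ _ _) _.
apply: (@le_trans _ _ (\sum_(a <- s) (B * M)%:C)).
  apply: ler_sum => a _; apply: iota_bis_le => //.
  - by apply: bis_supp_sub (bth a) _ => c ->; rewrite mul0r.
  - move=> c; rewrite normrM -[leRHS]mul1r; apply: ler_pM => //.
    rewrite (le_trans (gM c))// mulrC rcM; apply: ler_pM => //.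
    by rewrite ler0c.
  - by rewrite mulr_ge0.
by rewrite -rc_sum lecR big_const_seq count_predT iter_addr_0 -mulrA mulr_natl.
Qed.

End GroupoidNorm.

(** * Multipliers of positive type *)

Section NumericalRadius.
Context {R : realType} (H : hilbertSpace R).
Local Notation C := R[i].
Local Notation "<< u , v >>" := (inner H u v).

Lemma inner_le (u v : H) : `|<<u, v>>| <= `|u| * `|v|.
Proof.
rewrite -(@ler_pXn2r _ 2)// ?nnegrE ?mulr_ge0//.
by rewrite exprMn -!inner_norm Cauchy_Schwarz.
Qed.

Lemma polarization (S : H -> H) (u v : H) : linear S ->
  4 * <<S u, v>> = <<S (u + v), u + v>> - <<S (u - v), u - v>>
    + 'i * <<S (u + 'i *: v), u + 'i *: v>>
    - 'i * <<S (u - 'i *: v), u - 'i *: v>>.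
Proof.
move=> linS.
have SZ := scalable_linear linS.
have SD x y : S (x + y) = S x + S y by rewrite -[x]scale1r linS !scale1r.
have E k : <<S (u + k *: v), u + k *: v>> =
    <<S u, u>> + k^* * <<S u, v>> + (k * <<S v, u>> + k * (k^* * <<S v, v>>)).
  rewrite SD SZ (dotDl (inner H)) (dotZl (inner H)) !(dotDr (inner H)).
  by rewrite !(dotZr (inner H)) mulrDr.
have e1 : u + v = u + 1 *: v by rewrite scale1r.
have e2 : u - v = u + (- 1) *: v by rewrite scaleN1r.
have e3 : u - 'i *: v = u + (- 'i) *: v by rewrite scaleNr.
rewrite e1 e2 e3 !E !rmorphN/= conjCi rmorph1 opprK.
have i2 : 'i * 'i = -1 :> C by rewrite -expr2 sqrCi.
set a := <<S u, u>>; set b := <<S u, v>>; set c := <<S v, u>>.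
set d := <<S v, v>>.
have -> : 4 * b = 2 * b - 2 * ('i * 'i) * b + 2 * c + 2 * ('i * 'i) * c.
  by rewrite i2; ring.
ring.
Qed.

(** Take [w] parallel to [S v] with the norm of [v]. The four terms of the polarization identity are
    each at most $r (2|v|)^2$, so $4 |v| |S v| \le 16 r |v|^2$. *)
Lemma numerical_radius (S : H -> H) (r : C) : linear S -> 0 <= r ->
  (forall v, `|<<S v, v>>| <= r * `|v| ^+ 2) ->
  forall v, `|S v| <= 4 * r * `|v|.
Proof.
move=> linS r0 Sr v.
have [->|Sv0] := eqVneq (S v) 0; first by rewrite normr0 !mulr_ge0.
have [v0|v0] := eqVneq v 0.
  move: Sv0; rewrite v0; have := scalable_linear linS 0 0.
  by rewrite /= !scale0r => ->; rewrite eqxx.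
have nv : 0 < `|v| by rewrite normr_gt0.
have nSv : 0 < `|S v| by rewrite normr_gt0.
pose w := (`|v| / `|S v|) *: S v.
have nw : `|w| = `|v|.
  by rewrite normrZ normf_div !normr_id divfK// gt_eqF.
have Svw : <<S v, w>> = `|v| * `|S v|.
  rewrite (dotZr (inner H)) inner_norm conj_Creal ?rpred_div ?normr_real//.
  by rewrite expr2 mulrA divfK// gt_eqF.
have b (k : C) : `|k| = 1 ->
    `|<<S (v + k *: w), v + k *: w>>| <= r * (2 * `|v|) ^+ 2.
  move=> k1; apply: le_trans (Sr _) _; rewrite ler_wpM2l// lerXn2r ?nnegrE ?mulr_ge0//.
  rewrite (le_trans (ler_normD _ _))// normrZ k1 mul1r nw.
  by rewrite mulr_natl mulr2n.
have nI : `|'i| = 1 :> C by exact: normCi.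
have : `|4 * <<S v, w>>| <= 4 * (r * (2 * `|v|) ^+ 2).
  rewrite (polarization v w linS).
  have -> : 4 * (r * (2 * `|v|) ^+ 2) = r * (2 * `|v|) ^+ 2 +
    r * (2 * `|v|) ^+ 2 + r * (2 * `|v|) ^+ 2 + r * (2 * `|v|) ^+ 2 by ring.
  rewrite !(le_trans (ler_normD _ _) (lerD _ _))// ?normrN ?normrM ?nI ?mul1r.
  + by have := b 1 (normr1 _); rewrite scale1r.
  + by have := b (-1); rewrite normrN normr1 scaleN1r => /(_ erefl).
  + exact: b.
  + by have := b (- 'i); rewrite normrN nI scaleNr => /(_ erefl).
rewrite Svw normrM (ger0_norm (_ : 0 <= 4))// ger0_norm ?mulr_ge0//.
rewrite ler_pM2l// exprMn mulrA expr2 [X in _ <= X]mulrA [X in _ <= X]mulrC.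
rewrite ler_pM2l// => b4; rewrite (le_trans b4)// le_eqVlt; apply/orP; left.
by apply/eqP; ring.
Qed.

End NumericalRadius.

(** * Functions of positive type as multipliers *)

Section Multipliers.
Context {R : realType} {X : topologicalType} (T : sgds X).
Hypothesis hX : hausdorff_space X.
Hypothesis lX : locally_compact [set: X].
Local Notation G := (arrow T).
Local Notation C := R[i].
Local Notation Cf := (G -> R[i]^o).
Context {A : cstarAlgebra R} {iota : Cf -> A}.
Hypothesis iotaP : is_groupoid_cstar iota.
Implicit Types (f g h p q s t : Cf) (phi psi : X -> R[i]^o) (M : R).
Local Notation Cc := (Cc R T).
Local Notation liftT phi := (@lift R X T phi).

Lemma iota_condE_le f : Cc f -> `|iota (condE f)| <= `|iota f|.
Proof.
move=> ff; rewrite -(Re_normc (iota f)); apply: iota_lift_le => //.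
- exact: CcX_restrict.
- by move=> x; rewrite Re_normc; exact: coef_le_norm.
- by rewrite -ler0c Re_normc.
Qed.

(** In the term of index [a], two arrows with a common range in the support of [chi a] coincide, so
    nothing is left off the units, while [sum1] restores the value at units. This expression of the
    expectation as a sum of products takes the place of its complete positivity. *)
Lemma condE_star_mul (K : set G) (r : seq G) (chi : G -> G -> R) p q :
  (forall a, bis_supp (fun c => (chi a c)%:C : R[i]^o)) ->
  (forall c, K c -> \sum_(a <- r) chi a c ^+ 2 = 1) ->
  Cc p -> Cc q -> csupp p `<=` K ->
  condE (convolution (involution p) q) = fun c => \sum_(a <- r)
    convolution (involution (fun d => (chi a d)%:C * p d))
      (fun d => (chi a d)%:C * q d) c.
Proof.
move=> bchi sum1 pp qq pK; apply/funext => c.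
have [Uc|nUc] := pselect (units c); last first.
  rewrite /condE lift0// big1// => a _; apply: contrapT.
  move=> /conv_support[b [bc h1 h2]]; apply: nUc.
  have n1 : (chi a (arrow_inv b))%:C <> 0 :> C.
    by move=> e; apply: h1; rewrite /involution e mul0r conjC0.
  have n2 : (chi a (amul (arrow_inv b) c))%:C <> 0 :> C.
    by move=> e; apply: h2; rewrite e mul0r.
  have := bis_supp_range_inj (bchi a) n1 n2.
  rewrite amul_range// => /(_ erefl) e.
  by rewrite -(amulVKl bc) -e amulVr bc /units/=.
rewrite Uc /condE lift1; set u := aunit T _.
pose W := [set a : G | range_of a = range_of u /\ involution p a <> 0].
have fW : finite_set W.
  by apply: Cc_row_finite => //; exact: Cc_involution.
have Wr a : W a -> range_of a = range_of u by case.
rewrite (conv_finite _ fW)//.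
have E a : convolution (involution (fun d => (chi a d)%:C * p d))
      (fun d => (chi a d)%:C * q d) u =
    \sum_(b \in W) (chi a (arrow_inv b) ^+ 2)%:C *
      (involution p b * q (amul (arrow_inv b) u)).
  rewrite (conv_finite _ fW)//; last first.
    move=> b bu h; split=> // e; apply: h.
    by rewrite /involution rmorphM/= -/(involution p b) e mulr0.
  apply: eq_fsbigr => b; rewrite inE => -[bu _].
  rewrite {1}/involution rmorphM/= -/(involution p b) rc_conj rcX.
  have -> : amul (arrow_inv b) u = arrow_inv b.
    by rewrite -[RHS]amul1r/= bu.
  by ring.
under [RHS]eq_bigr do rewrite E fsbig_finite//.
rewrite exchange_big fsbig_finite//=.
rewrite big_seq [RHS]big_seq; apply: eq_bigr => b.
rewrite in_fset_set// inE => -[bu pb].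
rewrite -mulr_suml -rc_sum sum1 ?mul1r//.
apply/pK/subset_closure; apply/eqP => e; apply: pb.
by rewrite /involution e conjC0.
Qed.

Definition corner s t f : Cf :=
  convolution s (convolution
    (condE (convolution (involution s) (convolution f t))) (involution t)).

Lemma Cc_corner s t f : Cc s -> Cc t -> Cc f -> Cc (corner s t f).
Proof.
move=> ss tt ff; apply: Cc_conv => //; apply: Cc_conv => //; last first.
  exact: Cc_involution.
apply: Cc_condE => //; apply: Cc_conv => //; first exact: Cc_involution.
exact: Cc_conv.
Qed.

(** Every convolution has a single term. For [a] in the support of [s] over the range of [c], the
    expectation is evaluated at the source of [a], and undoing the two translations leads back to
    [f c]: the operation is a pointwise multiplication. *)
Lemma cornerE s t f c : Cc f -> bis_supp s -> bis_supp t ->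
  corner s t f c = f c *
    convolution (fun a => s a * (s a : C)^*)
      (involution (fun a => t a * (t a : C)^*)) c.
Proof.
move=> ff bs bt; have fi := bis_supp_range_inj bs.
have fs := bis_supp_source_inj bs; have ts := bis_supp_source_inj bt.
have [[a [ac sa]]|na] :=
    pselect (exists a, range_of a = range_of c /\ s a <> 0); last first.
  have s0 a : range_of a = range_of c -> s a = 0.
    by move=> ac; apply: contrapT => sa; apply: na; exists a.
  rewrite /corner conv_range0// conv_range0 ?mulr0// => a ac.
  by rewrite s0// mul0r.
rewrite /corner (conv_range_inj _ fi sa ac); set d := amul (arrow_inv a) c.
have rd : range_of d = source_of a by rewrite amul_range.
have ri : range_inj (fun b => s b * (s b : C)^* : C^o).
  by move=> b b' sb sb'; apply: fi => e; [apply: sb|apply: sb']; rewrite e mul0r.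
have ssa : s a * (s a : C)^* <> 0.
  by apply/eqP; rewrite mulf_neq0// ?conjC_eq0; exact/eqP.
rewrite (conv_range_inj _ ri ssa ac) -/d /condE conv_liftl rd.
have ifi := involution_range_inj fs.
have isa : involution s (arrow_inv a) <> 0.
  by rewrite /involution arrow_invK; apply/eqP; rewrite conjC_eq0; exact/eqP.
rewrite (conv_range_inj _ ifi isa)// arrow_invK amul1r.
rewrite /involution arrow_invK.
have [tb|/eqP tb] := eqVneq (t (arrow_inv d)) 0.
  by rewrite tb conjC0 !mulr0 conjC0 !mulr0.
rewrite (conv_source_inj _ ts tb); last by rewrite /= rd.
rewrite arrow_invK amulVKl// rmorphM/= conjCK.
by ring.
Qed.

(* A bound on the functionals [f |-> <pi(h f) v, v>], obtained by iterating the
   Cauchy-Schwarz inequality, in which the crude bound [K] disappears. *)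
Section Contraction.
Variable h : Cf.
Hypothesis Ch : forall f, Cc f -> Cc (fun c => h c * f c).
Hypothesis h_unit : forall x, `|h (aunit T x)| <= 1.
Variable K : C.
Hypothesis K0 : 0 <= K.
Hypothesis h_crude : forall f, Cc f ->
  `|iota (fun c => h c * f c)| <= K * `|iota f|.
Hypothesis h_pos : forall (H : hilbertSpace R) (pi : Cf -> H -> H) g v,
  star_representation pi -> Cc g ->
  0 <= inner H (pi (fun c => h c * convolution (involution g) g c) v) v.

(** Cauchy-Schwarz for the positive functional [Phi], tested on [f] and on a function [k] that acts
    as a unit on [f]. The value of [Phi] at $k^2$ is at most $|v|^2$ because [h] is bounded by 1 on
    units. *)
Lemma multiplier_functional_sq (H : hilbertSpace R) (pi : Cf -> H -> H) f v :
  star_representation pi -> Cc f -> involution f = f ->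
  `|inner H (pi (fun c => h c * f c) v) v| ^+ 2 <= `|v| ^+ 2 *
  `|inner H (pi (fun c => h c * convolution f f c) v) v|.
Proof.
move=> piP ff fsa.
have kr := compact_range (proj2 ff).
have [k [kk k01 k1 _]] := CcX_urysohn (R := R) hX lX kr openT (@subsetT _ _).
pose kC x : R[i]^o := (k x)%:C.
have kL : Cc (liftT kC) by exact: (Cc_lift T hX).
have kC1 c : csupp f c -> kC (range_of c) = 1.
  by move=> fc; rewrite /kC k1//; exists c.
have kf : convolution (liftT kC) f = f.
  rewrite conv_liftl; apply/funext => c.
  have [fc|nfc] := pselect (csupp f c); first by rewrite kC1// mul1r.
  by rewrite (csupp_out nfc) mulr0.
have kinv : involution (liftT kC) = liftT kC.
  by rewrite involution_lift; congr (liftT _); apply/funext => x; exact: rc_conj.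
have fk : convolution f (liftT kC) = f.
  apply: (iota_inj hX lX iotaP); [exact: Cc_conv|exact: ff|].
  rewrite (iotaM iotaP)// -[in RHS]fsa (iota_star iotaP)// -[in RHS]kf.
  by rewrite (iotaM iotaP)// cstarM -!(iota_star iotaP)// fsa kinv.
pose Phi g := inner H (pi (fun c => h c * g c) v) v.
have PhiD g g' : Cc g -> Cc g' -> Phi (g \+ g') = Phi g + Phi g'.
  move=> Cg Cg'; rewrite /Phi -(dotDl (inner H)) -(repD piP); [|exact: Ch..].
  congr (inner H (pi _ v) v); apply/funext => c; exact: mulrDr.
have PhiZ (t : C) g : Cc g -> Phi (fun c => t * g c) = t * Phi g.
  move=> Cg; rewrite /Phi -(dotZl (inner H)) -(repZ piP); last exact: Ch.
  congr (inner H (pi _ v) v); apply/funext => c; exact: mulrCA.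
pose a := Phi (convolution (liftT kC) (liftT kC)).
pose b := Phi f; pose c := Phi (convolution f f).
have a0 : 0 <= a by rewrite /a -{1}kinv; exact: h_pos.
have c0 : 0 <= c by rewrite /c -{1}fsa; exact: h_pos.
have Ckk : Cc (convolution (liftT kC) (liftT kC)) by exact: Cc_conv.
have Cff : Cc (convolution f f) by exact: Cc_conv.
have quad (t : R) : 0 <= a + t%:C * b + t%:C * b + t%:C ^+ 2 * c.
  have Ctf : Cc (fun x => t%:C * f x) by exact: CcZ.
  have := h_pos v piP (CcD kL Ctf).
  have -> : involution (liftT kC \+ (fun x => t%:C * f x)) =
      liftT kC \+ (fun x => t%:C * f x).
    apply/funext => x; rewrite -[in RHS]kinv -[in RHS]fsa /involution /=.
    by rewrite rmorphD rmorphM/= rc_conj.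
  have -> : convolution (liftT kC \+ (fun x => t%:C * f x))
      (liftT kC \+ (fun x => t%:C * f x)) =
      (convolution (liftT kC) (liftT kC) \+ (fun x => t%:C * f x)) \+
      ((fun x => t%:C * f x) \+ (fun x => t%:C ^+ 2 * convolution f f x)).
    have rL : row_finite (liftT kC) by exact: Cc_row_finite.
    have rf : row_finite (fun x => t%:C * f x) by exact: Cc_row_finite.
    rewrite conv_addl// !conv_addr// !conv_scaler !conv_scalel kf fk.
    by congr (_ \+ (_ \+ _)); apply/funext => x; rewrite expr2 mulrA.
  have C3 : Cc (fun x => t%:C ^+ 2 * convolution f f x) by exact: CcZ.
  rewrite -/(Phi _) (PhiD _ _ (CcD Ckk Ctf) (CcD Ctf C3)).
  by rewrite (PhiD _ _ Ckk Ctf) (PhiD _ _ Ctf C3) (PhiZ _ _ ff) (PhiZ _ _ Cff) addrA.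
have aV : a <= `|v| ^+ 2.
  rewrite -(ger0_norm a0) /a /Phi; apply: le_trans (inner_le _ _) _.
  rewrite expr2 ler_wpM2r//; apply: le_trans (rep_norm_le iotaP _ piP _) _.
    exact: Ch.
  rewrite -[leRHS]mul1r ler_wpM2r// conv_lift.
  have -> : (fun d => h d * liftT (fun x => kC x * kC x) d) =
      liftT (fun x => h (aunit T x) * (kC x * kC x)).
    apply/funext => d; rewrite /lift; case: asboolP => [Ud|_].
      by rewrite {1}Ud.
    by rewrite mulr0.
  apply: (@iota_lift_le _ _ _ hX lX _ _ iotaP _ 1) => // [|x].
    have := CcX_restrict hX (Ch Ckk); rewrite conv_lift.
    by congr CcX; apply/funext => x; rewrite lift1.
  have /andP[kx0 kx1] := k01 x.
  rewrite normrM mulr_ile1// -rcM rc_norm lecR ger0_norm ?mulr_ge0//.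
  by rewrite mulr_ile1.
(* The quadratic expression at [t = 1] and its outer coefficients are nonnegative, hence real, so
   the middle one is real too. *)
have breal : Im b = 0.
  have := quad 1; rewrite mul1r expr1n mul1r => q1.
  have : Im (a + b + b + c) = 0 by apply/Im_real/ger0_real.
  rewrite !raddfD/= (Im_real (ger0_real a0)) (Im_real (ger0_real c0)).
  by lra.
rewrite -/(Phi f) -/b -/(Phi _) -/c (ger0_norm c0).
have bE : b = (Re b)%:C by rewrite RRe_real// [b]complexE breal mulr0 addr0 complex_real.
have aE : a = (Re a)%:C by rewrite RRe_real// ger0_real.
have cE : c = (Re c)%:C by rewrite RRe_real// ger0_real.
have quadR (t : R) : 0 <= Re a + 2 * t * Re b + t ^+ 2 * Re c.
  rewrite -ler0c; have := quad t; rewrite bE {1}aE {1}cE -!rcM -rcX -!rcM -!rcD.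
  by congr (_ <= _%:C); ring.
apply: (@le_trans _ _ (a * c)); last by rewrite ler_wpM2r.
rewrite bE aE cE rc_norm -rcX -rcM lecR real_normK ?num_real//.
have a0' : 0 <= Re a by rewrite -ler0c -aE.
have c0' : 0 <= Re c by rewrite -ler0c -cE.
exact: quadratic_discriminant.
Qed.

Lemma multiplier_functional_le (H : hilbertSpace R) (pi : Cf -> H -> H) f v :
  star_representation pi -> Cc f -> involution f = f ->
  `|inner H (pi (fun c => h c * f c) v) v| <= `|v| ^+ 2 * `|iota f|.
Proof.
move=> piP; pose Phi g : C := `|inner H (pi (fun c => h c * g c) v) v|.
have P0 g : 0 <= Phi g by exact: normr_ge0.
(* All self-adjoint [g] are treated together, since the induction step passes from [g] to its
   convolution square, whose norm is the square of the norm of [g]. *)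
have crude n : forall g, Cc g -> involution g = g ->
    Phi g ^+ (2 ^ n) <= (`|v| ^+ 2 * `|iota g|) ^+ (2 ^ n) * K.
  elim: n => [|n IH] g Cg gsa.
    rewrite expn0 !expr1 /Phi; apply: le_trans (inner_le _ _) _.
    have := rep_norm_le iotaP v piP (Ch Cg) => /le_trans/(_ (ler_wpM2r _ (h_crude Cg))).
    move=> /(_ (normr_ge0 _)) h1.
    apply: (@le_trans _ _ (K * `|iota g| * `|v| * `|v|)).
      by rewrite ler_wpM2r.
    by rewrite le_eqVlt; apply/orP; left; apply/eqP; ring.
  rewrite expnS !exprM; have Cgg : Cc (convolution g g) by exact: Cc_conv.
  have ggsa : involution (convolution g g) = convolution g g.
    apply: (iota_inj hX lX iotaP) => //; first exact: Cc_involution.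
    by rewrite (iota_star iotaP)// (iotaM iotaP)// cstarM -!(iota_star iotaP)// gsa.
  have := multiplier_functional_sq v piP Cg gsa; rewrite -!/(Phi _) => h1.
  apply: (@le_trans _ _ ((`|v| ^+ 2 * Phi (convolution g g)) ^+ (2 ^ n))).
    by rewrite lerXn2r ?nnegrE// ?mulr_ge0 ?exprn_ge0.
  rewrite exprMn; have := IH _ Cgg ggsa => /(ler_wpM2l _) h2.
  apply: le_trans (h2 _ _) _; first by rewrite !exprn_ge0.
  have -> : `|iota (convolution g g)| = `|iota g| ^+ 2.
    by rewrite -{1}gsa iota_conv_star// cstar_identity.
  by rewrite mulrA -exprMn le_eqVlt; apply/orP; left; apply/eqP; congr (_ ^+ _ * _); ring.
move=> ff fsa; apply: (@power_trickC _ _ _ K) => // n; exact: crude.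
Qed.

(** [f1] and [f2] are the self-adjoint real and imaginary parts of [f], of norm at most that of [f].
    Their functional bounds add up to $2 \|f\| |v|^2$, and [numerical_radius] contributes the factor
    4. *)
Lemma multiplier_contraction f : Cc f ->
  `|iota (fun c => h c * f c)| <= 8 * `|iota f|.
Proof.
move=> ff; apply: iota_norm_le => //; first exact: Ch.
move=> H pi piP v.
pose f1 := (fun c => 2^-1 * f c) \+ (fun c => 2^-1 * involution f c).
pose f2 := (fun c => - 'i / 2 * f c) \+ (fun c => 'i / 2 * involution f c).
have Cif : Cc (involution f) by exact: Cc_involution.
have C1 : Cc f1 by apply: CcD; exact: CcZ.
have C2 : Cc f2 by apply: CcD; exact: CcZ.
have nI : `|'i| = 1 :> C by exact: normCi.
have half : `|2^-1| = 2^-1 :> C by rewrite ger0_norm.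
have bound (z w : C) : `|z| = 2^-1 -> `|w| = 2^-1 ->
    `|iota ((fun c => z * f c) \+ (fun c => w * involution f c))| <= `|iota f|.
  move=> z2 w2; rewrite (iotaD iotaP); [|exact: CcZ..].
  rewrite !(iotaZ iotaP)// (iota_star iotaP)//.
  apply: le_trans (ler_normD _ _) _; rewrite !normrZ cstar_norm z2 w2.
  by rewrite -mulrDl -[X in (X + X) * _]mul1r -splitr mul1r.
have n1 : `|iota f1| <= `|iota f| by exact: bound.
have n2 : `|iota f2| <= `|iota f|.
  by apply: bound; rewrite normrM ?normrN nI mul1r half.
have conj_half : (2^-1 : C)^* = 2^-1 by rewrite conj_Creal// ger0_real.
have s1 : involution f1 = f1.
  apply/funext => c; rewrite /involution /f1 /= /involution arrow_invK.
  by rewrite rmorphD !rmorphM/= conj_half conjCK addrC.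
have s2 : involution f2 = f2.
  apply/funext => c; rewrite /involution /f2 /= /involution arrow_invK.
  rewrite rmorphD !rmorphM/= rmorphN/= conj_half conjCi conjCK addrC opprK.
  by rewrite mulNr.
have fE : f = f1 \+ (fun c => 'i * f2 c).
  apply/funext => c; rewrite /f1 /f2 /=.
  have i2 : 'i * 'i = -1 :> C by rewrite -expr2 sqrCi.
  set x := f c; set y := involution f c.
  have -> : 2^-1 * x + 2^-1 * y + 'i * (- 'i / 2 * x + 'i / 2 * y) =
    2^-1 * x + 2^-1 * y - ('i * 'i) * (2^-1 * x) + ('i * 'i) * (2^-1 * y).
    by ring.
  by rewrite i2; field.
have -> : 8 * `|iota f| = 4 * (2 * `|iota f|) :> C by ring.
apply: numerical_radius; first exact: rep_linear piP (Ch ff).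
  by rewrite mulr_ge0.
move=> u; rewrite [X in (fun c => h c * X c)]fE.
have -> : (fun c => h c * (f1 \+ (fun c => 'i * f2 c)) c) =
    (fun c => h c * f1 c) \+ (fun c => 'i * (h c * f2 c)).
  by apply/funext => c /=; rewrite mulrDr mulrCA.
rewrite (repD piP); [|exact: Ch|by apply: CcZ; exact: Ch].
rewrite (repZ piP); last exact: Ch.
rewrite (dotDl (inner H)) (dotZl (inner H)).
apply: le_trans (ler_normD _ _) _; rewrite normrM nI mul1r.
have -> : 2 * `|iota f| * `|u| ^+ 2 =
  `|u| ^+ 2 * `|iota f| + `|u| ^+ 2 * `|iota f| by ring.
apply: lerD.
  by apply: le_trans (multiplier_functional_le _ piP C1 s1) _; rewrite ler_wpM2l ?exprn_ge0.
by apply: le_trans (multiplier_functional_le _ piP C2 s2) _; rewrite ler_wpM2l ?exprn_ge0.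
Qed.

End Contraction.

Section PositiveType.
Variables (J : eqType) (r : seq J) (s : J -> Cf).
Hypothesis Cs : forall j, Cc (s j).
Hypothesis bs : forall j, bis_supp (s j).

Definition sq_weight : Cf := fun a => \sum_(j <- r) s j a * (s j a : C)^*.

(** With [w] for [sq_weight] this is $w * w^*$, a coefficient of the regular representation. Because
    [w] is a sum of squares $|s_j|^2$, multiplication by it is a sum of [corner] operations. *)
Definition pos_type : Cf := convolution sq_weight (involution sq_weight).

Let w j : Cf := fun a => s j a * (s j a : C)^*.

Let Cw j : Cc (w j).
Proof.
apply: CcM => // a _.
exact: (continuous_conjC (proj1 (Cs j) a)).
Qed.

Let bw j : bis_supp (w j).
Proof. by apply: bis_supp_sub (bs j) _ => a; rewrite /w => ->; rewrite mul0r. Qed.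

Lemma Cc_sq_weight : Cc sq_weight.
Proof. exact: Cc_sum. Qed.

Lemma Cc_pos_type : Cc pos_type.
Proof.
apply: Cc_conv => //; first exact: Cc_sq_weight.
by apply: Cc_involution => //; exact: Cc_sq_weight.
Qed.

Lemma pos_typeE f : Cc f -> (fun c => pos_type c * f c) =
  fun c => \sum_(i <- r) \sum_(j <- r) corner (s i) (s j) f c.
Proof.
move=> ff; apply/funext => c.
have rw i : row_finite (w i) by exact: Cc_row_finite.
have -> : pos_type = fun c => \sum_(i <- r) \sum_(j <- r)
    convolution (w i) (involution (w j)) c.
  rewrite /pos_type [X in convolution X _](_ : _ =
    fun a => \sum_(j <- r) w j a)// conv_suml//.
  apply/funext => d; apply: eq_bigr => i _.
  have -> : involution sq_weight = fun a => \sum_(j <- r) involution (w j) a.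
    by apply/funext => a; rewrite /involution /sq_weight rmorph_sum.
  by rewrite conv_sumr.
rewrite mulr_suml; apply: eq_bigr => i _; rewrite mulr_suml.
by apply: eq_bigr => j _; rewrite cornerE// mulrC.
Qed.

Lemma iota_corner i j f : Cc f -> iota (corner (s i) (s j) f) =
  cmul (iota (s i)) (cmul (iota (condE
    (convolution (involution (s i)) (convolution f (s j)))))
    (cstar (iota (s j)))).
Proof.
move=> ff; have Cis k : Cc (involution (s k)) by exact: Cc_involution.
have C1 : Cc (convolution (involution (s i)) (convolution f (s j))).
  by apply: Cc_conv => //; exact: Cc_conv.
have C2 := Cc_condE hX C1.
rewrite /corner (iotaM iotaP)//; last by apply: Cc_conv.
by rewrite (iotaM iotaP)// (iota_star iotaP).
Qed.

(** A bound depending on the [s i]; it serves to start the iteration from which the constant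
    disappears. *)
Lemma pos_type_crude : exists2 K : C, 0 <= K & forall f, Cc f ->
  `|iota (fun c => pos_type c * f c)| <= K * `|iota f|.
Proof.
exists (\sum_(i <- r) \sum_(j <- r) `|iota (s i)| ^+ 2 * `|iota (s j)| ^+ 2).
  apply: sumr_ge0 => i _; apply: sumr_ge0 => j _.
  by rewrite mulr_ge0 ?exprn_ge0.
move=> f ff; rewrite pos_typeE//.
have Cc1 i j : Cc (corner (s i) (s j) f) by exact: Cc_corner.
rewrite iota_sum//; last by move=> i; exact: Cc_sum.
apply: le_trans (ler_norm_sum _ _ _) _; rewrite mulr_suml.
apply: ler_sum => i _; rewrite iota_sum//.
apply: le_trans (ler_norm_sum _ _ _) _; rewrite mulr_suml.
apply: ler_sum => j _; rewrite iota_corner//.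
have Cis : Cc (involution (s i)) by exact: Cc_involution.
have Cfs : Cc (convolution f (s j)) by exact: Cc_conv.
apply: le_trans (cmul_norm_le _ _) _.
apply: (@le_trans _ _ (`|iota (s i)| * ((`|iota (s i)| *
    (`|iota f| * `|iota (s j)|)) * `|iota (s j)|))).
  rewrite ler_wpM2l//; apply: le_trans (cmul_norm_le _ _) _.
  rewrite cstar_norm ler_wpM2r//.
  apply: le_trans (iota_condE_le _) _; first exact: Cc_conv.
  rewrite (iotaM iotaP)// (iota_star iotaP)//.
  apply: le_trans (cmul_norm_le _ _) _; rewrite cstar_norm ler_wpM2l//.
  by rewrite (iotaM iotaP)//; exact: cmul_norm_le.
by rewrite le_eqVlt; apply/orP; left; apply/eqP; ring.
Qed.

(** By [pos_typeE] and [iota_corner] the product is the sum of the elements $s_i E(p_i^* p_j) s_j^*$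
    with $p_j = g s_j$. Splitting the expectation by [condE_star_mul] regroups it into $v_a^* v_a$
    for $v_a = \sum_j \chi_a p_j s_j^*$. *)
Lemma pos_type_star_square g : Cc g -> exists (t : seq G) (v : G -> Cf),
  (forall a, Cc (v a)) /\
  (fun c => pos_type c * convolution (involution g) g c) =
  fun c => \sum_(a <- t) convolution (involution (v a)) (v a) c.
Proof.
move=> gg; pose p j := convolution g (s j).
have Cp j : Cc (p j) by exact: Cc_conv.
pose K := \big[setU/set0]_(j <- r) csupp (p j).
have kK : compact K by apply: bigsetU_compact => j _; exact: (proj2 (Cp j)).
have [t [chi [Cchi bchi _ sum1]]] := bis_partition (R := R) hX lX kK.
pose cp a j : Cf := fun d => (chi a d)%:C * p j d.
have Ccp a j : Cc (cp a j).
  by apply: CcM => // c _; exact: (proj1 (Cp j)).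
pose v a : Cf := fun c => \sum_(j <- r) convolution (cp a j) (involution (s j)) c.
have Cis k : Cc (involution (s k)) by exact: Cc_involution.
have Cv1 a j : Cc (convolution (cp a j) (involution (s j))) by exact: Cc_conv.
have Cv a : Cc (v a) by exact: Cc_sum.
exists t, v; split=> //.
have Cg : Cc (involution g) by exact: Cc_involution.
have Cgg : Cc (convolution (involution g) g) by exact: Cc_conv.
have Cvv a : Cc (convolution (involution (v a)) (v a)).
  by apply: Cc_conv => //; exact: Cc_involution.
apply: (iota_inj hX lX iotaP).
- by apply: CcM; [exact: Cc_pos_type|move=> c _; exact: (proj1 Cgg)].
- exact: Cc_sum.
rewrite pos_typeE// [RHS]iota_sum// [LHS]iota_sum//; last first.
  by move=> i; apply: Cc_sum => j; exact: Cc_corner.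
have iv a : iota (v a) =
    \sum_(j <- r) cmul (iota (cp a j)) (cstar (iota (s j))).
  rewrite /v iota_sum//; apply: eq_bigr => j _.
  by rewrite (iotaM iotaP)// (iota_star iotaP).
have Kp j : j \in r -> csupp (p j) `<=` K.
  by move=> jr; rewrite /K (big_rem j)//=; exact: subsetUl.
have key i j : i \in r -> iota (corner (s i) (s j) (convolution (involution g) g)) =
    \sum_(a <- t) cmul (cmul (iota (s i)) (cstar (iota (cp a i))))
      (cmul (iota (cp a j)) (cstar (iota (s j)))).
  move=> ir; rewrite iota_corner//.
  have -> : convolution (involution (s i))
      (convolution (convolution (involution g) g) (s j)) =
      convolution (involution (p i)) (p j).
    apply: (iota_inj hX lX iotaP).
    - by apply: Cc_conv => //; exact: Cc_conv.
    - by apply: Cc_conv => //; exact: Cc_involution.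
    rewrite (iotaM iotaP)//; last exact: Cc_conv.
    rewrite (iotaM iotaP)// (iotaM iotaP)// [RHS](iotaM iotaP)//; last exact: Cc_involution.
    rewrite !(iota_star iotaP)// /p !(iotaM iotaP)// cstarM.
    by rewrite !cmulA.
  rewrite (condE_star_mul bchi sum1 (Cp i) (Cp j) (Kp i ir)) iota_sum//; last first.
    move=> a; apply: (Cc_conv hX lX (f := involution (cp a i)) (g := cp a j)) => //.
    by apply: (Cc_involution hX); exact: Ccp.
  rewrite cmul_suml cmul_sumr; apply: eq_bigr => a _.
  rewrite (iotaM iotaP (Cc_involution hX (Ccp a i)) (Ccp a j)).
  by rewrite (iota_star iotaP (Ccp a i)) !cmulA.
transitivity (\sum_(i <- r) \sum_(j <- r) \sum_(a <- t)
    cmul (cmul (iota (s i)) (cstar (iota (cp a i))))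
      (cmul (iota (cp a j)) (cstar (iota (s j))))).
  rewrite big_seq [RHS]big_seq; apply: eq_bigr => i ir.
  rewrite iota_sum//; last first.
    by move=> j; exact: Cc_corner.
  by apply: eq_bigr => j _; exact: key.
under eq_bigr do rewrite exchange_big/=.
rewrite exchange_big/=; apply: eq_bigr => a _.
rewrite iota_conv_star// iv cstar_sum cmul_suml; apply: eq_bigr => i _.
rewrite cmul_sumr; apply: eq_bigr => j _.
by rewrite cstarM cstarK.
Qed.

Lemma pos_type_ge0 (H : hilbertSpace R) (pi : Cf -> H -> H) g v :
  star_representation pi -> Cc g ->
  0 <= inner H (pi (fun c => pos_type c * convolution (involution g) g c) v) v.
Proof.
move=> piP gg; have [t [u [Cu ->]]] := pos_type_star_square gg.
have Cuu a : Cc (convolution (involution (u a)) (u a)).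
  by apply: Cc_conv => //; exact: Cc_involution.
elim: t => [|a t IH].
  have -> : (fun c => \sum_(a <- [::]) convolution (involution (u a)) (u a) c) =
      fun c => 0 * (0 : C).
    by apply/funext => c; rewrite big_nil mulr0.
  rewrite (repZ piP); last exact: Cc0.
  by rewrite (dotZl (inner H)) mul0r.
have -> : (fun c => \sum_(b <- a :: t) convolution (involution (u b)) (u b) c) =
    convolution (involution (u a)) (u a) \+
    (fun c => \sum_(b <- t) convolution (involution (u b)) (u b) c).
  by apply/funext => c; rewrite big_cons.
rewrite (repD piP)//; last exact: Cc_sum.
rewrite (dotDl (inner H)) addr_ge0// -(rep_norm_sq hX v piP (Cu a)).
by rewrite exprn_ge0.
Qed.

Lemma pos_type_contraction f : (forall x, `|pos_type (aunit T x)| <= 1) ->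
  Cc f -> `|iota (fun c => pos_type c * f c)| <= 8 * `|iota f|.
Proof.
move=> h1 ff; have [K K0 crude] := pos_type_crude.
apply: multiplier_contraction h1 _ K0 crude _ _ ff.
  move=> g gg; apply: CcM; first exact: Cc_pos_type.
  by move=> c _; exact: (proj1 gg).
by move=> H pi g v; exact: pos_type_ge0.
Qed.

End PositiveType.

End Multipliers.

(** * Amenability *)

Section Graph.
Context {R : realType} {X : topologicalType} (T : sgds X).
Hypothesis hX : hausdorff_space X.
Hypothesis lX : locally_compact [set: X].
Local Notation G := (arrow T).
Local Notation C := R[i].
Local Notation Cf := (G -> R[i]^o).
Implicit Types (a b c : G) (x y : X) (phi psi : X -> R[i]^o) (j k : nat).
Local Notation Cc := (Cc R T).

(** The arrows $(x, j, T^j x)$. The range is injective on them but the source need not be, so they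
    do not form a bisection and functions on them have to be cut up. *)
Definition graph_arrow j : set G := [set a |
  [/\ degree a = j%:Z, iter_dom T j (range_of a) &
      iter j T (range_of a) = source_of a]].

Lemma graph_arrow_open j : open (graph_arrow j).
Proof.
rewrite openE => a [da ra ea].
have sa : iter_dom T 0 (source_of a) by [].
have := @near_level X T a j 0%N; rewrite subr0 => /(_ da ra sa ea).
by apply: filterS => b [db rb _ eb].
Qed.

Lemma graph_arrow_inj j a b : graph_arrow j a -> graph_arrow j b ->
  range_of a = range_of b -> a = b.
Proof.
move=> [da _ ea] [db _ eb] ab; apply: arrow_ext => //; first by rewrite da.
by rewrite -ea -eb ab.
Qed.

Lemma graph_arrow_exists j x : iter_dom T j x ->
  exists2 a, graph_arrow j a & range_of a = x.
Proof.
move=> xj; have p : exists m n : nat, [/\ j%:Z = m%:Z - n%:Z, iter_dom T m x,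
    iter_dom T n (iter j T x) & iter m T x = iter n T (iter j T x)].
  by exists j, 0%N; split=> //; rewrite subr0.
by exists (Arrow p).
Qed.

Definition graph j phi : Cf := fun a =>
  if `[< graph_arrow j a >] then phi (range_of a) else 0.

Lemma graph1 j phi a : graph_arrow j a -> graph j phi a = phi (range_of a).
Proof. by move=> ja; rewrite /graph asboolT. Qed.

Lemma graph0 j phi a : ~ graph_arrow j a -> graph j phi a = 0.
Proof. by move=> ja; rewrite /graph asboolF. Qed.

Lemma Cc_graph j phi : CcX phi -> csupp phi `<=` iter_dom T j ->
  Cc (graph j phi).
Proof.
move=> [cphi kphi] phij.
pose sigma x := xget (aunit T x) [set a | graph_arrow j a /\ range_of a = x].
have sE b : graph_arrow j b -> sigma (range_of b) = b.
  move=> jb; rewrite /sigma; case: xgetP => [a _ [ja ab]|/(_ b)]; last by case.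
  exact: (@graph_arrow_inj j).
have phiG x : csupp phi x -> exists2 b, graph_arrow j b & range_of b = x.
  by move=> /phij/graph_arrow_exists.
have ks : compact (sigma @` csupp phi).
  apply: continuous_compact => //; apply: continuous_in_subspaceT => x.
  rewrite inE => /phiG[b jb <-].
  exact: section_continuous (@graph_arrow_open j) sE _ jb.
have cs : closed (sigma @` csupp phi).
  by apply: compact_closed => //; exact: arrow_hausdorff.
have s0 b : ~ (sigma @` csupp phi) b -> graph j phi b = 0.
  move=> nb; have [jb|/graph0->//] := pselect (graph_arrow j b).
  rewrite graph1//; apply: csupp_out => h; apply: nb.
  by exists (range_of b) => //; exact: sE.
split; last exact: csupp_compact ks s0.
apply: continuous_csupp => b /(csupp_sub cs s0)[x /phiG[c jc <-]].
rewrite sE// => <-.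
have E : \forall d \near c, (phi \o @range_of X T) d = graph j phi d.
  apply: filterS (open_nbhs_nbhs (conj (@graph_arrow_open j) jc)) => d jd.
  by rewrite graph1.
suff : graph j phi @ c --> graph j phi c by [].
rewrite -(nbhs_singleton E); apply: (cvg_trans (near_eq_cvg E)).
exact: (@continuous_comp _ _ _ _ phi c (@range_continuous X T c) (cphi _)).
Qed.

Definition graph_pair j k c : Prop :=
  [/\ degree c = j%:Z - k%:Z, iter_dom T j (range_of c),
      iter_dom T k (source_of c) &
      iter j T (range_of c) = iter k T (source_of c)].

(** The only possible factorization of [c] passes through the point $T^j r(c) = T^k s(c)$, so the
    convolution has at most one term. *)
Lemma conv_graph j k phi psi c :
  convolution (graph j phi) (involution (graph k psi)) c =
  if `[< graph_pair j k c >] then phi (range_of c) * (psi (source_of c) : C)^*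
  else 0.
Proof.
have [[a [ja ac ga]]|na] := pselect (exists a,
    [/\ graph_arrow j a, range_of a = range_of c & graph j phi a <> 0]); last first.
  rewrite conv_range0; last first.
    move=> a ac; apply: contrapT => ga; apply: na; exists a; split=> //.
    by apply: contrapT => /(@graph0 _ phi).
  case: asboolP => // -[dc rc sc ec].
  have [a ja ac] := graph_arrow_exists rc.
  suff -> : phi (range_of c) = 0 by rewrite mul0r.
  apply: contrapT => h; apply: na; exists a; split=> //.
  by rewrite graph1// ac.
have gi : range_inj (graph j phi).
  move=> b b' gb gb'; apply: (@graph_arrow_inj j).
    by apply: contrapT => /(@graph0 _ phi).
  by apply: contrapT => /(@graph0 _ phi).
rewrite (conv_range_inj _ gi ga ac) graph1// ac /involution.
have cp : source_of (arrow_inv a) = range_of c by [].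
have [da ra ea] := ja; rewrite /graph.
have -> : `[< graph_arrow k (arrow_inv (amul (arrow_inv a) c)) >] =
    `[< graph_pair j k c >].
  apply/asbool_equiv_eq; rewrite /graph_arrow /graph_pair /=.
  rewrite amul_source// amul_range// amul_degree//= da -ac -ea.
  split=> [[d1 d2 d3]|[d1 d2 d3 d4]]; split=> //; by move: d1; lia.
by case: asboolP => _; rewrite /= ?amul_source// conjC0 mulr0.
Qed.

(** A weight on the graph of $T^j$ is a sum of squares of $\chi_b \sqrt{\xi_j}$, with each $\chi_b$
    supported in a bisection: the form that [pos_type] requires. *)
Lemma graph_sq_weight (M : nat) (xi : nat -> X -> R) :
  (forall j x, 0 <= xi j x) ->
  (forall j, CcX (fun x => (xi j x)%:C : R[i]^o)) ->
  (forall j, csupp (xi j) `<=` iter_dom T j) ->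
  exists (r : seq (nat * G)) (s : nat * G -> Cf),
    [/\ forall i, Cc (s i), forall i, bis_supp (s i) &
    sq_weight r s = fun a =>
      \sum_(j < M) graph j (fun x => (xi j x)%:C) a].
Proof.
move=> xi0 Cxi xiD.
pose g j := graph j (fun x => (Num.sqrt (xi j x))%:C).
have csxi j : csupp (fun x => (xi j x)%:C : R[i]^o) `<=` csupp (xi j).
  by apply: csupp_imp => x ->.
have cxi j : continuous (xi j) := continuous_real (proj1 (Cxi j)).
have Cg j : Cc (g j).
  have h0 : csupp (fun x => (Num.sqrt (xi j x))%:C : R[i]^o) `<=`
      csupp (fun x => (xi j x)%:C : R[i]^o).
    by apply: csupp_imp => x [->]; rewrite sqrtr0.
  apply: Cc_graph; last first.
    by apply: subset_trans h0 _; apply: subset_trans (@csxi j) (xiD j).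
  apply: CcX_sub (Cxi j) h0 _ => x _; apply: continuous_rcC.
  apply: (@continuous_comp _ _ _ (xi j) Num.sqrt); first exact: cxi.
  exact: sqrt_continuous.
have /choice[t /choice[chi chiP]] : forall j, exists (t : seq G), exists (chi : G -> G -> R),
    [/\ forall a, Cc (fun c => (chi a c)%:C),
        forall a, bis_supp (fun c => (chi a c)%:C : R[i]^o),
        forall a c, 0 <= chi a c <= 1 &
        forall c, csupp (g j) c -> \sum_(a <- t) chi a c ^+ 2 = 1].
  move=> j; have [t [chi chiP]] := bis_partition (R := R) hX lX (proj2 (Cg j)).
  by exists t, chi.
pose s (i : nat * G) : Cf := fun c => (chi i.1 i.2 c)%:C * g i.1 c.
exists [seq (j, a) | j <- index_iota 0 M, a <- t j], s; split.
- move=> i; have [C1 _ _ _] := chiP i.1.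
  by apply: CcM => // a _; exact: (proj1 (Cg i.1)).
- move=> i; have [_ b1 _ _] := chiP i.1.
  by apply: bis_supp_sub (b1 i.2) _ => a; rewrite /s => ->; rewrite mul0r.
apply/funext => a; rewrite /sq_weight big_allpairs_dep big_mkord.
apply: eq_bigr => j _; rewrite /s /=.
have [ja|ja] := pselect (graph_arrow j a); last first.
  by rewrite graph0// big1// => b _; rewrite /g graph0// mulr0 mul0r.
transitivity (\sum_(b <- t j) ((chi j b a) ^+ 2)%:C * (g j a * (g j a : C)^*)).
  apply: eq_bigr => b _; rewrite rmorphM/= rc_conj rcX.
  by ring.
rewrite -mulr_suml -rc_sum.
have gg : g j a * (g j a : C)^* = graph j (fun x => (xi j x)%:C) a.
  by rewrite /g !graph1// rc_conj -rcM -expr2 sqr_sqrtr.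
have [ga|/csupp_out ga] := pselect (csupp (g j) a).
  by have [_ _ _ ->] := chiP j; rewrite // mul1r gg.
by rewrite -gg ga mul0r mulr0.
Qed.

End Graph.

(** * Sums over partial matchings *)

Section PartialMatching.
Context {R : realType}.
Implicit Types (u v : nat -> R) (P : nat -> nat -> bool).

Lemma sum_unique_le (M : nat) (P : pred nat) (a : R) : 0 <= a ->
  (forall i j, P i -> P j -> i = j) -> \sum_(i < M) (if P i then a else 0) <= a.
Proof.
move=> a0 uP; rewrite -big_mkcond /=.
have [i Pi|P0] := pickP (fun i : 'I_M => P i); last by rewrite big_pred0.
rewrite (bigD1 i)//= big1 ?addr0// => j /andP[Pj /eqP[]].
exact/val_inj/uP.
Qed.

(** Each product is at most half the sum of the two squares, and a partial matching uses every index
    at most once. *)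
Lemma sum_matching_le1 (M : nat) u v P :
  (forall j k k', P j k -> P j k' -> k = k') ->
  (forall j j' k, P j k -> P j' k -> j = j') ->
  \sum_(j < M) u j ^+ 2 <= 1 -> \sum_(j < M) v j ^+ 2 <= 1 ->
  \sum_(j < M) \sum_(k < M) (if P j k then u j * v k else 0) <= 1.
Proof.
move=> Pr Pl u1 v1.
pose S := \sum_(j < M) \sum_(k < M) (if P j k then u j ^+ 2 else 0).
pose S' := \sum_(j < M) \sum_(k < M) (if P j k then v k ^+ 2 else 0).
have S1 : S <= 1.
  apply: le_trans u1; apply: ler_sum => j _; apply: sum_unique_le.
    exact: sqr_ge0.
  by move=> k k'; exact: Pr.
have S'1 : S' <= 1.
  apply: le_trans v1; rewrite /S' exchange_big/=; apply: ler_sum => k _.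
  apply: (@sum_unique_le _ (fun j => P j k)); first exact: sqr_ge0.
  by move=> j j'; exact: Pl.
apply: (@le_trans _ _ (2^-1 * (S + S'))); last by lra.
rewrite -big_split/= mulr_sumr; apply: ler_sum => j _.
rewrite -big_split/= mulr_sumr; apply: ler_sum => k _.
case: ifP => _; last by rewrite addr0 mulr0.
by have := sqr_ge0 (u j - v k); rewrite sqrrB; lra.
Qed.

(** All terms are nonnegative, and only the pairs [(m + i, n + i)] are kept. *)
Lemma sum_matching_ge (M I m n : nat) u v P :
  (forall j, 0 <= u j) -> (forall k, 0 <= v k) ->
  (m + I <= M)%N -> (n + I <= M)%N -> (forall i, P (m + i)%N (n + i)%N) ->
  \sum_(i < I) u (m + i)%N * v (n + i)%N <=
  \sum_(j < M) \sum_(k < M) (if P j k then u j * v k else 0).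
Proof.
move=> u0 v0 mM nM Pi.
pose F j k := if P j k then u j * v k else 0.
have F0 j k : 0 <= F j k by rewrite /F; case: ifP => // _; rewrite mulr_ge0.
pose g j := \sum_(k < M) F j k.
have g0 j : 0 <= g j by exact: sumr_ge0.
rewrite -[leRHS]/(\sum_(j < M) g j) -(big_mkord xpredT g).
rewrite (@big_cat_nat _ _ _ m)//=; last by apply: leq_trans mM; exact: leq_addr.
rewrite (@big_cat_nat _ _ _ (m + I) m M)//= ?leq_addr//.
apply: (@le_trans _ _ (\sum_(m <= j < m + I) g j)); last first.
  by rewrite addrCA lerDl addr_ge0// sumr_ge0.
rewrite -[X in \sum_(X <= _ < _) _]add0n big_addn addKn big_mkord; apply: ler_sum => i _.
have niM : (n + i < M)%N by apply: leq_trans nM; rewrite ltn_add2l.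
rewrite [X in g X]addnC /g (bigD1 (Ordinal niM))//= {1}/F Pi lerDl.
by apply: sumr_ge0.
Qed.

End PartialMatching.

(** * Cut-off weights along the orbits *)

Section Cutoff.
Context {R : realType} {X : topologicalType} (T : sgds X).
Hypothesis hX : hausdorff_space X.
Variable q : X -> R.
Hypothesis cq : continuous q.
Hypothesis q01 : forall x, 0 <= q x <= 1.
Hypothesis qT : csupp q `<=` sgds_dom T.
Hypothesis kq : compact (csupp q).

(** Unfolded, $q(x) q(Tx) \cdots q(T^{j-1}x) \sqrt{1 - q(T^j x)^2}$. Its square is the probability
    that a walk along the orbit, which continues from $y$ with probability $q(y)^2$, stops after
    exactly [j] steps. Outside the domain of [T], where [T x] is a junk value, [q x] is 0. *)
Fixpoint cutoff (j : nat) (x : X) : R :=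
  if j is i.+1 then q x * cutoff i (T x) else Num.sqrt (1 - q x ^+ 2).

Lemma cutoff_ge0 j x : 0 <= cutoff j x.
Proof.
elim: j x => [|j IH] x /=; first exact: sqrtr_ge0.
by rewrite mulr_ge0//; have /andP[] := q01 x.
Qed.

(** Composition with [T] is continuous only on the domain; the factor [q], supported there, makes
    the product continuous everywhere. *)
Lemma cutoff_continuous j : continuous (cutoff j).
Proof.
elim: j => [|j IH].
  move=> x; apply: (@continuous_comp _ _ _ (fun x => 1 - q x ^+ 2) Num.sqrt).
    by apply: cvgB; [exact: cvg_cst|apply: cvgM; exact: cq].
  exact: sqrt_continuous.
apply: continuous_csupp => x /= h.
have {h}/qT xT : csupp q x by apply: csupp_imp h => y /= ->; rewrite mul0r.
apply: cvgM; first exact: cq.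
by apply: (@continuous_comp _ _ _ T (cutoff j)); [exact: (proj1 (sgds_nbhs xT))|exact: IH].
Qed.

Lemma csupp_cutoff j : csupp (cutoff j) `<=` iter_dom T j.
Proof.
elim: j => [|j IH]; first by move=> x _ k; rewrite ltn0.
(* Closed although [T] is continuous only on its domain: off [csupp q] the first condition fails
   near the point, and on [csupp q] the map is continuous. *)
pose K := csupp q `&` T @^-1` csupp (cutoff j).
have cK : closed K.
  rewrite closedE/= => x xK.
  have qx : csupp q x.
    apply: contrapT => nqx; apply: xK.
    have : nbhs x (~` csupp q).
      by apply: open_nbhs_nbhs; split=> //; exact/closed_openC/closed_closure.
    by apply: filterS => y nqy [].
  split=> //=; apply: contrapT => nT; apply: xK.
  have : nbhs (T x) (~` csupp (cutoff j)).
    by apply: open_nbhs_nbhs; split=> //; exact/closed_openC/closed_closure.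
  move=> /(proj1 (sgds_nbhs (qT qx))).
  suff /filterS : T @^-1` (~` csupp (cutoff j)) `<=` ~` K by apply.
  by move=> y /= nTy [].
have : csupp (cutoff j.+1) `<=` K.
  apply: csupp_sub => // y nKy /=; apply: contrapT => /eqP.
  rewrite mulf_eq0 negb_or => /andP[qy jy]; apply: nKy.
  by split; exact: subset_closure.
move=> h x /h[/qT xT /IH Tx]; rewrite -[j.+1]/(1 + j)%N.
by apply/iter_domD; split=> // -[].
Qed.

Lemma cutoff_sum_le J x : \sum_(j < J) cutoff j x ^+ 2 <= 1.
Proof.
elim: J x => [|J IH] x; first by rewrite big_ord0.
have /andP[q0 q1] := q01 x; have q2 : q x ^+ 2 <= 1 by rewrite expr_le1.
rewrite big_ord_recl /= sqr_sqrtr ?subr_ge0//.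
under eq_bigr do rewrite exprMn.
rewrite -mulr_sumr; have := IH (T x); set S := \sum_(_ < _) _ => S1.
by have := sqr_ge0 (q x); nra.
Qed.

(** The partial sums satisfy $S_{J+1}(x) = 1 - q(x)^2 + q(x)^2 S_J(Tx)$, so each step multiplies the
    deficit from 1 by at most $d^2$. *)
Lemma cutoff_sum_ge J x d : 0 <= d -> (forall y, q y <= d) ->
  1 - (d ^+ 2) ^+ J <= \sum_(j < J) cutoff j x ^+ 2.
Proof.
move=> d0 qd; elim: J x => [|J IH] x; first by rewrite big_ord0 subrr.
have /andP[q0 q1] := q01 x; have q2 : q x ^+ 2 <= 1 by rewrite expr_le1.
rewrite big_ord_recl /= sqr_sqrtr ?subr_ge0//.
under eq_bigr do rewrite exprMn.
rewrite -mulr_sumr; have := IH (T x); set S := \sum_(_ < _) _ => SJ.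
have qd2 : q x ^+ 2 <= d ^+ 2 by rewrite lerXn2r ?nnegrE.
have D0 : 0 <= (d ^+ 2) ^+ J by rewrite !exprn_ge0.
rewrite exprS; have := ler_wpM2l (sqr_ge0 (q x)) SJ.
by have := ler_wpM2r D0 qd2; lra.
Qed.

Lemma cutoff_orbit d m x i : (forall k, (k < m)%N -> q (iter k T x) = d) ->
  cutoff (m + i) x = d ^+ m * cutoff i (iter m T x).
Proof.
elim: m x => [|m IH] x qd; first by rewrite mul1r.
rewrite addSn /= (qd 0%N)// IH; last first.
  by move=> k km; rewrite -iterSr; exact: (qd k.+1).
by rewrite -iterSr exprS mulrA.
Qed.

End Cutoff.

(** * An approximate unit of functions of positive type *)

Section Amenability.
Context {R : realType} {X : topologicalType} (T : sgds X).
Hypothesis hX : hausdorff_space X.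
Hypothesis lX : locally_compact [set: X].
Local Notation G := (arrow T).
Local Notation C := R[i].
Local Notation Cf := (G -> R[i]^o).
Local Notation Cc := (Cc R T).

(** Besides the level, the two orbit segments before the merging point are required to lie in [L],
    on which [q] will be constant. *)
Definition orbits_in (L : set X) (m n : nat) (c : G) : Prop :=
  [/\ degree c = m%:Z - n%:Z,
      iter m T (range_of c) = iter n T (source_of c),
      forall i, (i < m)%N -> L (iter i T (range_of c)) &
      forall i, (i < n)%N -> L (iter i T (source_of c))].

(** The two orbit segments are finite subsets of the domain; the support of a Urysohn function equal
    to 1 on them is a compact neighbourhood of each of their points, and nearby arrows have their
    segments in it. *)
Lemma orbits_in_nbhs (c : G) : exists p : set X * nat * nat,
  [/\ compact p.1.1, p.1.1 `<=` sgds_dom T &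
      \forall b \near c, orbits_in p.1.1 p.1.2 p.2 b].
Proof.
have [m [n [dc rc sc ec]]] := arrow_levels c.
pose F := [set iter i T (range_of c) | i in `I_m] `|`
  [set iter i T (source_of c) | i in `I_n].
have kF : compact F.
  by apply: finite_compact; rewrite finite_setU; split; exact: finite_image.
have FT : F `<=` sgds_dom T by move=> x [[i im <-]|[i im <-]]; [exact: rc|exact: sc].
have [k [[ck kk] _ k1 kT]] := CcX_urysohn (R := R) hX lX kF (@sgds_dom_open _ T) FT.
have kC x : csupp k x -> csupp (fun x => (k x)%:C : R[i]^o) x.
  by apply: csupp_imp => y [].
have near_csupp x : F x -> nbhs x (csupp k).
  move=> Fx; have : nbhs x (k @^-1` [set t | t != 0]).
    apply: (continuous_real ck); rewrite k1//; apply: open_nbhs_nbhs.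
    by split; [exact: open_neq|exact: oner_neq0].
  by apply: filterS => y /= ky; exact: subset_closure.
exists (csupp k, m, n); split=> //=.
  apply: csupp_compact kk _; first exact: closed_closure.
  by move=> y ny; apply: csupp_out => /kC.
have nr (i : 'I_m) : \forall b \near c, csupp k (iter i T (range_of b)).
  have ri : iter_dom T i (range_of c) by apply: iter_dom_leq rc; exact/ltnW.
  have h : {for c, continuous (iter i T \o @range_of X T)}.
    by apply: continuous_comp; [exact: range_continuous|exact: (proj1 (iter_nbhs ri))].
  apply: h => /=.
  by apply: near_csupp; left; exists i; [exact: ltn_ord|].
have ns (i : 'I_n) : \forall b \near c, csupp k (iter i T (source_of b)).
  have si : iter_dom T i (source_of c) by apply: iter_dom_leq sc; exact/ltnW.
  have h : {for c, continuous (iter i T \o @source_of X T)}.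
    by apply: continuous_comp; [exact: source_continuous|exact: (proj1 (iter_nbhs si))].
  apply: h => /=.
  by apply: near_csupp; right; exists i; [exact: ltn_ord|].
have F1 := @filter_forall _ _ _ _ (nbhs_filter c) nr.
have F2 := @filter_forall _ _ _ _ (nbhs_filter c) ns.
apply: filterS (filterI (near_level dc rc sc ec) (filterI F1 F2)) => b.
move=> [[db rb sb eb] [hr hs]]; split=> //.
  by move=> i im; exact: (hr (Ordinal im)).
by move=> i im; exact: (hs (Ordinal im)).
Qed.

Lemma compact_orbits_in (K : set G) : compact K -> exists (L : set X) (N : nat),
  [/\ compact L, L `<=` sgds_dom T & forall c, K c -> exists m n,
    [/\ (m <= N)%N, (n <= N)%N & orbits_in L m n c]].
Proof.
move=> kK; have /choice[p pP] := orbits_in_nbhs.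
have [|s [_ sK]] := compact_finite_nbhs (f := fun a => [set b |
  orbits_in (p a).1.1 (p a).1.2 (p a).2 b]) kK.
  by move=> a _; have [] := pP a.
exists (\big[setU/set0]_(a <- s) (p a).1.1).
exists (\sum_(a <- s) ((p a).1.2 + (p a).2))%N; split.
- by apply: bigsetU_compact => a _; have [] := pP a.
- elim/big_ind: _ => [x []//|A B hA hB x [/hA|/hB]//|a _].
  by have [] := pP a.
move=> c /sK[a sa [dc ec rc sc]]; exists (p a).1.2, (p a).2.
have sub : (p a).1.1 `<=` \big[setU/set0]_(b <- s) (p b).1.1.
  by rewrite (big_rem a)//=; exact: subsetUl.
split; [| |split=> //].
- by rewrite (big_rem a)//= -!addnA leq_addr.
- by rewrite (big_rem a)//= addnAC leq_addl.
- by move=> i /rc/sub.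
- by move=> i /sc/sub.
Qed.

(* The positive type functions of the [xi j = chi * cutoff q j] with [q = d] on
   the relevant orbit segments: the overlap of the weights at the two ends of an
   arrow of level [(m, n)] is at least [d ^ (m + n) (1 - d ^ (2 J))]. *)
Lemma pos_type_approximate_unit (K : set G) (e : R) : compact K -> 0 < e ->
  exists (r : seq (nat * G)) (s : nat * G -> Cf),
  [/\ forall i, Cc (s i), forall i, bis_supp (s i),
      forall x, `|pos_type r s (aunit T x)| <= 1 &
      forall c, K c -> `|1 - pos_type r s c| <= e%:C].
Proof.
move=> kK e0; have [L [N [kL LT KL]]] := compact_orbits_in kK.
(* If [e / 2] is at least 1 any [d] will do; otherwise [1 - u] works by Bernoulli, with $u = e /
   (2(2N + 1))$. *)
have [d [d0 d1 dN]] : exists d : R, [/\ 0 < d, d < 1 & 1 - e / 2 <= d ^+ N * d ^+ N].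
  have [e1|e1] := lerP 1 (e / 2).
    exists (1/2); split; [by lra|by lra|].
    have : 0 <= (1/2 : R) ^+ N * (1/2) ^+ N by rewrite mulr_ge0 ?exprn_ge0//; lra.
    by lra.
  pose M := (N + N)%N; pose u := e / 2 / M.+1%:R.
  have M0 : (0 : R) < M.+1%:R by rewrite ltr0n.
  have M1 : (1 : R) <= M.+1%:R by rewrite ler1n.
  have u0 : 0 < u by rewrite !divr_gt0.
  have u1 : u <= e / 2 by rewrite ler_pdivrMr// ler_peMr//; lra.
  have uM : M%:R * u <= e / 2.
    rewrite /u mulrC mulrAC ler_pdivrMr// ler_pM2l; last by lra.
    by rewrite ler_nat.
  exists (1 - u); split; [by lra|by lra|]; rewrite -exprD -/M.
  have bern k : 1 - k%:R * u <= (1 - u) ^+ k.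
    elim: k => [|k IH]; first by rewrite mul0r subr0.
    rewrite exprS -natr1; have k0 : (0 : R) <= k%:R by rewrite ler0n.
    have : (1 - u) * (1 - k%:R * u) <= (1 - u) * (1 - u) ^+ k.
      by rewrite ler_wpM2l//; lra.
    by apply: le_trans; have := mulr_ge0 k0 (sqr_ge0 u); lra.
  by apply: le_trans (bern M); lra.
have [J dJ] : exists J, (d ^+ 2) ^+ J <= e / 2.
  have d2 : `|d ^+ 2| < 1.
    by rewrite ger0_norm ?sqr_ge0// expr_lt1// ltW.
  have /cvgrPdist_le/(_ (e / 2)) := cvg_expr d2.
  case; first by rewrite divr_gt0.
  move=> J _ /(_ J (leqnn J)); rewrite sub0r normrN ger0_norm; first by exists J.
  by rewrite !exprn_ge0// ltW.
have [rho [[crho krho] rho01 rho1 rhoT]] :=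
  CcX_urysohn (R := R) hX lX kL (@sgds_dom_open _ T) LT.
have kK' := compactU (compact_range kK) (compact_source kK).
(* [cutoff T q 0] equals 1 wherever [q] vanishes, so the weights get their compact support from
   [chi], which is 1 at both ends of the arrows of [K]. *)
have [chi [Cchi chi01 chi1 _]] := CcX_urysohn (R := R) hX lX kK' openT (@subsetT _ _).
pose q x := d * rho x.
have crhoR : continuous rho := continuous_real crho.
have cq : continuous q by move=> x; apply: cvgMr; exact: crhoR.
have q01 x : 0 <= q x <= 1.
  have /andP[h0 h1] := rho01 x; rewrite mulr_ge0 ?(ltW d0)//=.
  by rewrite mulr_ile1// ltW.
have qd x : q x <= d.
  by have /andP[h0 h1] := rho01 x; rewrite /q ler_piMr// ltW.
have qrho : csupp q `<=` csupp rho by apply: csupp_imp => x h; rewrite /q h mulr0.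
have qT : csupp q `<=` sgds_dom T := subset_trans qrho rhoT.
pose xi j x := chi x * cutoff T q j x.
have xi0 j x : 0 <= xi j x.
  by have /andP[h0 _] := chi01 x; rewrite mulr_ge0// cutoff_ge0.
have cxi j : continuous (cutoff T q j) by exact: cutoff_continuous.
have Cxi j : CcX (fun x => (xi j x)%:C : R[i]^o).
  apply: (CcX_sub Cchi).
    by apply: csupp_imp => x [h]; rewrite /xi h mul0r.
  move=> x _; rewrite /xi; have -> : (fun x => (chi x * cutoff T q j x)%:C : R[i]^o) =
    (fun x => (chi x)%:C * (cutoff T q j x)%:C) by apply/funext => y; exact: rcM.
  by apply: continuous_mulC; [exact: (proj1 Cchi)|apply: continuous_rcC; exact: cxi].
have xiD j : csupp (xi j) `<=` iter_dom T j.
  apply: subset_trans (csupp_cutoff qT (j := j)).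
  by apply: csupp_imp => x h; rewrite /xi h mulr0.
pose M := (N + J)%N.
have xi_le x : \sum_(j < M) xi j x ^+ 2 <= 1.
  apply: le_trans (cutoff_sum_le T q01 M x); apply: ler_sum => j _.
  have /andP[h0 h1] := chi01 x; rewrite lerXn2r ?nnegrE ?mulr_ge0 ?cutoff_ge0//.
  by rewrite ler_piMl// cutoff_ge0.
have [r [s [Cs bs wE]]] := graph_sq_weight hX lX M xi0 Cxi xiD.
exists r, s.
(* The domain conditions of [graph_pair] are left out: where they fail, one of the two weights
   vanishes. *)
pose P (c : G) j k := `[< degree c = j%:Z - k%:Z /\
  iter j T (range_of c) = iter k T (source_of c) >].
have pE c : pos_type r s c = (\sum_(j < M) \sum_(k < M)
    (if P c j k then xi j (range_of c) * xi k (source_of c) else 0))%:C.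
  have rg j : row_finite (graph j (fun x => (xi j x)%:C) : Cf).
    apply: Cc_row_finite => //; apply: Cc_graph => //.
    by apply: subset_trans (xiD j); apply: csupp_imp => x ->.
  rewrite /pos_type wE conv_suml// rc_sum; apply: eq_bigr => j _.
  have -> : involution (fun a : G => \sum_(k < M) graph k (fun x => (xi k x)%:C) a) =
      fun a : G => \sum_(k < M) involution (graph k (fun x => (xi k x)%:C)) a :> R[i]^o.
    by apply/funext => a; rewrite /involution rmorph_sum.
  rewrite conv_sumr// rc_sum; apply: eq_bigr => k _.
  rewrite conv_graph rc_conj -rcM.
  have [jk|njk] := pselect (graph_pair j k c).
    by have [d' _ _ e'] := jk; rewrite asboolT// /P asboolT.
  rewrite asboolF//; case: ifP => // /asboolP[d' e'].
  have [xr|/csupp_out->] := pselect (csupp (xi j) (range_of c)); last by rewrite mul0r.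
  have [xs|/csupp_out->] := pselect (csupp (xi k) (source_of c)); last by rewrite mulr0.
  by case: njk; split=> //; [exact: xiD xr|exact: xiD xs].
have Pl c j k k' : P c j k -> P c j k' -> k = k'.
  by move=> /asboolP[d' _] /asboolP[d'' _]; lia.
have Pr c j j' k : P c j k -> P c j' k -> j = j'.
  by move=> /asboolP[d' _] /asboolP[d'' _]; lia.
have p_le c : \sum_(j < M) \sum_(k < M)
    (if P c j k then xi j (range_of c) * xi k (source_of c) else 0) <= 1.
  apply: (sum_matching_le1 (u := xi ^~ _) (v := xi ^~ _)).
  - exact: Pl.
  - exact: Pr.
  - exact: xi_le.
  - exact: xi_le.
split=> // [x|c Kc]; rewrite pE.
  rewrite rc_norm lecR ger0_norm//; apply: sumr_ge0 => j _; apply: sumr_ge0 => k _.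
  by case: ifP => // _; rewrite mulr_ge0.
rewrite -[1]/(1%:C) -raddfB rc_norm lecR ger0_norm ?subr_ge0// lerBlDl -lerBlDr.
have [m [n [mN nN [dc ec rc sc]]]] := KL c Kc.
have Pi i : P c (m + i)%N (n + i)%N.
  apply/asboolP; split; first by rewrite dc; lia.
  by rewrite ![(_ + i)%N]addnC !iterD ec.
have mM : (m + J <= M)%N by rewrite leq_add2r.
have nM : (n + J <= M)%N by rewrite leq_add2r.
apply: le_trans (sum_matching_ge (u := xi ^~ _) (v := xi ^~ _) _ _ mM nM Pi) => //.
pose z := iter m T (range_of c).
have E i : xi (m + i)%N (range_of c) * xi (n + i)%N (source_of c) =
    d ^+ m * d ^+ n * cutoff T q i z ^+ 2.
  rewrite /xi !chi1; [|by right; exists c|by left; exists c].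
  rewrite (@cutoff_orbit _ _ _ _ d m)//; last first.
    by move=> k /rc Lk; rewrite /q rho1// mulr1.
  rewrite (@cutoff_orbit _ _ _ _ d n)//; last first.
    by move=> k /sc Lk; rewrite /q rho1// mulr1.
  by rewrite -ec -/z; ring.
under eq_bigr do rewrite E.
rewrite -mulr_sumr.
have dk k : (k <= N)%N -> d ^+ N <= d ^+ k.
  by move=> kN; rewrite ler_wiXn2l// ltW.
have S1 := cutoff_sum_ge T q01 J z (ltW d0) qd.
have dN0 k : 0 <= d ^+ k by rewrite exprn_ge0// ltW.
have h1 : d ^+ N * d ^+ N <= d ^+ m * d ^+ n by rewrite ler_pM// dk.
have h2 : d ^+ m * d ^+ n <= 1 by rewrite mulr_ile1// exprn_ile1// ltW.
set S := \sum_(_ < _) _ in S1 *.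
have S2 : 1 - e / 2 <= S by lra.
set D := d ^+ m * d ^+ n in h1 h2 *.
have D0 : 0 <= D by rewrite mulr_ge0.
have : D * (1 - e / 2) <= D * S by rewrite ler_wpM2l.
nra.
Qed.

End Amenability.

(** * Ideals *)

(** A Neumann series: with [u = phi - j] one has $p = p j + p u$, and repeated substitution leaves a
    member of [J] plus $p u^n$, which tends to 0. *)
Lemma ideal_absorbs {R : realType} {A : cstarAlgebra R}
    (J : set A) (p phi j : A) :
  closed_ideal J -> cmul p phi = p -> J j -> `|phi - j| <= 2^-1 -> J p.
Proof.
move=> [_ JD _ JM cJ] pphi Jj hj.
pose u := phi - j.
have pE : p = cmul p j + cmul p u by rewrite -cmulDr addrC subrK pphi.
have approx n : exists y w, [/\ J y, p = y + cmul p w & `|w| <= 2^-1 ^+ n.+1].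
  elim: n => [|n [y [w [Jy pyw wn]]]].
    by exists (cmul p j), u; split=> //; exact: (proj1 (JM _ _ Jj)).
  exists (y + cmul (cmul p j) w), (cmul u w); split.
  - by apply: JD => //; apply: (proj2 (JM _ _ _)); exact: (proj1 (JM _ _ Jj)).
  - by rewrite cmulA -addrA -cmulDl -pE -pyw.
  - by apply: le_trans (cmul_norm_le _ _) _; rewrite exprS ler_pM.
apply: cJ => B /nbhs_ballP[e /= e0 Be].
have [n hn] : exists n : nat, `|p| * 2^-1 ^+ n.+1 < e.
  have p1 : 0 < `|p| + 1 by rewrite ltr_wpDl.
  have eE : e = (Re e)%:C by rewrite RRe_real// gtr0_real.
  have pR : `|p| = (Re `|p|)%:C by rewrite Re_normc.
  have eR : 0 < Re e by rewrite -ltcR -eE.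
  have q0 : 0 <= Re `|p| by rewrite -ler0c Re_normc.
  have half : `|2^-1 : R| < 1 by rewrite ger0_norm// invf_lt1// ltr1n.
  have /cvgrPdist_lt/(_ (Re e / (Re `|p| + 1))) := cvg_expr half.
  case; first by rewrite divr_gt0// ltr_wpDl.
  move=> n _ /(_ n.+1 (leqnSn n)); rewrite sub0r normrN ger0_norm; last first.
    by rewrite exprn_ge0.
  rewrite ltr_pdivlMr ?ltr_wpDl// => h; exists n.
  have -> : 2^-1 ^+ n.+1 = (2^-1 ^+ n.+1)%:C :> R[i].
    by rewrite rcX; congr (_ ^+ _); rewrite fmorphV/= rmorph_nat.
  rewrite pR eE -rcM ltcR; apply: le_lt_trans h.
  by rewrite mulrC ler_wpM2l ?exprn_ge0// lerDl.
have [y [w [Jy pyw wn]]] := approx n.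
exists y; split=> //; apply: Be; rewrite -ball_normE /=.
rewrite {1}pyw addrC addKr; apply: le_lt_trans hn.
by apply: le_trans (cmul_norm_le _ _) _; rewrite ler_wpM2l.
Qed.

Section Simplicity.
Context {R : realType} {X : topologicalType} (T : sgds X).
Hypothesis hX : hausdorff_space X.
Hypothesis lX : locally_compact [set: X].
Local Notation G := (arrow T).
Local Notation C := R[i].
Local Notation Cf := (G -> R[i]^o).
Context {A : cstarAlgebra R} {iota : Cf -> A}.
Hypothesis iotaP : is_groupoid_cstar iota.
Local Notation Cc := (Cc R T).
Local Notation liftT phi := (@lift R X T phi).
Implicit Types (f g s t : Cf) (phi psi : X -> R[i]^o) (W : set X).

Let hG : hausdorff_space G := @arrow_hausdorff X T hX.

(** Says that the continuous extension of [F] to [A] would vanish at [a], without constructing an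
    extension. *)
Definition vanishes_at (a : A) (F : Cf -> A) : Prop :=
  forall e : R, 0 < e -> exists2 d : R, 0 < d &
    forall f, Cc f -> `|iota f - a| < d%:C -> `|F f| <= e%:C.

Lemma vanishes_at_sum (a : A) (I : Type) (r : seq I) (F : I -> Cf -> A) :
  (forall i, vanishes_at a (F i)) ->
  vanishes_at a (fun f => \sum_(i <- r) F i f).
Proof.
move=> aF; elim: r => [|i r IH] e e0.
  by exists 1 => // f _ _; rewrite big_nil normr0 ler0c ltW.
have e2 : 0 < e / 2 by rewrite divr_gt0.
have [d1 d10 h1] := aF i _ e2; have [d2 d20 h2] := IH _ e2.
exists (Num.min d1 d2); first by rewrite lt_min d10 d20.
move=> f ff fa; rewrite big_cons (le_trans (ler_normD _ _))//.
have -> : e%:C = (e / 2)%:C + (e / 2)%:C by rewrite -rcD -splitr.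
by apply: lerD; [apply: h1|apply: h2] => //; apply: lt_le_trans fa _;
  rewrite lecR ge_min lexx ?orbT.
Qed.

(* [b] has zero conditional expectation onto the functions on the unit space. *)
Definition unit_null (b : A) : Prop :=
  forall e : R, 0 < e -> exists2 d : R, 0 < d &
    forall f, Cc f -> `|iota f - b| < d%:C ->
      forall x, `|f (aunit T x)| <= e%:C.

(** If [f] is near [a], then $s^* f t$ is near $s^* a t$, so its values on units are small and by
    [iota_lift_le] the norm of its expectation is small too. Adding 1 to [m] avoids a division by
    zero. *)
Lemma vanishes_at_corner (a : A) s t : Cc s -> Cc t ->
  unit_null (cmul (cstar (iota s)) (cmul a (iota t))) ->
  vanishes_at a (fun f => cmul (iota s) (cmul (iota (condE
    (convolution (involution s) (convolution f t)))) (cstar (iota t)))).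
Proof.
move=> ss tt nb e e0.
pose m := Re `|iota s| * Re `|iota t|.
have m0 : 0 <= m by rewrite mulr_ge0// -ler0c Re_normc.
have mE : m%:C = `|iota s| * `|iota t| by rewrite rcM !Re_normc.
have m1 : 0 < m + 1 by rewrite ltr_wpDl.
have mle : m / (m + 1) <= 1 by rewrite ler_pdivrMr// mul1r lerDl.
have [d d0 hd] := nb (e / (m + 1)) (divr_gt0 e0 m1).
exists (d / (m + 1)); first exact: divr_gt0.
move=> f ff fa; set g := convolution _ _.
have Cfs : Cc (convolution f t) by exact: Cc_conv.
have Cis : Cc (involution s) by exact: Cc_involution.
have Cg : Cc g by exact: Cc_conv.
have gb : `|iota g - cmul (cstar (iota s)) (cmul a (iota t))| < d%:C.
  rewrite (iotaM iotaP)// (iota_star iotaP)// (iotaM iotaP)// -cmulBr -cmulBl.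
  apply: le_lt_trans (cmul_norm_le _ _) _; rewrite cstar_norm.
  apply: (@le_lt_trans _ _ (`|iota s| * (`|iota f - a| * `|iota t|))).
    by rewrite ler_wpM2l// cmul_norm_le.
  rewrite mulrCA -mE.
  apply: (@le_lt_trans _ _ ((d / (m + 1))%:C * m%:C)).
    by rewrite ler_wpM2r ?ler0c// ltW.
  by rewrite -rcM ltcR mulrAC ltr_pdivrMr// ltr_pM2l// ltrDl.
have gl : `|iota (condE g)| <= (e / (m + 1))%:C.
  apply: iota_lift_le => //; [exact: CcX_restrict|exact: hd|].
  by rewrite ltW// divr_gt0.
apply: le_trans (cmul_norm_le _ _) _.
apply: (@le_trans _ _ (`|iota s| * ((e / (m + 1))%:C * `|iota t|))).
  rewrite ler_wpM2l//; apply: le_trans (cmul_norm_le _ _) _.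
  by rewrite cstar_norm ler_wpM2r.
rewrite mulrCA -mE -rcM lecR mulrAC -mulrA.
by rewrite ler_piMr// ltW.
Qed.

(** With [f0] and [f1] near [a], and [h] close to 1 on the support of [f0], the element [a] is
    compared in turn with [f0], [h f0], [h f1] and 0. The allowed errors are [e], [e] from
    [iota_dominated], [16 e] from the factor 8 on a distance below [2 e], and [2 e], which makes
    20. *)
Lemma unit_null_ideal_eq0 (I : set A) : closed_ideal I ->
  (forall b, I b -> unit_null b) -> forall a, I a -> a = 0.
Proof.
move=> [_ _ _ Imul _] In a Ia.
have dense (d : R) : 0 < d -> exists2 f, Cc f & `|iota f - a| < d%:C.
  move=> d0; have : closure (iota @` Cc) a by rewrite (iota_dense iotaP).
  have d0' : 0 < d%:C by rewrite -[0]/(0%:C) ltcR.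
  move=> /(_ (ball a d%:C)) /(_ (nbhsx_ballx _ _ d0'))[_ [[f ff <-]]].
  by rewrite -ball_normE /= distrC => fa; exists f.
suff small (e : R) : 0 < e -> `|a| <= (20 * e)%:C.
  apply/normr0_eq0/eqP; rewrite eq_le normr_ge0 andbT -Re_normc -[0]/(0%:C) lecR.
  apply/ler_addgt0Pr => e e0; rewrite add0r -lecR Re_normc.
  have := small (e / 20); rewrite divr_gt0// => /(_ isT).
  by rewrite mulrC divfK.
move=> e0; have [f0 C0 f0a] := dense e e0.
have [K K0 dom] := iota_dominated hX lX iotaP C0.
have K1 : 0 < K + 1 by rewrite ltr_wpDl.
have eK : 0 < e / (K + 1) by exact: divr_gt0.
have [r [s [Cs bs h1 hK]]] := pos_type_approximate_unit hX lX (proj2 C0) eK.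
pose h := pos_type r s.
have Ch f : Cc f -> Cc (fun c => h c * f c).
  by move=> ff; apply: CcM; [exact: Cc_pos_type|move=> c _; exact: (proj1 ff)].
have contr f : Cc f -> `|iota (fun c => h c * f c)| <= 8 * `|iota f|.
  by move=> ff; exact: (pos_type_contraction hX lX iotaP Cs bs h1 ff).
have van : vanishes_at a (fun f => iota (fun c => h c * f c)).
  have := vanishes_at_sum r (fun i => vanishes_at_sum r (fun j =>
    vanishes_at_corner (Cs i) (Cs j) (In _ (proj1 (Imul _ _ (proj2 (Imul _ _ Ia)))))))
    (a := a).
  move=> van d d0; have [d' d'0 hd'] := van d d0; exists d' => // f ff fa.
  rewrite pos_typeE// iota_sum//; last first.
    by move=> i; apply: Cc_sum => j; exact: Cc_corner.
  apply: le_trans (hd' f ff fa); rewrite le_eqVlt; apply/orP; left; apply/eqP.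
  congr `|_|; apply: eq_bigr => i _; rewrite iota_sum//; last first.
    by move=> j; exact: Cc_corner.
  by apply: eq_bigr => j _; rewrite iota_corner.
have [d d0 hd] := van e e0.
(* A second approximant is needed because [d] depends on [h], and [h] was built from [f0]. *)
have [|f1 C1] := dense (Num.min d e); first by rewrite lt_min d0 e0.
move=> f1a; have f1d : `|iota f1 - a| < d%:C.
  by apply: lt_le_trans f1a _; rewrite lecR ge_min lexx.
have f1e : `|iota f1 - a| < e%:C.
  by apply: lt_le_trans f1a _; rewrite lecR ge_min lexx orbT.
have hf1 := hd f1 C1 f1d.
have hf0 : `|iota f0 - iota (fun c => h c * f0 c)| <= e%:C.
  rewrite -iotaB//; last exact: Ch.
  apply: le_trans (dom _ (e / (K + 1)) _ _ _) _; first exact: ltW.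
  - by apply: CcB => //; exact: Ch.
  - move=> c; rewrite -[X in X - _]mul1r -mulrBl normrM.
    have [cK|/csupp_out->] := pselect (csupp f0 c); last by rewrite normr0 !mulr0.
    by rewrite ler_wpM2r// hK.
  - by rewrite lecR mulrCA ler_piMr ?(ltW e0)// ler_pdivrMr// mul1r lerDl.
have h01 : `|iota (fun c => h c * f0 c) - iota (fun c => h c * f1 c)| <= (16 * e)%:C.
  rewrite -iotaB//; [|exact: Ch..].
  have -> : (fun c => h c * f0 c - h c * f1 c) = (fun c => h c * (f0 c - f1 c)).
    by apply/funext => c; rewrite mulrBr.
  apply: le_trans (contr _ _) _; first exact: CcB.
  rewrite iotaB//; have -> : iota f0 - iota f1 = (iota f0 - a) - (iota f1 - a).
    by rewrite opprB addrA subrK.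
  have -> : (16 * e)%:C = 8 * (e%:C + e%:C).
    by rewrite rcM rmorph_nat; ring.
  rewrite ler_wpM2l//; apply: le_trans (ler_normB _ _) _.
  by apply: lerD; exact: ltW.
have -> : a = - (iota f0 - a) + ((iota f0 - iota (fun c => h c * f0 c)) +
    ((iota (fun c => h c * f0 c) - iota (fun c => h c * f1 c)) +
     iota (fun c => h c * f1 c))).
  by rewrite subrK subrK opprB subrK.
have -> : (20 * e)%:C = e%:C + (e%:C + ((16 * e)%:C + (e + e)%:C)).
  by rewrite -!rcD; congr (_%:C); ring.
apply: le_trans (ler_normD _ _) _; apply: lerD; first by rewrite normrN ltW.
apply: le_trans (ler_normD _ _) _; apply: lerD => //.
apply: le_trans (ler_normD _ _) _; apply: lerD => //.
by apply: le_trans hf1 _; rewrite lecR lerDl ltW.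
Qed.

(** If $T^m$ and $T^n$ differ somewhere on $W \cap U \cap V$, they differ on a nonempty open part,
    over which the basic set has no isotropy. If they agree throughout, freeness makes the
    intersection empty, and no loop of the basic set lies over [W]. For [m = n] a loop has degree 0
    and is a unit. *)
Lemma free_basic_open (i : basic_index (X := X)) W : essentially_free T ->
  basic_indices T i -> open W -> W !=set0 ->
  exists W', [/\ open W', W' !=set0, W' `<=` W & forall c, bopen T i c ->
    range_of c = source_of c -> W' (range_of c) -> units c].
Proof.
case: i => [[[m n] U] V] free [[oU Um _] [oV Vn _]] oW W0.
have [emn|nmn] := pselect (m = n).
  exists W; split=> // c [dc _ _ _] rs _; apply: arrow_ext => //=.
  by rewrite dc emn subrr.
pose E := [set x | (W `&` U `&` V) x /\ iter m T x <> iter n T x].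
have oE : open E.
  rewrite openE => x [[[Wx Ux] Vx] Tx].
  have := hX; rewrite open_hausdorff => /(_ (iter m T x) (iter n T x)).
  move=> /(_ (introN eqP Tx))[[P Q] [/= xP xQ] [oP oQ PQ]].
  have cm := proj1 (iter_nbhs (Um _ Ux)); have cn := proj1 (iter_nbhs (Vn _ Vx)).
  have hP : nbhs x (iter m T @^-1` P).
    by apply: cm; apply: open_nbhs_nbhs; split=> //; rewrite inE in xP.
  have hQ : nbhs x (iter n T @^-1` Q).
    by apply: cn; apply: open_nbhs_nbhs; split=> //; rewrite inE in xQ.
  have hWUV : nbhs x (W `&` U `&` V).
    by apply: open_nbhs_nbhs; split=> //; do 2 apply: openI => //.
  apply: filterS (filterI hWUV (filterI hP hQ)) => y [h [/= Py Qy]]; split=> //.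
  by move=> e; rewrite e in Py; move/eqP: PQ; rewrite -subset0 => /(_ _ (conj Py Qy)).
have [E0|nE0] := pselect (E !=set0).
  exists E; split=> // [x [[[]]]//|c [_ Uc Vc ec] rs [_]].
  by rewrite {2}rs ec.
exists W; split=> // c [_ Uc Vc _] rs Wc; exfalso.
have agree : W `&` U `&` V = set0.
  apply: (free m n nmn).
  - by do 2 apply: openI => //.
  - by move=> x [[_ /Um ?] /Vn ?].
  - by move=> x h; apply: contrapT => nx; apply: nE0; exists x.
have : (W `&` U `&` V) (range_of c) by split=> //; rewrite rs.
by rewrite agree.
Qed.

(** Shrinking [W] along a finite cover of [K] by basic sets removes the nontrivial loops. At a point
    [x] of the result, no arrow of [K] other than a unit has both ends at [x], and compactness of
    the non-units of [K] extends this to a neighbourhood of [(x, x)]. *)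
Lemma free_compact (K : set G) W : essentially_free T -> compact K ->
  open W -> W !=set0 ->
  exists W', [/\ open W', W' !=set0, W' `<=` W & forall c, K c ->
    W' (range_of c) -> W' (source_of c) -> units c].
Proof.
move=> free kK oW W0.
have /choice[B BP] : forall c : G, exists i, basic_indices T i /\ bopen T i c.
  by move=> c; have : (\bigcup_(i in basic_indices T) bopen T i) c;
    [rewrite basic_open_cover|case=> i ? ?; exists i].
have [|s [_ sK]] := compact_finite_nbhs (f := fun c => bopen T (B c)) kK.
  by move=> c _; apply: open_nbhs_nbhs; have [h1 h2] := BP c; split=> //;
    exact: basic_open_open.
have [W1 [oW1 [x W1x] W1W iso]] : exists W1, [/\ open W1, W1 !=set0, W1 `<=` W &
    forall a, a \in s -> forall c, bopen T (B a) c ->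
      range_of c = source_of c -> W1 (range_of c) -> units c].
  elim: (s) => [|a s' [W1 [oW1 W10 W1W h]]].
    by exists W; split.
  have [W2 [oW2 W20 W21 h2]] := free_basic_open free (proj1 (BP a)) oW1 W10.
  exists W2; split=> //; first exact: subset_trans W21 W1W.
  move=> a'; rewrite inE => /orP[/eqP-> //|a's c Bc rs W2c].
  exact: (h a' a's c Bc rs (W21 _ W2c)).
have kD : compact (K `\` @units X T).
  rewrite setDE; apply: compact_closedI => //; apply: open_closedC.
  by have [] := units_bisection T.
have far (y : X) (u : G -> X) (c : G) : continuous u -> u c <> y ->
    exists P Q : set _, [/\ nbhs c P, nbhs y Q & forall d w, P d -> Q w -> u d <> w].
  move=> cu cy; have := hX; rewrite open_hausdorff.
  move=> /(_ _ _ (introN eqP cy))[[P Q] [/= cP yQ] [oP oQ PQ]].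
  exists (u @^-1` P), Q; split.
  - by apply: cu; apply: open_nbhs_nbhs; split=> //; rewrite inE in cP.
  - by apply: open_nbhs_nbhs; split=> //; rewrite inE in yQ.
  move=> d w /= Pd Qw e; rewrite -e in Qw.
  by move/eqP: PQ; rewrite -subset0 => /(_ _ (conj Pd Qw)).
have : \forall yz \near nbhs (x, x), K `\` @units X T `<=`
    fun c => (range_of c, source_of c) <> yz.
  move/compact_near_coveringP: kD; apply => c [Kc nUc].
  have [rx|rx] := pselect (range_of c = x).
    have sx : source_of c <> x.
      move=> sx; apply: nUc; have [a sa Bc] := sK c Kc.
      by apply: (iso a sa c Bc); rewrite rx// sx.
    have [P [Q [cP xQ PQ]]] := far x _ c (@source_continuous _ T) sx.
    exists (P, setT `*` Q).
      by split=> //=; exists (setT, Q) => //; split=> //; exact: filterT.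
    by move=> [d [y z]] [/= Pd [_ Qz]] [_]; exact: PQ.
  have [P [Q [cP xQ PQ]]] := far x _ c (@range_continuous _ T) rx.
  exists (P, Q `*` setT).
    by split=> //=; exists (Q, setT) => //; split=> //; exact: filterT.
  by move=> [d [y z]] [/= Pd [Qy _]] [h _]; exact: (PQ _ _ Pd Qy h).
move=> [[P Q] /= [xP xQ] PQ].
exists (W1 `&` P° `&` Q°); split.
- by apply: openI; [apply: openI => //|]; exact: open_interior.
- by exists x.
- by move=> y [[/W1W]].
- move=> c Kc [[_ /interior_subset Pr] _] [_ /interior_subset Qs].
  apply: contrapT => nUc.
  exact: (PQ (range_of c, source_of c) (conj Pr Qs) c (conj Kc nUc)).
Qed.

(** On [W1] the function [f] exceeds [e] in modulus at the units, and its support has no other arrow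
    with both ends there, so $t f k = k^2$ for $t = k / f$. Hence $t b k$, a member of [J], is
    within $e^{-1} \cdot e/2$ of $k^2$, which acts as a unit on functions supported in [W];
    [ideal_absorbs] applies. *)
Lemma ideal_contains_local (J : set A) (b : A) : essentially_free T ->
  closed_ideal J -> J b -> ~ unit_null b ->
  exists W, [/\ open W, W !=set0 &
    forall phi, CcX phi -> csupp phi `<=` W -> J (iota (liftT phi))].
Proof.
move=> free JP Jb nb.
have [e [e0 he]] : exists e : R, 0 < e /\ forall d : R, 0 < d ->
    exists f, [/\ Cc f, `|iota f - b| < d%:C &
      exists x, e < Re `|f (aunit T x)|].
  apply: contrapT => h; apply: nb => e e0; apply: contrapT => h'.
  apply: h; exists e; split=> // d d0; apply: contrapT => h''; apply: h'.
  exists d => // f ff fb x; apply: contrapT => fx; apply: h''; exists f.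
  split=> //; exists x; rewrite ltNge; apply/negP => fe; apply: fx.
  by rewrite -Re_normc lecR.
have [f [ff fb [x0 fx0]]] := he (e / 2) (divr_gt0 e0 (ltr0n _ 2)).
have cfu := proj1 (CcX_restrict hX ff).
pose W0 := [set x | e < Re `|f (aunit T x)|].
have oW0 : open W0.
  apply: (@open_comp _ _ (fun x => Re `|f (aunit T x)|) [set t | e < t]).
    by move=> x _; exact: (continuous_normC cfu).
  exact: open_gt.
have [W1 [oW1 [x1 W1x] W1W W1u]] := free_compact free (proj2 ff) oW0 (ex_intro _ x0 fx0).
(* Two nested Urysohn functions: [W] is the set where [k0] is nonzero, and [k] equals 1 on its
   closure while still supported in [W1]. *)
have [|k0 [[ck0 kk0] _ k01 k0W]] := CcX_urysohn (R := R) hX lX (@compact_set1 _ x1) oW1.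
  by move=> _ ->.
have ck0' := continuous_real ck0.
have kL : compact (csupp k0).
  apply: csupp_compact kk0 _; first exact: closed_closure.
  move=> x nx; apply: csupp_out => h; apply: nx; apply: csupp_imp h => y [].
  by [].
have [k [Ck k01' k1 kW]] := CcX_urysohn (R := R) hX lX kL oW1 k0W.
pose W := k0 @^-1` [set t | t != 0].
exists W; split.
- by apply: open_comp; [move=> x _; exact: ck0'|exact: open_neq].
- by exists x1; rewrite /W /= k01// oner_neq0.
move=> phi Cphi phiW.
pose u x : C := f (aunit T x).
have u0 x : csupp k x -> e < Re `|u x| by move=> /kW/W1W.
have un0 x : csupp k x -> u x != 0.
  by move=> /u0 h; apply: contraTneq h => ->; rewrite normr0 -leNgt ltW.
pose kC x : R[i]^o := (k x)%:C; pose t x : R[i]^o := kC x / u x.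
have kCk : csupp kC `<=` csupp k by apply: csupp_imp => x; rewrite /kC => ->.
have Ct : CcX t.
  apply: (CcX_sub Ck); first by apply: csupp_imp => x kx; rewrite /t /kC kx mul0r.
  move=> x /kCk xk; apply: continuous_mulC; first exact: (proj1 Ck).
  by apply: (@cvgV C); [exact: un0|exact: cfu].
have tle x : `|t x| <= e^-1%:C.
  have [xk|/csupp_out kx] := pselect (csupp k x); last first.
    by rewrite /t /kC kx mul0r normr0 -[0]/(0%:C) lecR invr_ge0 ltW.
  rewrite normrM normfV /kC rc_norm -(Re_normc (u x)) -[_^-1](fmorphV (real_complex R)) -rcM.
  have h := u0 x xk; have /andP[h0 h1] := k01' x.
  rewrite lecR ger0_norm// ler_pdivrMr; last exact: lt_trans h.
  by rewrite (le_trans h1)// mulrC ler_pdivlMr// mul1r ltW.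
have kle x : `|kC x| <= 1%:C.
  by have /andP[h0 h1] := k01' x; rewrite rc_norm lecR ger0_norm.
pose tau := iota (liftT t); pose kap := iota (liftT kC).
have tau_le : `|tau| <= e^-1%:C.
  by apply: iota_lift_le => //; rewrite invr_ge0 ltW.
have kap_le : `|kap| <= 1%:C by exact: iota_lift_le.
have CLt : Cc (liftT t) by exact: Cc_lift.
have CLk : Cc (liftT kC) by exact: Cc_lift.
have Cfk : Cc (convolution f (liftT kC)) by exact: Cc_conv.
pose k2 x : R[i]^o := kC x * kC x.
have compress : convolution (liftT t) (convolution f (liftT kC)) = liftT k2.
  rewrite conv_liftl conv_liftr; apply/funext => c.
  have [Uc|nUc] := pselect (units c).
    rewrite Uc lift1 /= /k2 /t; set x := range_of c.
    have [xk|/csupp_out kx] := pselect (csupp k x).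
      by rewrite mulrA -/(u x) divfK// un0.
    by rewrite /kC kx !mul0r.
  rewrite lift0//; apply: contrapT => /eqP.
  rewrite !mulf_eq0 !negb_or => /andP[/andP[kr _] /andP[fc ks]].
  have kc x : kC x != 0 -> W1 x.
    by move=> h; apply/kW/kCk/subset_closure.
  by apply/nUc/(W1u c) => //; [exact: subset_closure|exact: kc|exact: kc].
have CLphi : Cc (liftT phi) by exact: Cc_lift.
have Ck2 : CcX k2.
  have := CcX_restrict hX (Cc_conv hX lX CLk CLk); rewrite conv_lift.
  by congr CcX; apply/funext => x; rewrite lift1.
have CLk2 : Cc (liftT k2) by exact: Cc_lift.
have [_ _ _ JM _] := JP.
apply: (@ideal_absorbs _ _ J _ (iota (liftT k2)) (cmul tau (cmul b kap)) JP).
- rewrite -(iotaM iotaP)// conv_lift; congr (iota (liftT _)).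
  apply/funext => x; rewrite /k2 /kC.
  have [xk|/csupp_out->] := pselect (csupp phi x); last by rewrite mul0r.
  rewrite k1 ?mulr1//; apply: subset_closure; exact: phiW.
- by apply: (proj1 (JM _ _ _)); exact: (proj2 (JM _ _ Jb)).
rewrite -compress (iotaM iotaP)// (iotaM iotaP)// -/tau -/kap -cmulBr -cmulBl.
apply: le_trans (cmul_norm_le _ _) _.
apply: (@le_trans _ _ (e^-1%:C * ((e / 2)%:C * 1%:C))).
  apply: ler_pM => //; apply: le_trans (cmul_norm_le _ _) _.
  by apply: ler_pM => //; exact: ltW.
rewrite mulr1 -rcM mulrA mulVf ?mul1r ?gt_eqF//.
by rewrite fmorphV/= rmorph_nat.
Qed.

(** A bump function [s] around [c], supported in a bisection with sources in [W], is unchanged by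
    right multiplication with some [k] supported in [W], so it is in [J]. The product $s s^*$ is
    then in [J], lives on the units and is nonzero at the range of [c]. *)
Lemma ideal_spreads (J : set A) W (c : G) : closed_ideal J -> open W ->
  (forall phi, CcX phi -> csupp phi `<=` W -> J (iota (liftT phi))) ->
  W (source_of c) ->
  exists rho, [/\ CcX rho, rho (range_of c) != 0 & J (iota (liftT rho))].
Proof.
move=> [_ _ _ JM _] oW JW Wc.
have [V [oV Vc bV]] := bisection_nbhd c.
have oV' : open (V `&` @source_of X T @^-1` W).
  by apply: openI => //; apply: open_comp => // d _; exact: source_continuous.
have [b [cb b01 b0 kb bO']] := @bump_exists R G hG
  (@arrow_locally_compact X T R hX lX) c _ oV' (conj Vc Wc).
pose s : Cf := fun d => (b d)%:C.
have sb : csupp s `<=` csupp b by apply: csupp_imp => d; rewrite /s => ->.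
have Cs : Cc s.
  split; first by move=> d; apply: continuous_rcC; exact: cb.
  by apply: csupp_compact kb _; [exact: closed_closure|
    move=> d nd; rewrite /s (csupp_out nd)].
have bs : bis_supp s by exists V => // d /sb/bO'[].
have Cis : Cc (involution s) by exact: Cc_involution.
have kS := compact_source (proj2 Cs).
have [|k [Ck _ k1 kW]] := CcX_urysohn (R := R) hX lX kS oW.
  by move=> _ [d /sb/bO'[_ Wd] <-].
have Js : J (iota s).
  have -> : s = convolution s (liftT (fun x => (k x)%:C)).
    rewrite conv_liftr; apply/funext => d.
    have [sd|/csupp_out->] := pselect (csupp s d); last by rewrite mul0r.
    by rewrite k1 ?mulr1//; exists d.
  have CLk : Cc (liftT (fun x => (k x)%:C)) by exact: Cc_lift.
  rewrite (iotaM iotaP)//; apply: (proj1 (JM _ _ _)).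
  by apply: JW => //; apply: subset_trans kW; apply: csupp_imp => x ->.
have Css : Cc (convolution s (involution s)) by exact: Cc_conv.
have si := bis_supp_range_inj bs; have ss := bis_supp_source_inj bs.
exists (fun x => convolution s (involution s) (aunit T x)); split.
- exact: CcX_restrict.
- have sc : s c <> 0 by move=> [h]; move: b0; rewrite h ltxx.
  rewrite (conv_range_inj _ si sc)//.
  have -> : amul (arrow_inv c) (aunit T (range_of c)) = arrow_inv c.
    by rewrite -[RHS]amul1r.
  by rewrite /involution arrow_invK mulf_neq0 ?conjC_eq0; apply/eqP.
have -> : liftT (fun x => convolution s (involution s) (aunit T x)) =
    convolution s (involution s).
  apply/funext => d; have [Ud|nUd] := pselect (units d).
    by rewrite [in RHS]Ud Ud lift1.
  rewrite lift0//; symmetry; apply: contrapT => /conv_support[a [ad sa sa']].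
  apply: nUd; have sa'' : s (arrow_inv (amul (arrow_inv a) d)) <> 0.
    by move=> h; apply: sa'; rewrite /involution h conjC0.
  have ra : source_of (arrow_inv a) = range_of d by [].
  have := ss _ _ sa sa''; rewrite /= amul_range// => /(_ erefl) e.
  have : arrow_inv a = amul (arrow_inv a) d by rewrite {1}e arrow_invK.
  move=> e'; have : amul a (arrow_inv a) = d by rewrite e' amulVKl.
  by move=> <-; rewrite amulVr.
by rewrite (iotaM iotaP)//; exact: (proj2 (JM _ _ Js)).
Qed.

Lemma ideal_lift_sum (J : set A) (s : seq X) (F : X -> X -> R[i]^o) :
  closed_ideal J ->
  (forall a, a \in s -> CcX (F a) /\ J (iota (liftT (F a)))) ->
  CcX (fun x => \sum_(a <- s) F a x) /\
  J (iota (liftT (fun x => \sum_(a <- s) F a x))).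
Proof.
(* Replacing the functions outside the list by 0 makes the hypotheses hold for every index, as
   [Cc_sum] and [iota_sum] require. *)
move=> [J0 JD _ _ _] FJ; pose F' a := if a \in s then F a else fun=> 0.
have -> : (fun x => \sum_(a <- s) F a x) = (fun x => \sum_(a <- s) F' a x).
  apply/funext => x; rewrite big_seq [RHS]big_seq; apply: eq_bigr => a sa.
  by rewrite /F' sa.
have l0 : liftT (fun=> 0) = fun=> 0.
  by apply/funext => c; rewrite /lift; case: asboolP.
have CJ a : Cc (liftT (F' a)) /\ J (iota (liftT (F' a))).
  rewrite /F'; case: (boolP (a \in s)) => [/FJ[? ?]|_].
    by split=> //; exact: Cc_lift.
  rewrite l0; split; first exact: Cc0.
  have := iotaZ iotaP 0 (Cc0 T (R := R)); rewrite scale0r.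
  have -> : (fun a => 0 * 0) = (fun=> 0) :> Cf by apply/funext => c; rewrite mul0r.
  by move=> ->.
have E : liftT (fun x => \sum_(a <- s) F' a x) = fun c => \sum_(a <- s) liftT (F' a) c.
  apply/funext => c; rewrite /lift; case: asboolP => // _.
  by rewrite big1.
have CS : Cc (fun c => \sum_(a <- s) liftT (F' a) c).
  by apply: Cc_sum => a; exact: (proj1 (CJ a)).
split.
  have := CcX_restrict hX CS; congr CcX; apply/funext => x.
  by apply: eq_bigr => a _; rewrite lift1.
rewrite E iota_sum//; last by move=> a; exact: (proj1 (CJ a)).
by elim/big_ind: _ => // a _; exact: (proj2 (CJ a)).
Qed.

(** Every [x] has a function [rho] in [J] that is nonzero near it, and a function supported where
    [rho] does not vanish is a multiple of [rho]. Over the ranges of the support of [f], a partition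
    of unity made of such multiples gives a left unit for [f] inside [J]; density does the rest. *)
Lemma ideal_full (J : set A) W :
  (forall U y, open U -> U !=set0 ->
    exists m n : nat, iter_dom T n y /\ iter_image T m U (iter n T y)) ->
  closed_ideal J -> open W -> W !=set0 ->
  (forall phi, CcX phi -> csupp phi `<=` W -> J (iota (liftT phi))) ->
  J = setT.
Proof.
move=> minimal JP oW W0 JW; have [_ _ _ JM cJ] := JP.
have cover x : exists rho, [/\ CcX rho, rho x != 0 & J (iota (liftT rho))].
  have [m [n [xn [y [Wy ym] e]]]] := minimal W x oW W0.
  (* The relation $T^n x = T^m y$ with [y] in [W] is the arrow $(x, n - m, y)$ along which the ideal
     is moved. *)
  have p : exists m' n' : nat, [/\ n%:Z - m%:Z = m'%:Z - n'%:Z, iter_dom T m' x,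
    iter_dom T n' y & iter m' T x = iter n' T y] by exists n, m.
  exact: (@ideal_spreads J W (Arrow p) JP oW JW Wy).
suff JC f : Cc f -> J (iota f).
  apply/seteqP; split=> // a _; apply: cJ.
  have : closure (iota @` Cc) a by rewrite (iota_dense iotaP).
  by apply: closure_subset => _ [f ff <-]; exact: JC.
move=> ff; have kr := compact_range (proj2 ff).
pose P (O : set X) := exists rho, [/\ CcX rho, forall x, O x -> rho x != 0 &
  J (iota (liftT rho))].
have [|s [chi [chiP sum1 _]]] := @partition_of_unity R X hX lX _ P kr.
  move=> x _; have [rho [Crho rhox Jrho]] := cover x.
  have nE (z : R[i]^o) : (Re `|z| != 0) = (z != 0).
    by rewrite -(normr_eq0 z) -[in RHS](Re_normc z) (inj_eq (@complexI R) _ 0).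
  exists ((fun x => Re `|rho x|) @^-1` [set t | t != 0]); split.
  - apply: open_comp; last exact: open_neq.
    by move=> y _; exact: (continuous_normC (proj1 Crho)).
  - by rewrite /= nE.
  - by exists rho; split=> // y; rewrite /= nE.
have [|Ck Jk] := @ideal_lift_sum J s (fun a x => (chi a x)%:C * (chi a x)%:C) JP.
  move=> a /chiP[cchi _ kchi [V [_ [rho [Crho rho0 Jrho]] chiO]]].
  have Cchi : CcX (fun x => (chi a x)%:C : R[i]^o).
    split; first by move=> x; apply: continuous_rcC; exact: cchi.
    by apply: csupp_compact kchi _; [exact: closed_closure|
      move=> d nd; rewrite (csupp_out nd)].
  have cC : csupp (fun x => (chi a x)%:C : R[i]^o) `<=` csupp (chi a).
    by apply: csupp_imp => x ->.
  have Csq : CcX (fun x => (chi a x)%:C * (chi a x)%:C : R[i]^o).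
    apply: (CcX_sub Cchi); first by apply: csupp_imp => x ->; rewrite mul0r.
    by move=> x _; apply: continuous_mulC; exact: (proj1 Cchi).
  split=> //.
  pose psi x : R[i]^o := (chi a x)%:C * (chi a x)%:C / rho x.
  have Cpsi : CcX psi.
    apply: (CcX_sub Cchi).
      by apply: csupp_imp => x h; rewrite /psi h !mul0r.
    move=> x /cC/chiO/rho0 rx; apply: continuous_mulC.
      by apply: continuous_mulC; exact: (proj1 Cchi).
    by apply: (@cvgV C); [exact: rx|exact: (proj1 Crho)].
  have -> : liftT (fun x => (chi a x)%:C * (chi a x)%:C) =
      convolution (liftT psi) (liftT rho).
    rewrite conv_lift; congr (liftT _); apply/funext => x; rewrite /psi.
    have [/chiO/rho0 rx|/csupp_out->] := pselect (csupp (chi a) x).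
      by rewrite divfK.
    by rewrite !mul0r.
  rewrite (iotaM iotaP); [|exact: Cc_lift..].
  exact: (proj1 (JM _ _ Jrho)).
set kap := fun x => \sum_(a <- s) _ in Ck Jk.
have -> : f = convolution (liftT kap) f.
  rewrite conv_liftl; apply/funext => c.
  have [fc|/csupp_out->] := pselect (csupp f c); last by rewrite mulr0.
  rewrite /kap (_ : \sum_(a <- s) _ = 1) ?mul1r//.
  have <- : (\sum_(a <- s) chi a (range_of c) ^+ 2)%:C = 1 :> C.
    by rewrite sum1//; exists c.
  by rewrite rc_sum; apply: eq_bigr => a _; rewrite rcX expr2.
have CLk : Cc (liftT kap) by exact: Cc_lift.
by rewrite (iotaM iotaP)//; exact: (proj2 (JM _ _ Jk)).
Qed.

(** By [coef_le_norm], a function equal to 1 at some unit has norm at least 1. *)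
Lemma cstar_nontrivial : [set: X] !=set0 -> exists a : A, a != 0.
Proof.
move=> [x _]; have [|k [Ck _ k1 _]] :=
  CcX_urysohn (R := R) hX lX (@compact_set1 _ x) openT; first exact: subsetT.
have CLk : Cc (liftT (fun x => (k x)%:C)) by exact: Cc_lift.
exists (iota (liftT (fun x => (k x)%:C))); rewrite -normr_gt0.
have := coef_le_norm hX lX iotaP (aunit T x) CLk.
by rewrite lift1 k1// normr1; apply: lt_le_trans.
Qed.

End Simplicity.

Theorem proposition2p5 (R : realType) (X : topologicalType) (T : sgds X)
    (X_nonempty : [set: X] !=set0)
    (X_hausdorff : hausdorff_space X)
    (X_second_countable : @second_countable X)
    (X_locally_compact : locally_compact [set: X])
    (T_free : essentially_free T)
    (T_minimal : forall (U : set X) (x : X), open U -> U !=set0 ->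
      exists m n : nat, iter_dom T n x /\ iter_image T m U (iter n T x))
    (A : cstarAlgebra R) (iota : (arrow T -> (R[i])^o) -> A)
    (A_cstar : is_groupoid_cstar iota) :
  simple_cstar A.
Proof.
split; first exact: (cstar_nontrivial X_hausdorff X_locally_compact A_cstar).
move=> J JP; have [[b [Jb nb]]|null] :=
    pselect (exists b, J b /\ ~ @unit_null _ _ _ _ iota b).
  right; have [W [oW W0 JW]] := ideal_contains_local X_hausdorff
    X_locally_compact A_cstar T_free JP Jb nb.
  exact: (ideal_full X_hausdorff X_locally_compact A_cstar T_minimal JP oW W0 JW).
left; have [J0 _ _ _ _] := JP; apply/seteqP; split=> [a Ja|_ -> //].
apply: (unit_null_ideal_eq0 X_hausdorff X_locally_compact A_cstar JP) Ja => b Jb.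
by apply: contrapT => nb; apply: null; exists b.
Qed.
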